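(* Let $(P_t)$ be a family of probability distributions on $(\Omega,\mathcal{A})$ indexed by a real parameter $t$, let $\vartheta_0\in\mathbb{R}$ be fixed, let $\Theta\subset\mathbb{R}$ with $0\in\Theta$, and for $\vartheta\in\Theta$ put $P_{n,\vartheta}:=P^{n}_{\vartheta_0+\vartheta/\sqrt{n}}$ on $(\Omega^n,\mathcal{A}^n)$. Suppose that LAN holds for the parameter set $\Theta$ with $\sigma>0$ and central sequence $X_n:\Omega^n\to\mathbb{R}$, and that the closure $\overline{\Theta}$ of $\Theta$ in $\mathbb{R}$ has non-empty interior. Let $T_n:\Omega^n\to\mathbb{R}$ be a sequence of $\Theta$-regular estimators, i.e. there is a probability distribution $Q$ on $\mathbb{R}$ such that $\mathcal{L}(\sqrt{n}(T_n-\vartheta_0)\,|\,P_{n,\vartheta})\to Q\ast\varepsilon_\vartheta$ weakly for each $\vartheta\in\Theta$. Then: (a) For each $\vartheta\in\Theta$ the random vectors $$\Big(X_n,\ \sqrt{n}(T_n-\vartheta_0)-\frac{X_n}{\sigma^2}\Big)$$ converge in distribution under $P_{n,\vartheta}$ to a pair of independent random variables $(X,Z)$ on $\mathbb{R}^2$. Let $\nu$ denote the weak limit distribution of the second component under $\vartheta=0$, i.e. $$\mathcal{L}\Big(\sqrt{n}(T_n-\vartheta_0)-\frac{X_n}{\sigma^2}\,\Big|\,P_{n,0}\Big)\to\nu .$$ Then this convergence also holds under $P_{n,\vartheta}$ with the same limit $\nu$, independent of $\vartheta\in\Theta$. (b) For fixed $\vartheta\in\Theta$ the limit distribution under $P_{n,\vartheta}$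 of the random vectors in (a) is $N(\vartheta\sigma^2,\sigma^2)\otimes\nu$, and the convolution theorem $$Q\ast\varepsilon_\vartheta=\nu\ast N\Big(\vartheta,\frac{1}{\sigma^2}\Big)$$ holds for all $\vartheta\in\Theta$. (c) The sequence $T_n$ is asymptotically efficient at $\vartheta_0$, i.e. $\sqrt{n}(T_n-\vartheta_0)-\frac{X_n}{\sigma^2}\to 0$ in $P_{n,0}$-probability, if and only if the weak limit $Q\ast\varepsilon_\vartheta$ of $\sqrt{n}(T_n-\vartheta_0)$ with respect to $P_{n,\vartheta}$ is $N(\vartheta,\frac{1}{\sigma^2})$ for at least one $\vartheta\in\Theta$.
   Context: $\varepsilon_x$ denotes the Dirac measure at $x$, $\ast$ is convolution, $\mathcal{L}(Y|P)$ is the distribution of $Y$ under $P$, and $N(m,s^2)$ is the normal distribution with mean $m$ and variance $s^2$. The measure $P^n$ is the $n$-fold product of $P$; the parameters $\vartheta_0+\vartheta/\sqrt n$ are understood to belong to the index set of the family. LAN (local asymptotic normality) for $\Theta$ means: there exist $\sigma>0$ and random variables $X_n:\Omega^n\to\mathbb{R}$ (the central sequence) such that $$\log\frac{dP_{n,\vartheta}}{dP_{n,0}}-\Big[\vartheta X_n-\frac{\vartheta^2\sigma^2}{2}\Big]\to 0\quad\text{in }P_{n,0}\text{-probability for every }\vartheta\in\Theta,$$ and $\mathcal{L}(X_n|P_{n,0})\to N(0,\sigma^2)$ weakly as $n\to\infty$. Here $dP_{n,\vartheta}/dP_{n,0}$ denotes the likelihood ratio (density of the absolutely continuous part). *)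

(* Defs.v *)
From HB Require Import structures.
From mathcomp Require Import all_boot all_order all_algebra.
From mathcomp Require Import all_classical all_reals all_analysis.
From mathcomp Require Import measurable_realfun giry.

Set Implicit Arguments.
Unset Strict Implicit.
Unset Printing Implicit Defensive.

Import Order.TTheory GRing.Theory Num.Theory.
Import numFieldNormedType.Exports.

Local Open Scope classical_set_scope.
Local Open Scope ring_scope.

Section pairing.
Context d d1 d2 (T : measurableType d) (T1 : measurableType d1)
  (T2 : measurableType d2).

Definition pair_fun (f : T -> T1) (g : T -> T2) : T -> T1 * T2 :=
  fun x => (f x, g x).

Variables (f : {mfun T >-> T1}) (g : {mfun T >-> T2}).

Let measurable_pair_fun : measurable_fun [set: T] (pair_fun f g).
Proof. by apply: measurable_fun_pair; exact: measurable_funPT. Qed.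

HB.instance Definition _ :=
  isMeasurableFun.Build _ _ _ _ (pair_fun f g) measurable_pair_fun.

End pairing.

Section power.
Context d (T : measurableType d) (R : realType).

Definition tuple_cons n (x : T * n.-tuple T) : n.+1.-tuple T :=
  [tuple of x.1 :: x.2].

Let measurable_tuple_cons n : measurable_fun [set: T * n.-tuple T] (@tuple_cons n).
Proof. exact: measurable_cons. Qed.

HB.instance Definition _ n :=
  isMeasurableFun.Build _ _ _ _ (@tuple_cons n) (@measurable_tuple_cons n).

(* The n-fold product measure on n.-tuple T, which carries the sigma-algebra
   generated by the coordinates; [power_probE] characterizes it. *)
Fixpoint power_prob (P : probability T R) (n : nat) : probability (n.-tuple T) R :=
  match n with
  | 0 => dirac [tuple]
  | m.+1 => distribution (P \x power_prob P m)%E (@tuple_cons m)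
  end.

Lemma power_probE (P : probability T R) n (A : 'I_n -> set T) :
  (forall i, measurable (A i)) ->
  power_prob P n [set x | forall i, A i (tnth x i)] = (\prod_(i < n) P (A i))%E.
Proof.
elim: n A => [|n IHn] A mA.
  rewrite big_ord0 /= diracE mem_set//.
  by case.
rewrite big_ord_recl /= -(IHn (fun i => A (lift ord0 i)))// -product_measure1E//.
  rewrite /distribution /pushforward /=; congr (product_measure1 _ _ _).
  apply/seteqP; split => [[x t] /= Axt|[x t] /= [Ax At] i].
    split=> [|i]; first by have := Axt ord0.
    by have := Axt (lift ord0 i); rewrite /tuple_cons /= tnthS.
  by case: (unliftP ord0 i) => [j ->|->]; rewrite /tuple_cons ?tnthS.
rewrite (_ : [set _ | _] = \bigcap_(i in [set: 'I_n])
    ((fun t : n.-tuple T => tnth t i) @^-1` A (lift ord0 i))).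
  apply: fin_bigcap_measurable => // i _.
  by rewrite -[X in measurable X]setTI; exact: measurable_tnth.
by apply/seteqP; split => t /= At i; [move=> _; exact: At|exact: At].
Qed.

End power.

Section weak_convergence.
Context (R : realType).

Definition weak_cvg (mu : nat -> probability R R) (nu : probability R R) :=
  forall f : R -> R, continuous f -> (exists M, forall x, `|f x| <= M) ->
    (\int[mu n]_x (f x)%:E)%E @[n --> \oo] --> (\int[nu]_x (f x)%:E)%E.

Definition weak_cvg2 (mu : nat -> probability (R * R)%type R)
    (nu : probability (R * R)%type R) :=
  forall f : R * R -> R, continuous f -> (exists M, forall x, `|f x| <= M) ->
    (\int[mu n]_x (f x)%:E)%E @[n --> \oo] --> (\int[nu]_x (f x)%:E)%E.

End weak_convergence.

Section convolution.
Context (R : realType).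

Definition add_pair (x : R * R) : R := x.1 + x.2.

Let measurable_add_pair : measurable_fun [set: R * R] add_pair.
Proof. exact: measurable_funD. Qed.

HB.instance Definition _ :=
  isMeasurableFun.Build _ _ _ _ add_pair measurable_add_pair.

Definition convolution (mu nu : probability R R) : probability R R :=
  distribution (mu \x nu)%E add_pair.

End convolution.

(* [normal_prob] is a measure on [measurableTypeR R], whose sigma-algebra is
   that of R but whose display differs; it is transported along the identity to
   the measurable structure on R used for random variables.  The second
   parameter is the standard deviation. *)
Section normal_law.
Context (R : realType).

Definition idTR (x : measurableTypeR R) : R := x.

Let measurable_idTR : measurable_fun [set: measurableTypeR R] idTR.
Proof. by move=> _ A mA; rewrite setTI. Qed.

HB.instance Definition _ :=
  isMeasurableFun.Build _ _ _ _ idTR measurable_idTR.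

Definition normal_law (m s : R) : probability R R :=
  distribution (normal_prob m s) idTR.

Lemma normal_lawE (m s : R) (A : set R) : normal_law m s A = normal_prob m s A.
Proof. by []. Qed.

End normal_law.

Definition independent_rv d (T : measurableType d) (R : realType)
    (P : probability T R) (X Y : {RV P >-> R}) :=
  forall A B : set R, measurable A -> measurable B ->
    P (X @^-1` A `&` Y @^-1` B) = (P (X @^-1` A) * P (Y @^-1` B))%E.

(* L is a version of the density with respect to P of the absolutely continuous
   part in the Lebesgue decomposition of Q; the singular part is Q restricted to
   the P-null set N. *)
Definition is_likelihood_ratio d (T : measurableType d) (R : realType)
    (Q P : probability T R) (L : T -> \bar R) :=
  [/\ measurable_fun [set: T] L,
      (forall x, 0 <= L x)%E &
      exists N, [/\ measurable N, P N = 0%E &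
        forall A, measurable A ->
          Q A = (\int[P]_(x in A) L x + Q (A `&` N))%E] ].

Section experiments.
Context d (Omega : measurableType d) (R : realType).

(* The values of Y are extended reals so that the logarithm of a vanishing
   likelihood ratio is covered. *)
Definition cvg_in_prob0 (P : forall n, probability (n.-tuple Omega) R)
    (Y : forall n, n.-tuple Omega -> \bar R) :=
  forall e : R, 0 < e -> P n [set x | e%:E < `|Y n x|]%E @[n --> \oo] --> 0%E.

(* At n = 0, where division by 0 yields 0, all the local measures are the point
   mass on the one-point space 0.-tuple Omega. *)
Definition local_prob (P : R -> probability Omega R) (theta0 theta : R) (n : nat)
  : probability (n.-tuple Omega) R :=
  power_prob (P (theta0 + theta / Num.sqrt n%:R)) n.

Definition LAN (P : R -> probability Omega R) (theta0 : R) (Theta : set R)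
    (sigma : R) (X : forall n, {mfun n.-tuple Omega >-> R}) :=
  [/\ 0 < sigma,
      (forall theta, Theta theta ->
        exists L : forall n, n.-tuple Omega -> \bar R,
          (forall n, is_likelihood_ratio (local_prob P theta0 theta n)
                       (local_prob P theta0 0 n) (L n)) /\
          cvg_in_prob0 (local_prob P theta0 0) (fun n x =>
            (lne (L n x)
             - (theta * X n x - theta ^+ 2 * sigma ^+ 2 / 2)%:E)%E)) &
      weak_cvg (fun n => distribution (local_prob P theta0 0 n) (X n))
        (normal_law 0 sigma)].

Section normalized_error.
Variables (theta0 sigma : R) (n : nat).

Definition norm_error (T : n.-tuple Omega -> R) : n.-tuple Omega -> R :=
  fun x => Num.sqrt n%:R * (T x - theta0).

Definition norm_rest (X T : n.-tuple Omega -> R) : n.-tuple Omega -> R :=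
  fun x => norm_error T x - X x / sigma ^+ 2.

Variables X T : {mfun n.-tuple Omega >-> R}.

Let measurable_norm_error : measurable_fun [set: n.-tuple Omega] (norm_error T).
Proof. by apply: measurable_funM => //; apply: measurable_funB. Qed.

HB.instance Definition _ :=
  isMeasurableFun.Build _ _ _ _ (norm_error T) measurable_norm_error.

Let measurable_norm_rest : measurable_fun [set: n.-tuple Omega] (norm_rest X T).
Proof. by apply: measurable_funB => //; apply: measurable_funM. Qed.

HB.instance Definition _ :=
  isMeasurableFun.Build _ _ _ _ (norm_rest X T) measurable_norm_rest.

End normalized_error.

Definition regular_estimators (P : R -> probability Omega R) (theta0 : R)
    (Theta : set R) (T : forall n, {mfun n.-tuple Omega >-> R})
    (Q : probability R R) :=
  forall theta, Theta theta ->
    weak_cvg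
      (fun n => distribution (local_prob P theta0 theta n) (norm_error theta0 (T n)))
      (convolution Q (dirac theta)).

Definition asymptotically_efficient (P : R -> probability Omega R) (theta0 : R)
    (sigma : R) (X T : forall n, {mfun n.-tuple Omega >-> R}) :=
  cvg_in_prob0 (local_prob P theta0 0)
    (fun n x => (norm_rest theta0 sigma (X n) (T n) x)%:E).

End experiments.

(* Main.v *)
Require Import Defs.
From HB Require Import structures.
From mathcomp Require Import all_boot all_order all_algebra.
From mathcomp Require Import all_classical all_reals all_analysis.
From mathcomp Require Import measurable_realfun giry.
From mathcomp Require Import ring lra.

Set Implicit Arguments.
Unset Strict Implicit.
Unset Printing Implicit Defensive.

Import Order.TTheory GRing.Theory Num.Theory.
Import numFieldNormedType.Exports.

Local Open Scope classical_set_scope.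
Local Open Scope ring_scope.

(** Write [Y] for the normalized error of the estimator, [X] for the central
    sequence and [Z = Y - X / sigma ^+ 2] for the remainder.  Under the measure of
    parameter [0] the likelihood ratio of parameter [theta] is close to
    [expR (theta * X - theta ^+ 2 * sigma ^+ 2 / 2)].  Regularity, tested with
    [cos (u * y)] and [sin (u * y)], therefore says that for each [theta] the
    expectation of [exp (i u Y + theta X)] has the limit
      [exp (theta ^ 2 sigma ^ 2 / 2 + i u theta) * chf Q u].
    As a function of [theta] this is, up to a factor [r u] that does not depend on
    [theta], the expectation of [exp (i u N / sigma ^ 2 + theta N)] for a normal
    variable [N] with mean 0 and variance [sigma ^ 2]; here [r u] is the quotient
    of the characteristic functions of [Q] and of [N / sigma ^ 2], the latter
    having no zeros ([normal_chf_neq0]).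

    The exponentials [x |-> expR (theta * x)], with [theta] in a set whose closure
    has interior points, determine the integrals of all continuous functions of
    exponential growth, also asymptotically ([exp_functional_vanish] and
    [exponentials_determine]).  So the weight [exp (theta X)] may be replaced by
    [exp (- i u X / sigma ^ 2) * h X] for an arbitrary [h], and the expectation of
    [exp (i u Z) * h X] tends to [r u] times the expectation of [h N].  Hence [X]
    and [Z] are asymptotically independent, and [r] is the characteristic function
    of a law [nu], which [helly] provides; this is [rest_limit].  The
    completeness statement concerns sequences of functionals, so that no
    subsequence along which the pairs converge has to be chosen.

    Two gaps separate this from the theorem.  The variables [X] converge in law
    only and need not have exponential moments: they are clamped at a level that
    tends to infinity so slowly that the exponential moments stay bounded
    ([exists_truncation]).  The likelihood ratios describe only the absolutely
    continuous parts, and approximate the exponentials only in probability: since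
    the exponentials have total mass tending to 1, nothing is lost in the limit
    ([le_cam]).  A second use of [le_cam] transports the joint limit to every
    [theta], where it changes the law of the first coordinate to a shifted normal
    law and leaves [nu] alone ([regular_limit]).

    The convolution identity is the image of the joint limit under
    [(x, z) |-> z + x / sigma ^+ 2].  Efficiency means that [nu] is the point mass
    at 0, and since the characteristic function of a normal law has no zeros this
    is the case as soon as one of the convolutions with [nu] is the normal law
    itself ([convolution_cancel]). *)

(** * Uniform continuity and polynomial approximation *)

(** Only the first of the two points has to lie in the compact set, so that
    grid points just outside it are covered. *)
Lemma heine_cantor (R : realType) (U : pseudoMetricType R) (K : set U)
    (f : U -> R) (e : R) :
  compact K -> continuous f -> 0 < e ->
  exists2 d : R, 0 < d & forall x y, K x -> ball x d y -> `|f x - f y| < e.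
Proof.
move=> /compact_near_coveringP cK cf e0.
have e20 : 0 < e / 2 by rewrite divr_gt0.
have : \forall d \near 0^'+, K `<=` fun x => forall y, ball x d y -> `|f x - f y| < e.
  apply: cK => x Kx.
  have /cvgrPdist_lt/(_ _ e20)/nbhs_ballP[r /= r0 hr] := cf x.
  have r20 : 0 < r / 2 by rewrite divr_gt0.
  exists (ball x (r / 2), [set d | 0 < d < r / 2]) => /=.
    split; first exact: nbhsx_ballx.
    near=> d; apply/andP; split; first by near: d; exact: nbhs_right_gt.
    by near: d; exact: nbhs_right_lt.
  move=> [x' d] /= [xx' /andP[d0 dr]] y x'y.
  have h1 : `|f x - f x'| < e / 2.
    by apply: hr => /=; apply: le_ball xx'; lra.
  have h2 : `|f x - f y| < e / 2.
    apply: hr => /=; rewrite [r]splitr; apply: ball_triangle xx' _.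
    by apply: le_ball x'y; exact: ltW.
  rewrite (_ : f x' - f y = (f x' - f x) + (f x - f y)); last by ring.
  rewrite [e]splitr (le_lt_trans (ler_normD _ _))// ltrD//.
  by rewrite distrC.
rewrite near_withinE => /nbhs_ballP[r /= r0 hr].
exists (r / 2); first by rewrite divr_gt0.
move=> x y Kx xy; apply: (hr (r / 2)) => //=; last by rewrite divr_gt0.
by rewrite /ball/= sub0r normrN gtr0_norm ?divr_gt0// ltr_pdivrMr// ltr_pMr// ltr1n.
Unshelve. all: by end_near. Qed.

Section weierstrass.
Variable R : realType.

(** The Bernstein polynomial of the values [f 0], ..., [f n], read as the
    expectation of [f] at a sum of [n] Bernoulli variables and computed by
    conditioning on the first of them: the first two moments then follow by
    induction, without binomial coefficients. *)
Fixpoint bernstein (n : nat) (f : nat -> R) : {poly R} :=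
  if n is m.+1 then 'X * bernstein m (f \o S) + (1 - 'X) * bernstein m f
  else (f 0%N)%:P.

Lemma bernsteinS n f x : (bernstein n.+1 f).[x] =
  x * (bernstein n (f \o S)).[x] + (1 - x) * (bernstein n f).[x].
Proof. by rewrite /= !hornerE. Qed.

Lemma bernsteinD n f g x :
  (bernstein n (f \+ g)).[x] = (bernstein n f).[x] + (bernstein n g).[x].
Proof.
elim: n f g => [|n IH] f g; first by rewrite /= !hornerE.
rewrite !bernsteinS IH (_ : (f \+ g) \o S = (f \o S) \+ (g \o S))// IH; ring.
Qed.

Lemma bernsteinZ n a f x :
  (bernstein n (fun k => a * f k)).[x] = a * (bernstein n f).[x].
Proof.
elim: n f => [|n IH] f; first by rewrite /= !hornerE.
rewrite !bernsteinS IH (_ : (fun k => a * f k) \o S = fun k => a * (f \o S) k)//.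
by rewrite IH; ring.
Qed.

Lemma bernstein_cst n c x : (bernstein n (fun=> c)).[x] = c.
Proof.
elim: n => [|n IH]; first by rewrite /= hornerE.
by rewrite bernsteinS (_ : (fun=> c) \o S = fun=> c)// IH; ring.
Qed.

Lemma bernstein_id n x : (bernstein n (fun k => k%:R)).[x] = n%:R * x.
Proof.
elim: n => [|n IH]; first by rewrite /= hornerE mul0r.
rewrite bernsteinS (_ : _ \o S = (fun k => k%:R) \+ fun=> 1); last first.
  by apply/funext => k /=; rewrite -natr1.
by rewrite bernsteinD IH bernstein_cst -natr1; ring.
Qed.

Lemma bernstein_sqr n x :
  (bernstein n (fun k => k%:R ^+ 2)).[x] = n%:R * x * (1 - x) + (n%:R * x) ^+ 2.
Proof.
elim: n => [|n IH]; first by rewrite /= hornerE; ring.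
rewrite bernsteinS (_ : _ \o S = (fun k => k%:R ^+ 2) \+
  ((fun k => 2 * k%:R) \+ fun=> 1)); last first.
  by apply/funext => k /=; rewrite -natr1; ring.
rewrite !bernsteinD bernsteinZ bernstein_id IH bernstein_cst -natr1; ring.
Qed.

Lemma le_bernstein n f g x : 0 <= x <= 1 -> (forall k, (k <= n)%N -> f k <= g k) ->
  (bernstein n f).[x] <= (bernstein n g).[x].
Proof.
move=> /andP[x0 x1]; elim: n f g => [|n IH] f g fg.
  by rewrite /= !hornerE fg.
rewrite !bernsteinS lerD// ler_wpM2l ?subr_ge0// IH// => k kn; apply: fg => //.
exact: leqW.
Qed.

(** Bernstein's argument: [`|G x - G y| <= e / 2 + C * (y - x) ^+ 2] on the unit
    interval, and the expectation of the quadratic term is a variance of order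
    [1 / n]. *)
Lemma weierstrass (G : R -> R) (e : R) : continuous G -> 0 < e ->
  exists p : {poly R}, forall x : R, 0 <= x <= 1 -> `|G x - p.[x]| <= e.
Proof.
move=> cG e0; have e20 : 0 < e / 2 by rewrite divr_gt0.
have [d d0 hd] := heine_cantor (@segment_compact R 0 1) cG e20.
have [B hB] : exists B : R, forall x : R, 0 <= x <= 1 -> `|G x| <= B.
  have [] := @EVT_max R (fun x => `|G x|) 0 1 ler01.
    by apply: continuous_subspaceT => x; apply: cvg_norm; exact: cG.
  by move=> c _ hc; exists `|G c| => x x01; apply: hc; rewrite in_itv.
have B0 : 0 <= B by apply: (le_trans (normr_ge0 (G 0))); apply: hB; rewrite lexx ler01.
(* makes the variance term at most [e / 2] *)
pose n := (Num.truncn (4 * B / (d ^+ 2 * e))).+1.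
have n0 : 0 < n%:R :> R by rewrite ltr0n.
have nB : 4 * B <= n%:R * (d ^+ 2 * e).
  rewrite -ler_pdivrMr; last by rewrite mulr_gt0// exprn_gt0.
  by apply: ltW; exact: truncnS_gt.
exists (bernstein n (fun k => G (k%:R / n%:R))) => x x01.
have /andP[x0 x1] := x01.
pose q k := 2 * B / d ^+ 2 * (k%:R / n%:R - x) ^+ 2 : R.
have main k : (k <= n)%N -> `|G x - G (k%:R / n%:R)| <= e / 2 + q k.
  move=> kn; have k01 : 0 <= (k%:R / n%:R : R) <= 1.
    by rewrite divr_ge0//= ler_pdivrMr// mul1r ler_nat.
  have q0 : 0 <= q k by rewrite /q mulr_ge0 ?sqr_ge0// divr_ge0 ?sqr_ge0// mulr_ge0.
  have [xk|xk] := ltP `|x - k%:R / n%:R| d.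
    apply: ltW; rewrite (lt_le_trans (hd x _ _ xk)) ?lerDl//.
  rewrite (le_trans (ler_normB _ _))// (@le_trans _ _ (2 * B))//.
    by rewrite mulr2n mulrDl !mul1r lerD ?hB.
  apply: (@le_trans _ _ (q k)); last by rewrite lerDr ltW.
  have dd : d ^+ 2 != 0 by rewrite gt_eqF// exprn_gt0.
  rewrite /q -[leLHS](divfK dd) ler_wpM2l ?divr_ge0 ?sqr_ge0 ?mulr_ge0//.
  by rewrite -[leRHS]real_normK ?num_real// distrC lerXn2r ?nnegrE// ltW.
have qE : (bernstein n q).[x] = 2 * B / d ^+ 2 * (x * (1 - x) / n%:R).
  rewrite (_ : q = fun k => 2 * B / d ^+ 2 * (((fun k => n%:R ^- 2 * k%:R ^+ 2) \+
     ((fun k => (- (2 * x / n%:R)) * k%:R) \+ (fun=> x ^+ 2))) k)); last first.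
    by apply/funext => k; rewrite /q/=; field; apply/andP; split; exact: lt0r_neq0.
  rewrite bernsteinZ !bernsteinD !bernsteinZ bernstein_sqr bernstein_id bernstein_cst.
  by field; apply/andP; split; exact: lt0r_neq0.
have qe : (bernstein n q).[x] <= e / 2.
  rewrite qE; apply: (@le_trans _ _ (2 * B / d ^+ 2 * (1 / n%:R))).
    rewrite ler_wpM2l//; first by rewrite divr_ge0 ?sqr_ge0 ?mulr_ge0.
    rewrite ler_pM2r ?invr_gt0// -[leRHS]mulr1 ler_pM ?subr_ge0//.
    by rewrite gerBl.
  rewrite mulrA ler_pdivrMr// mulr1 ler_pdivrMr ?exprn_gt0//; lra.
have sumE : (bernstein n (fun k => e / 2 + q k)).[x] <= e.
  rewrite (_ : (fun k => _) = (fun=> e / 2) \+ q)// bernsteinD bernstein_cst; lra.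
have GE : G x - (bernstein n (fun k => G (k%:R / n%:R))).[x] =
    (bernstein n (fun k => G x - G (k%:R / n%:R))).[x].
  rewrite (_ : (fun k => G x - _) = (fun=> G x) \+ (fun k => -1 * G (k%:R / n%:R))).
    by rewrite bernsteinD bernstein_cst bernsteinZ mulN1r.
  by apply/funext => k /=; rewrite mulN1r.
rewrite GE ler_norml; apply/andP; split.
  rewrite lerNl (le_trans _ sumE)// -mulN1r -bernsteinZ; apply: le_bernstein => // k kn.
  by rewrite mulN1r (le_trans _ (main k kn))// lerNl lerNnormlW.
apply: (le_trans _ sumE); apply: le_bernstein => // k kn.
by rewrite (le_trans _ (main k kn))// ler_norm.
Qed.

End weierstrass.

(** * Functionals determined by trigonometric functions *)

Section clamp.
Variable R : realType.
Implicit Types (M x : R).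

Definition clamp M x : R := Num.max (- M) (Num.min M x).

Lemma continuous_clamp M : continuous (clamp M).
Proof.
rewrite (_ : clamp M = fun x => Num.max (- M) (Num.min M x))// => x.
apply: (@continuous_max R R (fun=> - M) (fun v => Num.min M v)).
  exact: cvg_cst.
by apply: (@continuous_min R R (fun=> M) id); [exact: cvg_cst|exact: cvg_id].
Qed.

Lemma clamp_id M x : `|x| <= M -> clamp M x = x.
Proof. by rewrite ler_norml => /andP[h1 h2]; rewrite /clamp min_r// max_r. Qed.

Lemma normr_clamp M x : 0 <= M -> `|clamp M x| <= M.
Proof.
move=> M0; rewrite ler_norml /clamp le_max lexx/= ge_max ge_min lexx/= andbT.
by rewrite (le_trans _ M0)// oppr_le0.
Qed.

Lemma normr_clamp_le M x : 0 <= M -> `|clamp M x| <= `|x|.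
Proof.
move=> M0; have [xM|xM] := leP `|x| M; first by rewrite clamp_id.
by rewrite (le_trans (normr_clamp _ M0))// ltW.
Qed.

End clamp.

Section trigonometric_functionals.
Variable R : realType.
Implicit Types (f g h G : R -> R) (a e u s t v x B C M : R).

Definition bounded_continuous f :=
  continuous f /\ exists B, forall x, `|f x| <= B.

Lemma bounded_continuousZD a f g : bounded_continuous f ->
  bounded_continuous g -> bounded_continuous (fun x => a * f x + g x).
Proof.
move=> [cf [B fB]] [cg [C gC]]; split.
  by move=> x; apply: cvgD; [apply: cvgM; [exact: cvg_cst|exact: cf]|exact: cg].
exists (`|a| * B + C) => x; rewrite (le_trans (ler_normD _ _))// lerD//.
by rewrite normrM ler_wpM2l.
Qed.

Lemma bounded_continuousM f g : bounded_continuous f ->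
  bounded_continuous g -> bounded_continuous (fun x => f x * g x).
Proof.
move=> [cf [B fB]] [cg [C gC]]; split.
  by move=> x; apply: cvgM; [exact: cf|exact: cg].
by exists (B * C) => x; rewrite normrM ler_pM.
Qed.

Lemma bounded_continuous_cst a : bounded_continuous (fun=> a).
Proof. by split; [move=> x; exact: cvg_cst|exists `|a|]. Qed.

Lemma bounded_continuousB f g : bounded_continuous f ->
  bounded_continuous g -> bounded_continuous (fun x => f x - g x).
Proof.
move=> bf bg; have := bounded_continuousZD (-1) bg bf.
by congr bounded_continuous; apply/funext => x; rewrite mulN1r addrC.
Qed.

Lemma bounded_continuous_cos u : bounded_continuous (fun x => cos (u * x)).
Proof.
split; last by exists 1 => x; exact: cos_max.
move=> x; apply: continuous_comp; last exact: continuous_cos.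
by apply: cvgM; [exact: cvg_cst|exact: cvg_id].
Qed.

Lemma bounded_continuous_sin u : bounded_continuous (fun x => sin (u * x)).
Proof.
split; last by exists 1 => x; exact: sin_max.
move=> x; apply: continuous_comp; last exact: continuous_sin.
by apply: cvgM; [exact: cvg_cst|exact: cvg_id].
Qed.

Variable L : nat -> (R -> R) -> R.

Hypothesis L_linear : forall n a f g, bounded_continuous f ->
  bounded_continuous g -> L n (fun x => a * f x + g x) = a * L n f + L n g.
Hypothesis L_bounded : exists C, \forall n \near \oo, forall f B,
  bounded_continuous f -> (forall x, `|f x| <= B) -> `|L n f| <= C * B.
Hypothesis L_tight : forall e, 0 < e -> exists M, \forall n \near \oo, forall f,
  bounded_continuous f -> (forall x, `|f x| <= 1) ->
  (forall x, `|x| <= M -> f x = 0) -> `|L n f| <= e.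
Hypothesis L_cos : forall u, L n (fun x => cos (u * x)) @[n --> \oo] --> (0 : R).
Hypothesis L_sin : forall u, L n (fun x => sin (u * x)) @[n --> \oo] --> (0 : R).

Let vanish f := bounded_continuous f /\ L n f @[n --> \oo] --> (0 : R).

Let vanishZD a f g : vanish f -> vanish g -> vanish (fun x => a * f x + g x).
Proof.
move=> [bf Lf] [bg Lg]; split; first exact: bounded_continuousZD.
rewrite (_ : (fun n => _) = fun n => a * L n f + L n g); last first.
  by apply/funext => n; rewrite L_linear.
rewrite -[X in _ --> X]addr0 -[X in _ --> X + _](mulr0 a).
by apply: cvgD => //; apply: cvgM => //; exact: cvg_cst.
Qed.

Let L0 n : L n (fun=> 0) = 0.
Proof.
have b0 := bounded_continuous_cst 0; have := L_linear n 1 b0 b0.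
rewrite (_ : (fun x => 1 * 0 + 0) = fun=> 0); last by apply/funext => x; lra.
lra.
Qed.

Let vanish0 : vanish (fun=> 0).
Proof.
split; first exact: bounded_continuous_cst.
rewrite (_ : (fun n => _) = fun=> 0); first exact: cvg_cst.
by apply/funext => n; exact: L0.
Qed.

Let vanish_sum (a : nat -> R) (F : nat -> R -> R) m : (forall i, vanish (F i)) ->
  vanish (fun x => \sum_(i < m) a i * F i x).
Proof.
move=> vF; elim: m => [|m IH].
  by under eq_fun do rewrite big_ord0.
under eq_fun do rewrite big_ord_recr/= addrC.
exact: vanishZD.
Qed.

Let vanish_approx f : bounded_continuous f ->
  (forall e, 0 < e -> exists2 g, vanish g &
    \forall n \near \oo, `|L n (fun x => f x - g x)| <= e) -> vanish f.
Proof.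
move=> bf fapp; split=> //; apply/cvgrPdist_le => e e0.
have e20 : 0 < e / 2 by rewrite divr_gt0.
have [g [bg Lg] fg] := fapp _ e20.
move/cvgrPdist_le : Lg => /(_ _ e20) Lg.
near=> n; rewrite sub0r normrN.
rewrite (_ : f = fun x => 1 * (f x - g x) + g x); last first.
  by apply/funext => x; lra.
rewrite L_linear//; last exact: bounded_continuousB.
rewrite mul1r [e]splitr (le_trans (ler_normD _ _))// lerD//; near: n => //.
by apply: filterS Lg => n; rewrite sub0r normrN.
Unshelve. all: by end_near. Qed.

(** The product formulas turn a power of one sine into a combination of sines
    and cosines of other frequencies. *)
Let vanish_sin_pow u k s : vanish (fun x => sin (u * x) ^+ k * cos (s * x)) /\
  vanish (fun x => sin (u * x) ^+ k * sin (s * x)).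
Proof.
elim: k s => [|k IH] s.
  split; under eq_fun do rewrite expr0 mul1r.
    by split; [exact: bounded_continuous_cos|exact: L_cos].
  by split; [exact: bounded_continuous_sin|exact: L_sin].
have [c1 s1] := IH (u + s); have [c2 s2] := IH (u - s).
split.
  have := vanishZD (2^-1) s1 (vanishZD (2^-1) s2 vanish0).
  congr vanish; apply/funext => x.
  by rewrite (mulrDl u s x) (mulrBl x u s) sinD sinB exprS; field.
have := vanishZD (2^-1) c2 (vanishZD (- 2^-1) c1 vanish0).
congr vanish; apply/funext => x.
by rewrite (mulrDl u s x) (mulrBl x u s) cosB cosD exprS; field.
Qed.

Let vanish_poly u (p : {poly R}) : vanish (fun x => p.[sin (u * x)]).
Proof.
under eq_fun do rewrite horner_coef.
apply: (@vanish_sum (fun i => p`_i) (fun i x => sin (u * x) ^+ i)) => i.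
have [+ _] := vanish_sin_pow u i 0; congr vanish; apply/funext => x.
by rewrite mul0r cos0 mulr1.
Qed.

(** Weierstrass' theorem replaces [G] by a polynomial in [sin (u * x)]. *)
Let vanish_comp_sin u G : continuous G -> vanish (fun x => G (sin (u * x))).
Proof.
move=> cG.
have cG' : continuous (fun t => G (2 * t - 1)).
  move=> t; apply: (@continuous_comp _ _ _ (fun t => 2 * t - 1) G); last exact: cG.
  by apply: cvgB; [apply: cvgM; [exact: cvg_cst|exact: cvg_id]|exact: cvg_cst].
have app e : 0 < e -> exists p : {poly R}, forall x, `|G (sin (u * x)) - p.[sin (u * x)]| <= e.
  move=> e0; have [p hp] := weierstrass cG' e0.
  exists (p \Po ((1 + 'X) * (2^-1)%:P)) => x.
  rewrite horner_comp !hornerE.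
  have := hp ((1 + sin (u * x)) / 2).
  rewrite (_ : 2 * ((1 + sin (u * x)) / 2) - 1 = sin (u * x)); last by field.
  apply; have := sin_geN1 (u * x); have := sin_le1 (u * x); lra.
apply: vanish_approx.
  split.
    move=> x; apply: (@continuous_comp _ _ _ (fun x => sin (u * x)) G); last exact: cG.
    by have [+ _] := bounded_continuous_sin u; apply.
  have [p hp] := app 1 ltr01.
  have [[_ [B pB]] _] := vanish_poly u p.
  exists (1 + B) => x.
  rewrite -[G _](subrK p.[sin (u * x)]) (le_trans (ler_normD _ _))// lerD//.
move=> e e0; have [C CL] := L_bounded.
have C10 : 0 < `|C| + 1 by rewrite ltr_wpDl.
have [p hp] := app (e / (`|C| + 1)) (divr_gt0 e0 C10).
exists (fun x => p.[sin (u * x)]); first exact: vanish_poly.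
near=> n.
apply: (@le_trans _ _ (C * (e / (`|C| + 1)))).
  near: n; apply: filterS CL => n; apply => //.
  apply: bounded_continuousB; last by have [] := vanish_poly u p.
  split.
    move=> x; apply: (@continuous_comp _ _ _ (fun x => sin (u * x)) G); last exact: cG.
    by have [+ _] := bounded_continuous_sin u; apply.
  have [[_ [B pB]] _] := vanish_poly u p.
  exists (e / (`|C| + 1) + B) => x.
  by rewrite -[G _](subrK p.[sin (u * x)]) (le_trans (ler_normD _ _))// lerD.
rewrite mulrA ler_pdivrMr// mulrC ler_pM2l//.
by rewrite (le_trans (ler_norm _))// lerDl.
Unshelve. all: by end_near. Qed.

(** On a bounded interval [f] is a continuous function of the single function
    [sin (c / M * x)], because the sine is injective between [- c] and [c] for
    [c < pi / 2]; outside the interval tightness takes over.  The statement is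
    about functionals rather than measures because it is applied to
    differences of weighted integrals. *)
Lemma trigonometric_vanish f : bounded_continuous f ->
  L n f @[n --> \oo] --> (0 : R).
Proof.
move=> bf; suff [] : vanish f by [].
apply: vanish_approx => // e e0.
have [cf [B0 fB0]] := bf.
pose B := `|B0| + 1; have B_gt0 : 0 < B by rewrite ltr_wpDl.
have fB x : `|f x| <= B.
  by rewrite (le_trans (fB0 x))// (le_trans (ler_norm _))// lerDl.
have eB0 : 0 < e / (2 * B) by rewrite divr_gt0// mulr_gt0.
have [M0 LM] := L_tight eB0.
pose M := `|M0| + 1; have M_gt0 : 0 < M by rewrite ltr_wpDl.
have M0M : M0 <= M by rewrite (le_trans (ler_norm _))// lerDl.
pose c : R := pi / 4.
have pi0 := pi_gt0 R.
have c0 : 0 < c by rewrite divr_gt0.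
pose a := sin c.
have cpi : c < pi / 2 by rewrite /c; lra.
have a1 : a < 1.
  rewrite -sin_pihalf /a ltr_sin// in_itv/=; apply/andP; split; lra.
have aN1 : -1 < - a by rewrite ltrN2.
have a0 : 0 < a by apply: sin_gt0_pi; rewrite c0/=; lra.
pose G v := f (M / c * asin (clamp a v)).
have cG : continuous G.
  move=> v; apply: (@continuous_comp _ _ _ (fun v => M / c * asin (clamp a v)) f); last exact: cf.
  apply: cvgM; first exact: cvg_cst.
  apply: (@continuous_comp _ _ _ (clamp a) asin); first exact: continuous_clamp.
  apply: continuous_asin; have := normr_clamp v (ltW a0).
  by rewrite ler_norml => /andP[v1 v2]; apply/andP; split; lra.
exists (fun x => G (sin (c / M * x))); first exact: vanish_comp_sin.
have bG : bounded_continuous (fun x => G (sin (c / M * x))).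
  by have [] := vanish_comp_sin (c / M) cG.
pose h x := (2 * B)^-1 * (f x - G (sin (c / M * x))) + 0.
have B20 : 0 < 2 * B by rewrite mulr_gt0.
near=> n.
have hh : `|L n h| <= e / (2 * B).
  near: n; apply: filterS LM => n; apply.
  - apply: bounded_continuousZD; last exact: bounded_continuous_cst.
    exact: bounded_continuousB.
  - move=> x; rewrite /h addr0 normrM gtr0_norm ?invr_gt0//.
    rewrite ler_pdivrMl// mulr1 (le_trans (ler_normB _ _))//.
    by rewrite mulr_natl mulr2n lerD// /G.
  - move=> x xM; rewrite /h addr0.
    have xc : `|c / M * x| <= c.
      rewrite normrM gtr0_norm ?divr_gt0// mulrAC ler_pdivrMr// ler_pM2l//.
      exact: le_trans M0M.
    have clE : clamp a (sin (c / M * x)) = sin (c / M * x).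
      move: xc; rewrite ler_norml => /andP[x1 x2].
      have xI : c / M * x \in `[(- (pi / 2)), (pi / 2)].
        by rewrite in_itv/=; apply/andP; split; lra.
      have cI : c \in `[(- (pi / 2)), (pi / 2)].
        by rewrite in_itv/=; apply/andP; split; lra.
      have NcI : - c \in `[(- (pi / 2)), (pi / 2)].
        by rewrite in_itv/=; apply/andP; split; lra.
      have s1 : sin (c / M * x) <= a by rewrite leNgt /a ltr_sin// -leNgt.
      have s2 : - a <= sin (c / M * x) by rewrite leNgt /a -sinN ltr_sin// -leNgt.
      by rewrite clamp_id// ler_norml s1 s2.
    rewrite /G clE sinK; last first.
      move: xc; rewrite ler_norml => /andP[x1 x2].
      by rewrite in_itv/=; apply/andP; split; lra.
    have -> : M / c * (c / M * x) = x by field; rewrite !lt0r_neq0.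
    by rewrite subrr mulr0.
rewrite (_ : (fun x => _) = fun x => 2 * B * h x + 0); last first.
  by apply/funext => x; rewrite /h !addr0 mulrA divff ?mul1r// lt0r_neq0.
have bh : bounded_continuous h.
  by apply: bounded_continuousZD; [exact: bounded_continuousB|exact: bounded_continuous_cst].
have b0 := bounded_continuous_cst 0.
rewrite L_linear// L0 addr0 normrM gtr0_norm//.
by rewrite mulrC -ler_pdivlMr.
Unshelve. all: by end_near. Qed.

End trigonometric_functionals.

(** * Functionals determined by exponentials *)

Section exponential_growth.
Variable R : realType.
Implicit Types (f g h : R -> R) (a e r s t u x y B C M theta : R).

Definition exp_growth f :=
  continuous f /\ exists B r, forall x, `|f x| <= B * expR (r * `|x|).

Lemma exp_growthP f : exp_growth f -> exists B r,
  [/\ 0 <= B, 0 <= r & forall x, `|f x| <= B * expR (r * `|x|)].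
Proof.
move=> [_ [B [r fB]]]; exists B, `|r|; split=> // [|x].
  by have := fB 0; rewrite normr0 mulr0 expR0 mulr1; exact: le_trans.
rewrite (le_trans (fB x))// ler_wpM2l//.
  by have := fB 0; rewrite normr0 mulr0 expR0 mulr1; exact: le_trans.
by rewrite ler_expR ler_wpM2r// ler_norm.
Qed.

Lemma exp_growthZD a f g : exp_growth f -> exp_growth g ->
  exp_growth (fun x => a * f x + g x).
Proof.
move=> ef eg; have [B [r [B0 r0 fB]]] := exp_growthP ef.
have [C [s [C0 s0 gC]]] := exp_growthP eg; case: ef => cf _; case: eg => cg _.
split.
  by move=> x; apply: cvgD; [apply: cvgM; [exact: cvg_cst|exact: cf]|exact: cg].
exists (`|a| * B + C), (r + s) => x.
rewrite (le_trans (ler_normD _ _))// mulrDl lerD//.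
  rewrite normrM -mulrA ler_wpM2l// (le_trans (fB x))// ler_wpM2l//.
  by rewrite ler_expR ler_wpM2r// lerDl.
by rewrite (le_trans (gC x))// ler_wpM2l// ler_expR ler_wpM2r// lerDr.
Qed.

Lemma exp_growthM f g : exp_growth f -> exp_growth g ->
  exp_growth (fun x => f x * g x).
Proof.
move=> [cf [B [r fB]]] [cg [C [s gC]]]; split.
  by move=> x; apply: cvgM; [exact: cf|exact: cg].
exists (B * C), (r + s) => x.
by rewrite normrM mulrDl expRD mulrACA ler_pM.
Qed.

Lemma bounded_exp_growth f : bounded_continuous f -> exp_growth f.
Proof.
move=> [cf [B fB]]; split=> //; exists B, 0 => x.
by rewrite mul0r expR0 mulr1.
Qed.

Lemma continuous_expR_mul theta : continuous (fun x => expR (theta * x)).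
Proof.
move=> x; apply: (@continuous_comp _ _ _ (fun x => theta * x) expR).
  by apply: cvgM; [exact: cvg_cst|exact: cvg_id].
exact: continuous_expR.
Qed.

Lemma exp_growth_expR theta : exp_growth (fun x => expR (theta * x)).
Proof.
split; first exact: continuous_expR_mul.
exists 1, `|theta| => x; rewrite mul1r ger0_norm ?expR_ge0// ler_expR -normrM.
exact: ler_norm.
Qed.

Lemma normr_le_expR x : `|x| <= expR `|x|.
Proof. by have := expR_ge1Dx `|x|; lra. Qed.

Lemma exprn_normr_le_expR x k : `|x| ^+ k <= expR (k%:R * `|x|).
Proof.
by rewrite expRM_natl lerXn2r ?nnegrE ?expR_ge0// normr_le_expR.
Qed.

Lemma exp_growthX k : exp_growth (fun x => x ^+ k).
Proof.
split; first by move=> x; exact: exprn_continuous.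
by exists 1, k%:R => x; rewrite normrX mul1r exprn_normr_le_expR.
Qed.

Lemma normr_expRB1 t : `|expR t - 1| <= `|t| * expR `|t|.
Proof.
have h1 := expR_ge1Dx t; have h2 := expR_ge1Dx (- t).
have h3 : expR t - 1 <= t * expR t.
  have : (1 - t) * expR t <= expR (- t) * expR t by rewrite ler_wpM2r// expR_ge0.
  by rewrite -expRD addNr expR0; lra.
have [t0|t0] := leP 0 t.
  by rewrite !ger0_norm//; lra.
have e1 : 1 <= expR (- t) by rewrite -expR0 ler_expR oppr_ge0 ltW.
have e2 : expR t < 1 by rewrite -expR0 ltr_expR.
rewrite (ltr0_norm t0) ltr0_norm; last lra.
by apply: (@le_trans _ _ (- t * 1)); [lra|rewrite ler_wpM2l//; lra].
Qed.

Lemma normr_expRB1B t : `|expR t - 1 - t| <= t ^+ 2 * expR `|t|.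
Proof.
have h1 := expR_ge1Dx t; have h2 := expR_ge1Dx (- t).
have h3 : expR t - 1 <= t * expR t.
  have : (1 - t) * expR t <= expR (- t) * expR t by rewrite ler_wpM2r// expR_ge0.
  by rewrite -expRD addNr expR0; lra.
rewrite ger0_norm; last lra.
apply: (@le_trans _ _ (t * (expR t - 1))); first lra.
rewrite (le_trans (ler_norm _))// normrM.
rewrite (le_trans (ler_wpM2l (normr_ge0 _) (normr_expRB1 t)))//.
by rewrite mulrA -normrM ger0_norm -?expr2 ?sqr_ge0.
Qed.

(** From the index [K] on, [1 <= 2 ^ (i - K)], so that the tail is at most
    [2 ^- K] times the exponential series at [2 * `|y|]. *)
Lemma exp_series_tail (c : nat -> R) y K l :
  (forall n, `|c n| <= n`!%:R^-1) ->
  series (fun n => c n * y ^+ n) @ \oo --> l ->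
  `|l - \sum_(i < K) c i * y ^+ i| <= 2 ^- K * expR (2 * `|y|).
Proof.
move=> cn cl.
have tail N : (K <= N)%N -> `|series (fun n => c n * y ^+ n) N - \sum_(i < K) c i * y ^+ i| <=
    2 ^- K * expR (2 * `|y|).
  move=> KN; rewrite /series/= -(big_mkord xpredT (fun i => c i * y ^+ i)).
  rewrite (big_cat_nat (leq0n K) KN)//= addrAC subrr add0r.
  rewrite (le_trans (ler_norm_sum _ _ _))//.
  apply: (@le_trans _ _ (2 ^- K * \sum_(K <= i < N) exp_coeff (2 * `|y|) i)).
    rewrite mulr_sumr big_nat_cond [leRHS]big_nat_cond; apply: ler_sum => i /andP[/andP[Ki _] _].
    have h1 : 1 <= 2 ^- K * 2 ^+ i :> R.
      by rewrite mulrC ler_pdivlMr ?exprn_gt0// mul1r ler_eXn2l ?ltr1n.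
    have h2 : `|c i * y ^+ i| <= i`!%:R^-1 * `|y| ^+ i.
      by rewrite normrM normrX ler_wpM2r// exprn_ge0.
    rewrite (le_trans h2)//.
    have -> : 2 ^- K * exp_coeff (2 * `|y|) i =
        (2 ^- K * 2 ^+ i) * (i`!%:R^-1 * `|y| ^+ i).
      by rewrite /exp_coeff/= exprMn; ring.
    by rewrite ler_peMl// mulr_ge0// exprn_ge0.
  rewrite ler_wpM2l ?invr_ge0 ?exprn_ge0//.
  have exp_ge0 i : 0 <= exp_coeff (2 * `|y|) i by rewrite exp_coeff_ge0// mulr_ge0.
  apply: (@le_trans _ _ (series (exp_coeff (2 * `|y|)) N)).
    by rewrite /series/= (big_cat_nat (leq0n K) KN)//= lerDr sumr_ge0.
  rewrite /expR.
  apply: nondecreasing_cvgn_le; last exact: is_cvg_series_exp_coeff.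
  by apply: nondecreasing_series.
have cl2 : `|series (fun n => c n * y ^+ n) n - \sum_(i < K) c i * y ^+ i| @[n --> \oo]
    --> `|l - \sum_(i < K) c i * y ^+ i|.
  by apply: cvg_norm; apply: cvgB => //; exact: cvg_cst.
apply: (cvgr_to_le cl2); exists K => //.
Qed.

Lemma cos_poly_approx K : exists c : nat -> R, forall y,
  `|cos y - \sum_(i < K) c i * y ^+ i| <= 2 ^- K * expR (2 * `|y|).
Proof.
pose c n : R := (~~ odd n)%:R * (-1) ^+ n./2 * n`!%:R^-1.
exists c => y; apply: exp_series_tail => [n|].
  rewrite /c !normrM normrX normrN1 expr1n mulr1 normfV !normr_nat.
  by rewrite ler_piMl// ?invr_ge0// lern1 leq_b1.
rewrite -cos_coeffE cos.unlock; exact: is_cvg_series_cos_coeff.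
Qed.

Lemma sin_poly_approx K : exists c : nat -> R, forall y,
  `|sin y - \sum_(i < K) c i * y ^+ i| <= 2 ^- K * expR (2 * `|y|).
Proof.
pose c n : R := (odd n)%:R * (-1) ^+ n.-1./2 * n`!%:R^-1.
exists c => y; apply: exp_series_tail => [n|].
  rewrite /c !normrM normrX normrN1 expr1n mulr1 normfV !normr_nat.
  by rewrite ler_piMl// ?invr_ge0// lern1 leq_b1.
rewrite -sin_coeffE sin.unlock; exact: is_cvg_series_sin_coeff.
Qed.

Lemma exists_exp2N_le e : 0 < e -> exists K : nat, 2 ^- K <= e.
Proof.
move=> e0; exists (Num.truncn (e^-1)).+1.
rewrite invf_ple ?posrE ?exprn_gt0//.
rewrite -natrX (le_trans (ltW (truncnS_gt _)))// ler_nat ltnW// ltn_expl//.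
Qed.

Lemma exists_expRN_le C e : 0 < e -> exists2 M, 0 < M & C * expR (- M) <= e.
Proof.
move=> e0; pose D := `|C| + 1; have D0 : 0 < D by rewrite ltr_wpDl.
exists (D / e); first by rewrite divr_gt0.
apply: (@le_trans _ _ (D * expR (- (D / e)))).
  by rewrite ler_wpM2r ?expR_ge0// (le_trans (ler_norm _))// lerDl.
rewrite expRN ler_pdivrMr ?expR_gt0// -ler_pdivrMl// mulrC.
by have := expR_ge1Dx (D / e); lra.
Qed.

(** These are the properties of integration against a sequence of signed
    measures whose exponential moments of each order stay bounded. *)
Definition exp_functional (L : nat -> (R -> R) -> R) :=
  (forall n a f g, exp_growth f -> exp_growth g ->
    L n (fun x => a * f x + g x) = a * L n f + L n g) /\
  (forall r, exists C, \forall n \near \oo, forall f B, exp_growth f ->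
    (forall x, `|f x| <= B * expR (r * `|x|)) -> `|L n f| <= C * B).

Lemma exp_functional_tilt L h : exp_growth h -> exp_functional L ->
  exp_functional (fun n f => L n (fun x => h x * f x)).
Proof.
move=> eh [Ll Lb]; split.
  move=> n a f g ef eg.
  rewrite -Ll//; [|exact: exp_growthM..].
  by congr (L n _); apply/funext => x; lra.
move=> r; have [B [s [B0 s0 hB]]] := exp_growthP eh.
have [C LC] := Lb (s + r); exists (C * B).
near=> n => f D ef fD; rewrite -mulrA.
suff H : forall f B, exp_growth f ->
    (forall x, `|f x| <= B * expR ((s + r) * `|x|)) -> `|L n f| <= C * B.
  apply: H; first exact: exp_growthM.
  by move=> x; rewrite normrM mulrDl expRD mulrACA ler_pM.
by near: n.
Unshelve. all: by end_near. Qed.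

Section functional.
Variable L : nat -> (R -> R) -> R.
Hypothesis Lexp : exp_functional L.

Definition asymptotically_null f :=
  exp_growth f /\ L n f @[n --> \oo] --> (0 : R).

Lemma asymptotically_nullZD a f g : asymptotically_null f -> asymptotically_null g ->
  asymptotically_null (fun x => a * f x + g x).
Proof.
move=> [bf Lf] [bg Lg]; split; first exact: exp_growthZD.
rewrite (_ : (fun n => _) = fun n => a * L n f + L n g); last first.
  by apply/funext => n; rewrite Lexp.1.
rewrite -[X in _ --> X]addr0 -[X in _ --> X + _](mulr0 a).
by apply: cvgD => //; apply: cvgM => //; exact: cvg_cst.
Qed.

Lemma exp_growth0 : exp_growth (fun=> 0).
Proof. exact/bounded_exp_growth/bounded_continuous_cst. Qed.

Lemma asymptotically_null0 : asymptotically_null (fun=> 0).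
Proof.
split; first exact: exp_growth0.
rewrite (_ : (fun n => L n (fun=> 0)) = fun=> 0); first exact: cvg_cst.
apply/funext => n.
have := Lexp.1 n 1 _ _ exp_growth0 exp_growth0.
rewrite (_ : (fun x => 1 * 0 + 0) = fun=> 0); last by apply/funext => x; lra.
lra.
Qed.

Lemma asymptotically_null_sum (a : nat -> R) (F : nat -> R -> R) m : (forall i, asymptotically_null (F i)) ->
  asymptotically_null (fun x => \sum_(i < m) a i * F i x).
Proof.
move=> vF; elim: m => [|m IH].
  by under eq_fun do rewrite big_ord0; exact: asymptotically_null0.
under eq_fun do rewrite big_ord_recr/= addrC.
exact: asymptotically_nullZD.
Qed.

Lemma asymptotically_null_approx r f : exp_growth f ->
  (forall e, 0 < e -> exists2 g, asymptotically_null g &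
    forall x, `|f x - g x| <= e * expR (r * `|x|)) -> asymptotically_null f.
Proof.
move=> ef fapp; split=> //; apply/cvgrPdist_le => e e0.
have e20 : 0 < e / 2 by rewrite divr_gt0.
have [C0 LC] := Lexp.2 r; pose C := `|C0| + 1.
have C_gt0 : 0 < C by rewrite ltr_wpDl.
have [g [eg Lg] fg] := fapp _ (divr_gt0 e20 C_gt0).
move/cvgrPdist_le : Lg => /(_ _ e20) Lg.
have efg : exp_growth (fun x => f x - g x).
  have := exp_growthZD (-1) eg ef.
  by congr exp_growth; apply/funext => x; lra.
near=> n; rewrite sub0r normrN.
rewrite (_ : f = fun x => 1 * (f x - g x) + g x); last first.
  by apply/funext => x; lra.
rewrite Lexp.1// mul1r [e]splitr (le_trans (ler_normD _ _))// lerD//; last first.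
  by near: n; apply: filterS Lg => n; rewrite sub0r normrN.
apply: (@le_trans _ _ (C0 * (e / 2 / C))).
  by near: n; apply: filterS LC => n; apply.
rewrite mulrA ler_pdivrMr// mulrC ler_pM2l//.
by rewrite (le_trans (ler_norm _))// lerDl.
Unshelve. all: by end_near. Qed.

(** Replacing [x] by [clamp M x] changes [f] by at most
    [2 * B * expR (- M)] relative to the weight [expR ((r + 1) * `|x|)]. *)
Lemma exp_functional_truncate :
  (forall h, bounded_continuous h -> L n h @[n --> \oo] --> (0 : R)) ->
  forall f, exp_growth f -> L n f @[n --> \oo] --> (0 : R).
Proof.
move=> Lh f ef; suff [] : asymptotically_null f by [].
have [B [r [B0 r0 fB]]] := exp_growthP ef.
apply: (@asymptotically_null_approx (r + 1)) => // e e0.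
have [M M0 BM] := exists_expRN_le (2 * B) e0.
have clM x : `|clamp M x| <= M by exact: normr_clamp (ltW M0).
have bfc : bounded_continuous (fun x => f (clamp M x)).
  split.
    move=> x; apply: (@continuous_comp _ _ _ (clamp M) f); first exact: continuous_clamp.
    by case: ef => cf _; exact: cf.
  exists (B * expR (r * M)) => x; rewrite (le_trans (fB _))// ler_wpM2l//.
  by rewrite ler_expR ler_wpM2l.
exists (fun x => f (clamp M x)); first by split; [exact: bounded_exp_growth|exact: Lh].
move=> x; have [xM|xM] := leP `|x| M.
  by rewrite clamp_id// subrr normr0 mulr_ge0 ?expR_ge0// ltW.
apply: (@le_trans _ _ (2 * B * expR (- M) * expR ((r + 1) * `|x|))); last first.
  by rewrite ler_wpM2r// expR_ge0.
rewrite -mulrA -expRD; apply: (@le_trans _ _ (2 * B * expR (r * `|x|))); last first.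
  by rewrite ler_wpM2l ?mulr_ge0// ler_expR; lra.
rewrite (le_trans (ler_normB _ _))//.
have h1 := fB x; have h2 := fB (clamp M x).
have h3 : B * expR (r * `|clamp M x|) <= B * expR (r * `|x|).
  by rewrite ler_wpM2l// ler_expR ler_wpM2l// (le_trans (clM _))// ltW.
by rewrite (le_trans (lerD h1 (le_trans h2 h3)))// -mulrA mulr_natl mulr2n.
Qed.

End functional.

Section completeness.
Variable L : nat -> (R -> R) -> R.
Hypothesis Lexp : exp_functional L.
Variable Theta : set R.
Hypothesis Lexpl : forall theta, Theta theta ->
  L n (fun x => expR (theta * x)) @[n --> \oo] --> (0 : R).

(** Exponentials depend continuously on their exponent in a weighted supremum
    norm. *)
Let null_closure theta : closure Theta theta -> asymptotically_null L (fun x => expR (theta * x)).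
Proof.
move=> cth; apply: (@asymptotically_null_approx _ Lexp (`|theta| + 2)); first exact: exp_growth_expR.
move=> e e0; pose d := Num.min e 1.
have d0 : 0 < d by rewrite lt_min e0/=.
have [theta' [Th' /= hd]] := cth _ (nbhsx_ballx theta d d0).
exists (fun x => expR (theta' * x)).
  by split; [exact: exp_growth_expR|exact: Lexpl].
move=> x; pose h := theta' - theta.
move: hd; rewrite /ball/= distrC -/h lt_min => /andP[he h1].
have -> : expR (theta * x) - expR (theta' * x) = - (expR (theta * x) * (expR (h * x) - 1)).
  have -> : theta' * x = theta * x + h * x by rewrite /h; ring.
  by rewrite expRD; ring.
rewrite normrN normrM ger0_norm ?expR_ge0//.
apply: (@le_trans _ _ (expR (`|theta| * `|x|) * (e * (expR `|x| * expR `|x|)))).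
  apply: ler_pM; rewrite ?expR_ge0//; first by rewrite ler_expR -normrM ler_norm.
  rewrite (le_trans (normr_expRB1 _))// normrM -mulrA ler_pM// ?mulr_ge0 ?expR_ge0 ?(ltW he)//.
  rewrite ler_pM// ?expR_ge0 ?normr_le_expR// ler_expR.
  by rewrite ler_piMl// ltW.
by rewrite mulrCA -!expRD le_eqVlt; apply/orP; left; apply/eqP; congr (_ * expR _); lra.
Qed.

Hypothesis Theta_int : interior (closure Theta) !=set0.

(** Induction on [k]: the difference quotient in [theta] of
    [x ^+ k * expR (theta * x)] approximates [x ^+ k.+1 * expR (theta * x)] in a
    weighted supremum norm, and near an interior point of the closure of
    [Theta] all exponents used by the quotients are available. *)
Let null_expX : exists theta, forall k, asymptotically_null L (fun x => x ^+ k * expR (theta * x)).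
Proof.
have [theta0 /nbhs_ballP[rho /= rho0 hrho]] := Theta_int.
exists theta0.
suff H k : forall theta, `|theta0 - theta| < rho -> asymptotically_null L (fun x => x ^+ k * expR (theta * x)).
  by move=> k; apply: H; rewrite subrr normr0.
elim: k => [|k IH] theta thr.
  by under eq_fun do rewrite expr0 mul1r; exact/null_closure/hrho.
apply: (@asymptotically_null_approx _ Lexp (`|theta| + 1 + k.+2%:R)).
  by apply: exp_growthM; [exact: exp_growthX|exact: exp_growth_expR].
move=> e e0.
pose h := Num.min 1 (Num.min e ((rho - `|theta0 - theta|) / 2)).
have h0 : 0 < h by rewrite !lt_min ltr01 e0 divr_gt0// subr_gt0.
have h1 : h <= 1 by rewrite !ge_min lexx.
have he : h <= e by rewrite !ge_min lexx orbT.
have hr : h < rho - `|theta0 - theta|.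
  rewrite (@le_lt_trans _ _ ((rho - `|theta0 - theta|) / 2))//; last lra.
  by rewrite !ge_min lexx !orbT.
have thr' : `|theta0 - (theta + h)| < rho.
  rewrite opprD addrA (le_lt_trans (ler_normB _ _))// (gtr0_norm h0); lra.
exists (fun x => h^-1 * (x ^+ k * expR ((theta + h) * x)) +
    (- h^-1 * (x ^+ k * expR (theta * x)) + 0)).
  apply: (asymptotically_nullZD Lexp); first exact: IH.
  by apply: (asymptotically_nullZD Lexp); [exact: IH|exact: asymptotically_null0].
move=> x.
have -> : x ^+ k.+1 * expR (theta * x) - (h^-1 * (x ^+ k * expR ((theta + h) * x)) +
    (- h^-1 * (x ^+ k * expR (theta * x)) + 0)) =
    - (h^-1 * (x ^+ k * expR (theta * x) * (expR (h * x) - 1 - h * x))).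
  rewrite mulrDl expRD exprS; field; exact: lt0r_neq0.
rewrite normrN normrM gtr0_norm ?invr_gt0// ler_pdivrMl//.
apply: (@le_trans _ _ (h * h * (`|x| ^+ k.+2 * (expR (`|theta| * `|x|) * expR `|x|)))).
  rewrite !normrM normrX.
  have -> : h * h * (`|x| ^+ k.+2 * (expR (`|theta| * `|x|) * expR `|x|)) =
    `|x| ^+ k * expR (`|theta| * `|x|) * ((h * `|x|) ^+ 2 * expR `|x|).
    by rewrite !exprS; ring.
  apply: ler_pM; rewrite ?mulr_ge0 ?exprn_ge0//.
    rewrite ler_wpM2l ?exprn_ge0// ger0_norm ?expR_ge0// ler_expR -normrM.
    exact: ler_norm.
  rewrite (le_trans (normr_expRB1B _))//.
  rewrite -[X in X * _ <= _]real_normK ?num_real// normrM (gtr0_norm h0).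
  rewrite ler_wpM2l ?sqr_ge0// ler_expR.
  by rewrite ler_piMl// ltW.
rewrite -mulrA ler_wpM2l ?(ltW h0)//.
apply: ler_pM => //; rewrite ?(ltW h0)//.
have -> : (`|theta| + 1 + k.+2%:R) * `|x| = k.+2%:R * `|x| + (`|theta| * `|x| + `|x|).
  by ring.
by rewrite !expRD ler_wpM2r ?mulr_ge0 ?expR_ge0// exprn_normr_le_expR.
Qed.

(** Completeness of the exponential family, for sequences.  Functions
    [x ^+ k * expR (theta * x)] are asymptotically null for one [theta], hence so
    are [expR (theta * x) * cos (u * x)] and [expR (theta * x) * sin (u * x)] by
    the Taylor series of cosine and sine; the functionals tilted by
    [expR (theta * x)] therefore vanish in the limit on all bounded continuous
    functions, and by truncation on all functions of exponential growth, among
    which is [expR (- theta * x) * f x]. *)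
Theorem exp_functional_vanish f : exp_growth f -> L n f @[n --> \oo] --> (0 : R).
Proof.
have [theta vth] := null_expX.
have trig_poly (q : R -> R) u : exp_growth (fun x => q (u * x)) ->
    (forall K, exists c : nat -> R, forall y,
      `|q y - \sum_(i < K) c i * y ^+ i| <= 2 ^- K * expR (2 * `|y|)) ->
    asymptotically_null L (fun x => expR (theta * x) * q (u * x)).
  move=> eq qapp; apply: (@asymptotically_null_approx _ Lexp (`|theta| + 2 * `|u|)).
    by apply: exp_growthM => //; exact: exp_growth_expR.
  move=> e e0; have [K Ke] := exists_exp2N_le e0.
  have [c cK] := qapp K.
  exists (fun x => \sum_(i < K) (c i * u ^+ i) * (x ^+ i * expR (theta * x))).
    exact: (@asymptotically_null_sum _ Lexp (fun i => c i * u ^+ i) (fun i x => x ^+ i * expR (theta * x))).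
  move=> x.
  have -> : \sum_(i < K) (c i * u ^+ i) * (x ^+ i * expR (theta * x)) =
      expR (theta * x) * \sum_(i < K) c i * (u * x) ^+ i.
    by rewrite mulr_sumr; apply: eq_bigr => i _; rewrite exprMn; ring.
  rewrite -mulrBr normrM ger0_norm ?expR_ge0//.
  rewrite mulrDl expRD mulrCA; apply: ler_pM; rewrite ?expR_ge0//.
    by rewrite ler_expR -normrM ler_norm.
  rewrite (le_trans (cK _))// normrM mulrA.
  by rewrite ler_wpM2r// expR_ge0.
have Lt := exp_functional_tilt (exp_growth_expR theta) Lexp.
have main h : bounded_continuous h ->
    L n (fun x => expR (theta * x) * h x) @[n --> \oo] --> (0 : R).
  move=> bh.
  apply: (@trigonometric_vanish R (fun n h => L n (fun x => expR (theta * x) * h x))) => //.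
  - by move=> n a f1 f2 /bounded_exp_growth ? /bounded_exp_growth ?; exact: Lt.1.
  - have [C LC] := Lt.2 0; exists C; near=> n => g B bg gB.
    suff H : forall f B, exp_growth f -> (forall x, `|f x| <= B * expR (0 * `|x|)) ->
        `|L n (fun x => expR (theta * x) * f x)| <= C * B.
      apply: H; first exact: bounded_exp_growth.
      by move=> x; rewrite mul0r expR0 mulr1.
    by near: n.
  - move=> e e0; have [C LC] := Lt.2 1.
    have [M M0 CM] := exists_expRN_le C e0.
    exists M; near=> n => g bg g1 gM.
    rewrite (le_trans _ CM)//.
    suff H : forall f B, exp_growth f -> (forall x, `|f x| <= B * expR (1 * `|x|)) ->
        `|L n (fun x => expR (theta * x) * f x)| <= C * B.
      apply: H; first exact: bounded_exp_growth.
      move=> x; rewrite mul1r -expRD.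
      have [xM|xM] := leP `|x| M; first by rewrite gM// normr0 expR_ge0.
      rewrite (le_trans (g1 _))// -expR0 ler_expR; lra.
    by near: n.
  - move=> u; have [] := @trig_poly cos u => //.
      exact/bounded_exp_growth/bounded_continuous_cos.
    exact: cos_poly_approx.
  - move=> u; have [] := @trig_poly sin u => //.
      exact/bounded_exp_growth/bounded_continuous_sin.
    exact: sin_poly_approx.
suff vt g : exp_growth g -> L n (fun x => expR (theta * x) * g x) @[n --> \oo] --> (0 : R).
  move=> ef.
  rewrite (_ : f = fun x => expR (theta * x) * (expR (- theta * x) * f x)).
    by apply: vt; apply: exp_growthM => //; exact: exp_growth_expR.
  by apply/funext => x; rewrite mulrA -expRD mulNr subrr expR0 mul1r.
move=> eg.
exact: (exp_functional_truncate Lt main).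
Unshelve. all: by end_near. Qed.

End completeness.
End exponential_growth.

(** * Integration against a probability measure *)

Section expectation.
Context d (T : measurableType d) (R : realType).
Variable P : probability T R.
Implicit Types (f g : T -> R) (B c : R).

Lemma integrable_bounded f : measurable_fun [set: T] f ->
  (exists B, forall x, `|f x| <= B) -> P.-integrable [set: T] (EFin \o f).
Proof.
move=> mf [B fB]; apply: measurable_bounded_integrable => //.
  by rewrite (@le_lt_trans _ _ 1%E)// ?ltry// probability_le1.
exists B; split; first exact: num_real.
by move=> M BM x _; exact: le_trans (fB x) (ltW BM).
Qed.

Lemma integrable_dominated f g : measurable_fun [set: T] f ->
  P.-integrable [set: T] (EFin \o g) -> (forall x, `|f x| <= g x) ->
  P.-integrable [set: T] (EFin \o f).
Proof.
move=> mf ig fg; apply: (le_integrable _ _ _ ig) => //; first exact/measurable_EFinP.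
by move=> x _; rewrite /= lee_fin (le_trans (fg x))// ler_norm.
Qed.

Lemma integrable_add f g : P.-integrable [set: T] (EFin \o f) ->
  P.-integrable [set: T] (EFin \o g) ->
  P.-integrable [set: T] (EFin \o (fun x => f x + g x)).
Proof. by move=> fi gi; exact: (integrableD measurableT fi gi). Qed.

Lemma integrable_sub f g : P.-integrable [set: T] (EFin \o f) ->
  P.-integrable [set: T] (EFin \o g) ->
  P.-integrable [set: T] (EFin \o (fun x => f x - g x)).
Proof. by move=> fi gi; exact: (integrableB measurableT fi gi). Qed.

Lemma integrable_scale c f : P.-integrable [set: T] (EFin \o f) ->
  P.-integrable [set: T] (EFin \o (fun x => c * f x)).
Proof.
move=> fi; rewrite (_ : EFin \o _ = fun x => (c%:E * (f x)%:E)%E).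
  exact: integrableZl.
by apply/funext => x /=; rewrite EFinM.
Qed.

Lemma integrable_const c : P.-integrable [set: T] (EFin \o (fun=> c)).
Proof. by apply: integrable_bounded => //; exists `|c|. Qed.

Lemma integral_EFin f : P.-integrable [set: T] (EFin \o f) ->
  (\int[P]_x (f x)%:E = (\int[P]_x f x)%:E)%E.
Proof. by move=> intf; rewrite /Rintegral fineK//; exact: integrable_fin_num. Qed.

Lemma Rintegral_prob_cst c : \int[P]_x c = c.
Proof. by rewrite Rintegral_cst//= probability_setT mulr1. Qed.

Lemma normr_Rintegral_le f g : measurable_fun [set: T] f ->
  P.-integrable [set: T] (EFin \o g) -> (forall x, `|f x| <= g x) ->
  `|\int[P]_x f x| <= \int[P]_x g x.
Proof.
move=> mf ig fg; have intf := integrable_dominated mf ig fg.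
rewrite (le_trans (le_normr_Rintegral _ _))//.
by apply: le_Rintegral => //; exact: integrable_norm.
Qed.

Lemma normr_Rintegral_bounded f B : measurable_fun [set: T] f ->
  (forall x, `|f x| <= B) -> `|\int[P]_x f x| <= B.
Proof.
move=> mf fB; rewrite -[leRHS]Rintegral_prob_cst; apply: normr_Rintegral_le => //.
by apply: integrable_bounded => //; exists `|B|.
Qed.

End expectation.

Section density.
Context d (T : measurableType d) (R : realType).
Local Open Scope ereal_scope.
Import HBNNSimple.

(** Both sides agree on simple functions, and monotone convergence does the
    rest.  The density may take the value [+oo]. *)
Lemma ge0_integral_density (mu nu : {measure set T -> \bar R}) (L : T -> \bar R) :
  measurable_fun [set: T] L -> (forall x, 0 <= L x) ->
  (forall A, measurable A -> nu A = \int[mu]_(x in A) L x) ->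
  forall f : T -> \bar R, measurable_fun [set: T] f -> (forall x, 0 <= f x) ->
  \int[nu]_x f x = \int[mu]_x (f x * L x).
Proof.
move=> mL L0 nuE f mf f0.
pose h := nnsfun_approx measurableT mf.
have hf x : (h n x)%:E @[n --> \oo] --> f x by exact: cvg_nnsfun_approx.
have nd x : {homo (fun n => h n x) : a b / (a <= b)%N >-> (a <= b)%R}.
  by move=> a b ab; exact/lefP/nd_nnsfun_approx.
have simple n : \int[nu]_x (h n x)%:E = \int[mu]_x ((h n x)%:E * L x).
  under eq_integral do rewrite fimfunE -fsumEFin//.
  rewrite ge0_integral_fsum//=; last 2 first.
    by move=> r; exact/measurable_EFinP/measurable_funM.
    by move=> r x _; exact: nnfun_muleindic_ge0.
  under [RHS]eq_integral => x _.
    rewrite fimfunE -fsumEFin// ge0_mule_fsuml; last by move=> y; exact: nnfun_muleindic_ge0.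
    over.
  rewrite ge0_integral_fsum//=; last 2 first.
    move=> r; apply: emeasurable_funM => //.
    exact/measurable_EFinP/measurable_funM.
    by move=> r x _; rewrite mule_ge0// nnfun_muleindic_ge0.
  apply: eq_fsbigr => r /[!inE] -[x _ hr].
  have r0 : (0 <= r)%R by rewrite -hr.
  have mhr : measurable (h n @^-1` [set r]) by [].
  under eq_integral do rewrite EFinM.
  under [RHS]eq_integral do rewrite EFinM -muleA.
  rewrite ge0_integralZl//; last exact/measurable_EFinP.
  rewrite ge0_integralZl//; last 2 first.
    by apply: emeasurable_funM => //; exact/measurable_EFinP.
    by move=> y _; rewrite mule_ge0// lee_fin.
  congr (_ * _); rewrite integral_indic// setIT nuE//.
  by rewrite integral_mkcond; apply: eq_integral => y _; rewrite epatch_indic/= muleC.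
transitivity (limn (fun n => \int[nu]_x (h n x)%:E)).
  rewrite -monotone_convergence//.
  - by apply: eq_integral => x _; apply/esym/cvg_lim => //; exact: hf.
  - by move=> n; exact/measurable_EFinP.
  - by move=> n x _; rewrite lee_fin.
  - by move=> x _ a b ab; rewrite lee_fin nd.
under eq_fun do rewrite simple.
rewrite -monotone_convergence//.
- apply: eq_integral => x _; apply/cvg_lim => //.
  have [fx0|fx0] := eqVneq (f x) 0.
    rewrite fx0 mul0e (_ : (fun n => _) = fun=> 0); first exact: cvg_cst.
    apply/funext => n; suff -> : (h n x)%:E = 0 by rewrite mul0e.
    apply/eqP; rewrite eq_le; apply/andP; split; last by rewrite lee_fin.
    by rewrite -fx0 /h nnsfun_approxE le_approx.
  have [Lx0|Lx0] := eqVneq (L x) 0.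
    rewrite Lx0 mule0 (_ : (fun n => _) = fun=> 0); first exact: cvg_cst.
    by apply/funext => n; rewrite mule0.
  apply: cvgeM; [by apply: neq0_mule_def; rewrite mule_eq0 negb_or fx0|exact: hf|exact: cvg_cst].
- by move=> n; apply: emeasurable_funM => //; exact/measurable_EFinP.
- by move=> n x _; rewrite mule_ge0// lee_fin.
- by move=> x _ a b ab; rewrite lee_wpmul2r// lee_fin nd.
Qed.

(** A likelihood ratio is the density of the absolutely continuous part only,
    which leaves an inequality between measures, and hence one between
    integrals. *)
Lemma ge0_integral_density_le (mu nu : {measure set T -> \bar R}) (L : T -> \bar R) :
  measurable_fun [set: T] L -> (forall x, 0 <= L x) ->
  (forall A, measurable A -> \int[mu]_(x in A) L x <= nu A) ->
  forall f : T -> \bar R, measurable_fun [set: T] f -> (forall x, 0 <= f x) ->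
  \int[mu]_x (f x * L x) <= \int[nu]_x f x.
Proof.
move=> mL L0 nuL f mf f0.
pose m A := \int[mu]_(x in A) L x.
have m0 : m set0 = 0 by rewrite /m integral_set0.
have m_ge0 A : 0 <= m A by exact: integral_ge0.
have m_sigma : semi_sigma_additive m.
  move=> A mA tA mUA; rewrite /m ge0_integral_bigcup//; last first.
    exact: measurable_funTS.
  by apply: is_cvg_ereal_nneg_natsum_cond => n _ _; exact: integral_ge0.
pose mm := isMeasure.Build _ T R m m0 m_ge0 m_sigma.
pose mp : {measure set T -> \bar R} := HB.pack m mm.
rewrite -(@ge0_integral_density mu mp L)//.
exact: ge0_le_measure_integral.
Qed.

End density.

Lemma measurable_neq_fun d (T : measurableType d) (R : realType) (f g : T -> R) :
  measurable_fun [set: T] f -> measurable_fun [set: T] g ->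
  measurable [set x | f x != g x].
Proof.
move=> mf mg.
rewrite (_ : [set x | _] = [set: T] `&` [set x | (f x)%:E != (g x)%:E]%E).
  by apply: measurable_neqe => //; apply/measurable_EFinP.
by rewrite setTI; apply/seteqP; split => x /=; rewrite eqe.
Qed.

(** * Normal laws *)

Section change_of_variables.
Context d d' (T : measurableType d) (T' : measurableType d') (R : realType).

(** A transformation formula proved for nonnegative functions extends to
    bounded ones by adding the constant [B], which has the same integral on
    both sides because [w] has integral 1. *)
Lemma Rintegral_bounded_transfer (P : probability T R) (Q : probability T' R)
    (phi : T -> T') (w : T -> R) (f : T' -> R) (B : R) :
  measurable_fun [set: T] phi -> measurable_fun [set: T] w ->
  measurable_fun [set: T'] f ->
  (forall x, 0 <= w x) -> (forall x, `|f x| <= B) ->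
  (\int[P]_x (w x)%:E = 1)%E ->
  (\int[Q]_x (f x + B)%:E = \int[P]_x ((f (phi x) + B) * w x)%:E)%E ->
  \int[Q]_x f x = \int[P]_x (f (phi x) * w x).
Proof.
move=> mphi mw mf w0 fB w1 fQ.
have iw : P.-integrable [set: T] (EFin \o w).
  apply/integrableP; split; first exact/measurable_EFinP.
  by under eq_integral do rewrite /= ger0_norm//; rewrite w1 ltry.
have ifw : P.-integrable [set: T] (EFin \o (fun x => f (phi x) * w x)).
  apply: (@integrable_dominated _ _ _ _ _ (fun x => B * w x)).
  - by apply: measurable_funM => //; exact: measurableT_comp.
  - rewrite (_ : EFin \o _ = fun x => (B%:E * (w x)%:E)%E); first exact: integrableZl.
    by apply/funext => x /=; rewrite EFinM.
  - by move=> x; rewrite normrM (ger0_norm (w0 x)) ler_wpM2r.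
have iQ : Q.-integrable [set: T'] (EFin \o f) by apply: integrable_bounded => //; exists B.
have icB : Q.-integrable [set: T'] (EFin \o (fun=> B)).
  by apply: integrable_bounded => //; exists `|B|.
have iBw : P.-integrable [set: T] (EFin \o (fun x => B * w x)).
  rewrite (_ : EFin \o _ = fun x => (B%:E * (w x)%:E)%E); first exact: integrableZl.
  by apply/funext => x /=; rewrite EFinM.
have : \int[Q]_x (f x + B) = \int[P]_x (f (phi x) * w x + B * w x).
  rewrite /Rintegral fQ; congr fine; apply: eq_integral => x _.
  by rewrite mulrDl.
rewrite !RintegralD// Rintegral_prob_cst RintegralZl//.
by rewrite {3}/Rintegral w1/= mulr1; exact: addIr.
Qed.

End change_of_variables.

Section normal_law_facts.
Variable R : realType.
Implicit Types (f : R -> R) (m s a b theta : R).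

Lemma ge0_integral_normal_law m s f : measurable_fun [set: R] f ->
  (forall x, 0 <= f x) ->
  (\int[normal_law m s]_x (f x)%:E =
   \int[lebesgue_measure]_x (f x * normal_pdf m s x)%:E)%E.
Proof.
move=> mf f0; rewrite /normal_law ge0_integral_distribution//; last exact/measurable_EFinP.
rewrite (@ge0_integral_density _ _ _ lebesgue_measure _ (fun x => (normal_pdf m s x)%:E))//.
- by apply/measurable_EFinP; exact: measurable_normal_pdf.
- by move=> x; rewrite lee_fin normal_pdf_ge0.
- by apply: measurableT_comp; first exact/measurable_EFinP.
Qed.

Lemma ge0_integral_normal_law_affine m s a b f : 0 < a -> s != 0 -> continuous f ->
  (forall x, 0 <= f x) ->
  (\int[normal_law (a * m + b) (a * s)]_x (f x)%:E =
   \int[normal_law m s]_x (f (a * x + b))%:E)%E.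
Proof.
move=> a0 s0 cf f0.
have cF : continuous (fun x => a * x + b).
  by move=> x; apply: cvgD; [apply: cvgM; [exact: cvg_cst|exact: cvg_id]|exact: cvg_cst].
have as0 : a * s != 0 by rewrite mulf_neq0// gt_eqF.
have mf : measurable_fun [set: R] f by exact: continuous_measurable_fun.
have mfF : measurable_fun [set: R] (fun x => f (a * x + b)).
  apply: continuous_measurable_fun => x.
  by apply: (@continuous_comp _ _ _ (fun x => a * x + b) f); [exact: cF|exact: cf].
rewrite (ge0_integral_normal_law _ _ mf f0).
rewrite (ge0_integral_normal_law _ _ mfF (fun x => f0 _)).
have F' : (fun x => a * x + b)^`()%classic = cst a.
  apply/funext => x; rewrite derive1E deriveD// deriveM// derive_cst derive_id.
  by rewrite derive_cst scaler0 addr0 addr0 /GRing.scale/= mulr1.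
rewrite (@increasing_ge0_integration_by_substitutionT _ (fun x => a * x + b)
  (fun x => f x * normal_pdf (a * m + b) (a * s) x)).
- apply: eq_integral => x _; congr (_%:E); rewrite F' !fctE/=.
  rewrite -mulrA; congr (_ * _).
  rewrite !normal_pdfE// /normal_peak /normal_fun.
  have -> : - (a * x + b - (a * m + b)) ^+ 2 / ((a * s) ^+ 2 *+ 2) =
     - (x - m) ^+ 2 / (s ^+ 2 *+ 2) by field; rewrite s0 gt_eqF.
  rewrite mulrAC; congr (_ * _).
  rewrite exprMn -mulrA -mulrnAr sqrtrM ?sqr_ge0// sqrtr_sqr gtr0_norm//.
  by rewrite invfM mulrAC mulVf ?mul1r// gt_eqF.
- by move=> x y xy; rewrite ltrD2r ltr_pM2l.
- by rewrite F' => x; exact: cvg_cst.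
- by rewrite F'; exact: is_cvg_cst.
- by rewrite F'; exact: is_cvg_cst.
- by move=> x; apply: derivableD => //; apply: derivableM.
- apply: cvg_comp (cvg_addrr_Ny _); apply/gt0_cvgMrNy => //; exact: cvg_id.
- apply: cvg_comp (cvg_addrr _); apply/gt0_cvgMry => //; exact: cvg_id.
- by move=> x; apply: cvgM; [exact: cf|exact: continuous_normal_pdf].
- by move=> x; rewrite mulr_ge0// normal_pdf_ge0.
Qed.

(** Completing the square in the exponent.  The factor has the form of the
    likelihood ratios in a locally asymptotically normal family. *)
Lemma ge0_integral_normal_law_tilt theta s f : s != 0 ->
  measurable_fun [set: R] f -> (forall x, 0 <= f x) ->
  (\int[normal_law (theta * s ^+ 2) s]_x (f x)%:E =
   \int[normal_law 0 s]_x (f x * expR (theta * x - theta ^+ 2 * s ^+ 2 / 2))%:E)%E.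
Proof.
move=> s0 mf f0; pose g x := f x * expR (theta * x - theta ^+ 2 * s ^+ 2 / 2).
have mg : measurable_fun [set: R] g.
  apply: measurable_funM => //; apply: measurableT_comp => //.
  by apply: measurable_funB => //; exact: measurable_funM.
have g0 x : 0 <= g x by rewrite mulr_ge0// expR_ge0.
rewrite (ge0_integral_normal_law _ _ mf f0) (ge0_integral_normal_law _ _ mg g0).
apply: eq_integral => x _; congr (_%:E); rewrite -mulrA; congr (_ * _).
rewrite !normal_pdfE// [RHS]mulrCA; congr (_ * _).
rewrite /normal_fun -expRD; congr expR; field; exact: s0.
Qed.

Lemma Rintegral_normal_law_affine m s a b f : 0 < a -> s != 0 ->
  bounded_continuous f ->
  \int[normal_law (a * m + b) (a * s)]_x f x =
  \int[normal_law m s]_x f (a * x + b).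
Proof.
move=> a0 s0 [cf [B fB]].
have mf : measurable_fun [set: R] f by exact: continuous_measurable_fun.
have mphi : measurable_fun [set: R] (fun x => a * x + b).
  by apply: measurable_funD => //; exact: measurable_funM.
have w1 : (\int[normal_law m s]_x (1 : R)%:E = 1)%E.
  by rewrite integral_cst//= mul1e probability_setT.
have fB1 : (\int[normal_law (a * m + b) (a * s)]_x (f x + B)%:E =
    \int[normal_law m s]_x ((f (a * x + b) + B) * 1)%:E)%E.
  rewrite (@ge0_integral_normal_law_affine m s a b (fun x => f x + B) a0 s0).
  - by apply: eq_integral => x _; rewrite mulr1.
  - by move=> x; apply: cvgD; [exact: cf|exact: cvg_cst].
  - by move=> x; have := fB x; rewrite ler_norml; lra.
have m1 : measurable_fun [set: R] (fun=> 1 : R) by exact: measurable_cst.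
rewrite (Rintegral_bounded_transfer mphi m1 mf (fun=> ler01) fB w1 fB1).
by apply: eq_Rintegral => x _; rewrite mulr1.
Qed.

Lemma integral_normal_law_expR theta s : s != 0 ->
  (\int[normal_law 0 s]_x (expR (theta * x - theta ^+ 2 * s ^+ 2 / 2))%:E = 1)%E.
Proof.
move=> s0.
have H := ge0_integral_normal_law_tilt theta s0 (@measurable_cst _ _ _ _ setT (1 : R))
  (fun=> ler01).
have w1 (P : probability R R) : (\int[P]_x (1 : R)%:E = 1)%E.
  exact: etrans (integral_EFin (integrable_const P 1)) (congr1 EFin (Rintegral_prob_cst P 1)).
apply: etrans (etrans (esym H) (w1 _)).
by apply: eq_integral => x _; rewrite mul1r.
Qed.

Lemma Rintegral_normal_law_tilt theta s f : s != 0 -> bounded_continuous f ->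
  \int[normal_law (theta * s ^+ 2) s]_x f x =
  \int[normal_law 0 s]_x (f x * expR (theta * x - theta ^+ 2 * s ^+ 2 / 2)).
Proof.
move=> s0 [cf [B fB]].
have mf : measurable_fun [set: R] f by exact: continuous_measurable_fun.
have mw : measurable_fun [set: R]
    (fun x => expR (theta * x - theta ^+ 2 * s ^+ 2 / 2)).
  apply: measurableT_comp => //.
  by apply: measurable_funB => //; exact: measurable_funM.
have fB1 := @ge0_integral_normal_law_tilt theta s (fun x => f x + B) s0.
apply: (Rintegral_bounded_transfer (@measurable_id _ _ setT) mw mf _ fB).
- by move=> x; exact: expR_ge0.
- exact: integral_normal_law_expR.
- apply: fB1; first exact: measurable_funD.
  by move=> x; have := fB x; rewrite ler_norml; lra.
Qed.

(** [expR (r * `|x|) <= expR (r * x) + expR (- r * x)], and each of these two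
    is a constant times a probability density. *)
Lemma integrable_normal_law_expR r s : s != 0 ->
  (normal_law 0 s).-integrable [set: R] (EFin \o (fun x => expR (r * `|x|))).
Proof.
move=> s0.
have iexp theta : (normal_law 0 s).-integrable [set: R] (EFin \o (fun x => expR (theta * x))).
  have c0 := expR_gt0 (- (theta ^+ 2 * s ^+ 2 / 2)).
  have iw : (normal_law 0 s).-integrable [set: R]
      (EFin \o (fun x => expR (theta * x - theta ^+ 2 * s ^+ 2 / 2))).
    apply/integrableP; split.
      apply/measurable_EFinP; apply: measurableT_comp => //.
      by apply: measurable_funB => //; exact: measurable_funM.
    under eq_integral do rewrite /= ger0_norm ?expR_ge0//.
    by rewrite integral_normal_law_expR// ltry.
  rewrite (_ : EFin \o _ = fun x => ((expR (theta ^+ 2 * s ^+ 2 / 2))%:E *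
      (expR (theta * x - theta ^+ 2 * s ^+ 2 / 2))%:E)%E).
    exact: integrableZl.
  by apply/funext => x /=; rewrite -EFinM -expRD addrCA subrr addr0.
apply: (@integrable_dominated _ _ _ _ _ (fun x => expR (r * x) + expR (- r * x))).
- apply: measurableT_comp => //; apply: measurable_funM => //.
- by apply: integrable_add; exact: iexp.
- move=> x; rewrite ger0_norm ?expR_ge0//.
  have h1 := expR_ge0 (r * x); have h2 := expR_ge0 (- r * x).
  have [x0|x0] := leP 0 x; first by rewrite ger0_norm//; lra.
  by rewrite (ltr0_norm x0) mulrN -mulNr; lra.
Qed.

End normal_law_facts.

(** * Test functions on the line *)

Section ramp.
Variable R : realType.
Implicit Types (x y a M : R).

Definition ramp x : R := Num.max 0 (Num.min 1 x).

Lemma ramp_ge0 x : 0 <= ramp x.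
Proof. by rewrite /ramp le_max lexx. Qed.

Lemma ramp_le1 x : ramp x <= 1.
Proof. by rewrite /ramp ge_max ler01/= ge_min lexx. Qed.

Lemma ramp_eq0 x : x <= 0 -> ramp x = 0.
Proof. by move=> x0; rewrite /ramp min_r ?max_l// (le_trans x0). Qed.

Lemma ramp_eq1 x : 1 <= x -> ramp x = 1.
Proof. by move=> x1; rewrite /ramp min_l// max_r. Qed.

Lemma le_ramp x y : x <= y -> ramp x <= ramp y.
Proof.
move=> xy; have [x0|x0] := leP x 0; first by rewrite (ramp_eq0 x0) ramp_ge0.
have [y1|y1] := leP 1 y; first by rewrite (ramp_eq1 y1) ramp_le1.
rewrite /ramp !min_r ?max_r//; try exact: ltW; last exact/ltW/(le_lt_trans xy).
exact/ltW/(lt_le_trans x0).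
Qed.

Lemma continuous_ramp : continuous ramp.
Proof.
rewrite (_ : ramp = fun x => Num.max 0 (Num.min 1 x))// => x.
apply: (@continuous_max R R (fun=> 0) (fun v => Num.min 1 v)).
  exact: cvg_cst.
by apply: (@continuous_min R R (fun=> 1) id); [exact: cvg_cst|exact: cvg_id].
Qed.

Lemma normr_ramp_le1 x : `|ramp x| <= 1.
Proof. by rewrite ger0_norm ?ramp_ge0 ?ramp_le1. Qed.

Lemma bounded_continuous_ramp (g : R -> R) : continuous g ->
  bounded_continuous (fun x => ramp (g x)).
Proof.
move=> cg; split; last by exists 1 => x; exact: normr_ramp_le1.
move=> x; apply: (@continuous_comp _ _ _ g ramp); first exact: cg.
exact: continuous_ramp.
Qed.

(** A continuous substitute for the indicator of the interval from [- M] to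
    [M]: tightness stated with it passes from a weak limit to the sequence. *)
Definition cutoff M x := ramp (M + 1 - `|x|).

Lemma bounded_continuous_cutoff M : bounded_continuous (cutoff M).
Proof.
apply: bounded_continuous_ramp => x.
by apply: cvgB; [exact: cvg_cst|apply: cvg_norm; exact: cvg_id].
Qed.

Lemma cutoff_eq1 M x : `|x| <= M -> cutoff M x = 1.
Proof. by move=> xM; rewrite /cutoff ramp_eq1//; lra. Qed.

Lemma cutoff_eq0 M x : M + 1 <= `|x| -> cutoff M x = 0.
Proof. by move=> xM; rewrite /cutoff ramp_eq0//; lra. Qed.

End ramp.

Lemma bounded_continuous_measurable (R : realType) (f : R -> R) :
  bounded_continuous f -> measurable_fun [set: R] f.
Proof. by move=> [cf _]; exact: continuous_measurable_fun. Qed.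

Lemma bounded_continuous_integrable (R : realType) (P : probability R R) (f : R -> R) :
  bounded_continuous f -> P.-integrable [set: R] (EFin \o f).
Proof.
move=> bf; apply: integrable_bounded; last exact: bf.2.
exact: bounded_continuous_measurable.
Qed.

(** The functions [ramp (k%:R * (x - a))] increase to the indicator of the open
    half-line above [a], and these half-lines are stable under intersection. *)
Lemma probability_bounded_continuous_eq (R : realType) (P Q : probability R R) :
  (forall f, bounded_continuous f -> (forall x, 0 <= f x) ->
    \int[P]_x f x = \int[Q]_x f x) ->
  measure_eq P Q.
Proof.
move=> PQ; pose G := @RGenOInfty.G R.
have Goo (a : R) : P `]a, +oo[%classic = Q `]a, +oo[%classic.
  pose f k x : R := ramp (k%:R * (x - a)).
  have bf k : bounded_continuous (f k).
    apply: bounded_continuous_ramp => x.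
    by apply: cvgM; [exact: cvg_cst|apply: cvgB; [exact: cvg_id|exact: cvg_cst]].
  have lim (mu : probability R R) :
      (\int[mu]_x (f k x)%:E @[k --> \oo] --> mu `]a, +oo[%classic)%E.
    have -> : mu `]a, +oo[%classic = (\int[mu]_x (\1_`]a, +oo[%classic x)%:E)%E.
      by rewrite integral_indic// setIT.
    have -> : (\int[mu]_x (\1_`]a, +oo[%classic x)%:E =
       \int[mu]_x (limn (fun k => (f k x)%:E)))%E.
      apply: eq_integral => x _; apply/esym/cvg_lim => //; apply: cvg_EFin.
        by near=> n.
      rewrite /comp/= indicE; have [xa|xa] := leP x a.
        rewrite memNset/=; last by rewrite in_itv/= andbT; apply/negP; rewrite -leNgt.
        rewrite (_ : (fun k => _) = fun=> 0); first exact: cvg_cst.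
        apply/funext => k; rewrite /f ramp_eq0// mulr_ge0_le0// subr_le0//.
      rewrite mem_set/=; last by rewrite in_itv/= xa.
      apply: cvg_near_cst; near=> k; rewrite /f ramp_eq1//.
      rewrite -ler_pdivrMr ?subr_gt0//.
      by near: k; exact: nbhs_infty_ger.
    apply: cvg_monotone_convergence => //.
    - by move=> k; apply/measurable_EFinP; exact: bounded_continuous_measurable.
    - by move=> k x _; rewrite lee_fin ramp_ge0.
    - move=> x _ m n mn; rewrite lee_fin.
      have [xa|xa] := leP x a.
        by rewrite /f !ramp_eq0// mulr_ge0_le0// subr_le0.
      by apply: le_ramp; rewrite ler_wpM2r ?ler_nat// subr_ge0 ltW.
  apply: (cvg_unique _ (lim P)) => //.
  rewrite (_ : (fun k => _) = fun k => (\int[Q]_x (f k x)%:E)%E); first exact: lim.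
  apply/funext => k; rewrite !integral_EFin ?PQ//.
  - by move=> x; exact: ramp_ge0.
  - exact: bounded_continuous_integrable.
  - exact: bounded_continuous_integrable.
move=> A mA.
apply: (measure_unique G (fun k => `]- k%:R, +oo[%classic)) => //.
- exact: RGenOInfty.measurableE.
- move=> _ _ [x ->] [y ->]; exists (Num.max x y).
  apply/seteqP; split => z /=; rewrite !in_itv/= !andbT gt_max.
    by move=> [-> ->].
  by move=> /andP[].
- by move=> k; exists (- k%:R).
- apply/seteqP; split => // x _; exists (Num.truncn `|x|).+1 => //=.
  rewrite in_itv/= andbT ltrNl (le_lt_trans (ler_norm _))// normrN.
  exact: truncnS_gt.
- by move=> _ [x ->]; exact: Goo.
- by move=> k; rewrite (@le_lt_trans _ _ 1%E)// ?ltry// probability_le1.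
Unshelve. all: by end_near. Qed.

Lemma weak_cvgP (R : realType) (mu : nat -> probability R R) (nu : probability R R) :
  weak_cvg mu nu <-> forall f, bounded_continuous f ->
    \int[mu n]_x f x @[n --> \oo] --> \int[nu]_x f x.
Proof.
split=> [h f bf|h f cf bf].
  apply: fine_cvg; rewrite -integral_EFin; last exact: bounded_continuous_integrable.
  by apply: h; case: bf.
rewrite integral_EFin; last exact: bounded_continuous_integrable.
apply/fine_cvgP; split; last exact: h.
near=> n; apply: integrable_fin_num => //; exact: bounded_continuous_integrable.
Unshelve. all: by end_near. Qed.

(** * Test functions of product form on the plane *)

Lemma continuous_pairl (R : realType) (a : R) : continuous (fun y : R => (a, y)).
Proof.
move=> y.
have := @cvg_pair _ _ _ (nbhs y) (nbhs a) (nbhs y) _ _ _ (fun=> a) id (cvg_cst a) cvg_id.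
exact.
Qed.

Section tensor.
Variable R : realType.
Implicit Types (f : R * R -> R) (B M e : R).

Definition tensor_sum N (F G : nat -> R -> R) (p : R * R) : R :=
  \sum_(i < N) F i p.1 * G i p.2.

(** Piecewise linear interpolation in the first variable, with the functions
    [f (a i, y)] of the second variable as coefficients: the [F i] form a
    partition of unity on the square, each supported near [a i]. *)
Lemma tensor_approx f B M e : continuous f -> (forall p, `|f p| <= B) -> 0 < e ->
  exists N F G, [/\ forall i, bounded_continuous (F i),
    forall i, bounded_continuous (G i),
    forall p, `|tensor_sum N F G p| <= B &
    forall p, `|p.1| <= M -> `|p.2| <= M -> `|f p - tensor_sum N F G p| <= e].
Proof.
move=> cf fB e0.
have B0 : 0 <= B by exact: le_trans (fB (0, 0)).
have cK : compact (`[- M, M]%classic `*` `[- M, M]%classic : set (R * R)).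
  by apply: compact_setX; exact: segment_compact.
have [d d0 hd] := heine_cantor cK cf e0.
have d2 : 0 < d / 2 by rewrite divr_gt0.
pose s x := (x + M) / (d / 2) + 1.
pose N := (Num.truncn `|2 * M / (d / 2) + 1|).+1.
pose F i x := ramp (s x - i%:R) - ramp (s x - i.+1%:R).
pose a i := - M + i%:R * (d / 2).
pose G i y := f (a i, y).
have F0 i x : 0 <= F i x.
  by rewrite subr_ge0 le_ramp// lerD2l lerN2 ler_nat.
have Fsum x : \sum_(i < N) F i x = ramp (s x) - ramp (s x - N%:R).
  elim: N => [|n IH]; first by rewrite big_ord0 subr0 subrr.
  by rewrite big_ord_recr/= IH /F addrA subrK.
have Fsum1 x : \sum_(i < N) F i x <= 1.
  by rewrite Fsum (le_trans _ (ramp_le1 (s x)))// gerBl ramp_ge0.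
have cs : continuous s.
  move=> x; apply: cvgD; last exact: cvg_cst.
  by apply: cvgM; [apply: cvgD; [exact: cvg_id|exact: cvg_cst]|exact: cvg_cst].
exists N, F, G; split.
- move=> i; apply: bounded_continuousB; apply: bounded_continuous_ramp => x.
    by apply: cvgB; [exact: cs|exact: cvg_cst].
  by apply: cvgB; [exact: cs|exact: cvg_cst].
- move=> i; split; last by exists B => y; exact: fB.
  move=> y; apply: (@continuous_comp _ _ _ (fun y => (a i, y)) f); last exact: cf.
  exact: continuous_pairl.
- move=> p; rewrite /tensor_sum (le_trans (ler_norm_sum _ _ _))//.
  apply: (@le_trans _ _ (\sum_(i < N) F i p.1 * B)).
    by apply: ler_sum => i _; rewrite normrM (ger0_norm (F0 _ _)) ler_wpM2l// fB.
  by rewrite -mulr_suml ler_piMl// Fsum1.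
- move=> [x y] /= xM yM.
  have Fsx : \sum_(i < N) F i x = 1.
    rewrite Fsum ramp_eq1 ?ramp_eq0 ?subr0//.
      move: xM; rewrite ler_norml => /andP[x1 x2].
      rewrite subr_le0 /s (@le_trans _ _ (2 * M / (d / 2) + 1))//.
        by rewrite lerD2r ler_pM2r ?invr_gt0//; lra.
      by rewrite (le_trans (ler_norm _))// ltW// /N truncnS_gt.
    move: xM; rewrite ler_norml => /andP[x1 x2].
    by rewrite /s lerDr divr_ge0 ?(ltW d2)//; lra.
  rewrite -[f _]mulr1 -Fsx mulr_sumr /tensor_sum -sumrB (le_trans (ler_norm_sum _ _ _))//.
  apply: (@le_trans _ _ (\sum_(i < N) F i x * e)); last by rewrite -mulr_suml Fsx mul1r.
  apply: ler_sum => i _ /=.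
  rewrite mulrC -mulrBr normrM (ger0_norm (F0 _ _)).
  have [->|Fi0] := eqVneq (F i x) 0; first by rewrite !mul0r.
  rewrite ler_wpM2l// ltW//; apply: hd.
    by split; rewrite /= in_itv/= -ler_norml.
  split => /=; last exact: ballxx.
  rewrite /ball/= /a.
  have i1 : i%:R < s x.
    by rewrite ltNge; apply: contra Fi0 => h; rewrite /F !ramp_eq0 ?subrr// subr_le0// (le_trans h)// ler_nat.
  have i2 : s x < i%:R + 2.
    rewrite ltNge; apply: contra Fi0 => h; rewrite /F !ramp_eq1 ?subrr//.
      by rewrite -natr1; lra.
    by lra.
  move: i1 i2; rewrite /s -ltrBlDr ltr_pdivlMr// => i1.
  rewrite (_ : i%:R + 2 = i%:R + 1 + 1) ?ltrD2r ?ltr_pdivrMr//; last by ring.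
  move=> i2; rewrite ltr_norml; apply/andP; split; lra.
Qed.

Lemma measurable_tensor_sum N F G : (forall i, measurable_fun [set: R] (F i)) ->
  (forall i, measurable_fun [set: R] (G i)) ->
  measurable_fun [set: R * R] (tensor_sum N F G).
Proof.
move=> mF mG; apply: measurable_sum => i; apply: measurable_funM.
  by apply: measurableT_comp => //; exact: measurable_fst.
by apply: measurableT_comp => //; exact: measurable_snd.
Qed.

(** The sigma-algebra on the plane is the product one, for which sums of
    products are measurable; a continuous function is a pointwise limit of
    such sums, taken on growing squares. *)
Lemma continuous_measurable_fun2 f : continuous f ->
  (exists B, forall p, `|f p| <= B) -> measurable_fun [set: R * R] f.
Proof.
move=> cf [B fB].
pose good (k : nat) (g : R * R -> R) := measurable_fun [set: R * R] g /\
  forall p, `|p.1| <= k%:R -> `|p.2| <= k%:R -> `|f p - g p| <= k.+1%:R^-1.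
have : forall k, exists g, good k g.
  move=> k; have k0 : 0 < k.+1%:R^-1 :> R by rewrite invr_gt0.
  have [N [F [G [bF bG _ fg]]]] := @tensor_approx f B k%:R _ cf fB k0.
  exists (tensor_sum N F G); split=> //.
  by apply: measurable_tensor_sum => i; exact: bounded_continuous_measurable.
move=> /choice[g hg].
apply: (@measurable_fun_cvg _ _ _ _ g) => [k|p _]; first exact: (hg k).1.
apply/cvgrPdist_le => e e0; near=> k.
rewrite (le_trans ((hg k).2 p _ _))//.
- by near: k; exact: nbhs_infty_ger.
- by near: k; exact: nbhs_infty_ger.
- rewrite invf_ple ?posrE// (@le_trans _ _ k%:R)// ?ler_nat//.
  by near: k; exact: nbhs_infty_ger.
Unshelve. all: by end_near. Qed.

Lemma Rintegral_sum d (T : measurableType d) (P : probability T R) N (F : nat -> T -> R) :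
  (forall i, P.-integrable [set: T] (EFin \o F i)) ->
  P.-integrable [set: T] (EFin \o (fun x => \sum_(i < N) F i x)) /\
  \int[P]_x (\sum_(i < N) F i x) = \sum_(i < N) \int[P]_x F i x.
Proof.
move=> iF; elim: N => [|N [IHi IH]].
  have -> : (fun x => \sum_(i < 0) F i x) = fun=> 0.
    by apply/funext => x; rewrite big_ord0.
  split; first by apply: integrable_bounded => //; exists 0 => x; rewrite normr0.
  by rewrite Rintegral_prob_cst big_ord0.
split.
  rewrite (_ : (fun x => _) = fun x => \sum_(i < N) F i x + F N x).
    exact: integrable_add.
  by apply/funext => x /=; rewrite big_ord_recr.
under eq_Rintegral do rewrite big_ord_recr/=.
by rewrite big_ord_recr/= RintegralD// IH.
Qed.

(** On a large square [f] is uniformly close to a sum of products.  The mass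
    outside is controlled by the product [chi] of two cutoffs: this is itself a
    product, so convergence on products includes tightness. *)
Lemma weak_cvg2_tensor (mu : nat -> probability (R * R)%type R)
    (nu : probability (R * R)%type R) :
  (forall F G, bounded_continuous F -> bounded_continuous G ->
    \int[mu n]_p (F p.1 * G p.2) @[n --> \oo] --> \int[nu]_p (F p.1 * G p.2)) ->
  weak_cvg2 mu nu.
Proof.
move=> FG f cf [B0 fB0]; pose B := `|B0| + 1.
have B_gt0 : 0 < B by rewrite ltr_wpDl.
have fB p : `|f p| <= B.
  by rewrite (le_trans (fB0 p))// (le_trans (ler_norm _))// lerDl.
have mf : measurable_fun [set: R * R] f.
  by apply: continuous_measurable_fun2 => //; exists B.
have if_ (P : probability (R * R)%type R) : P.-integrable [set: R * R] (EFin \o f).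
  by apply: integrable_bounded => //; exists B.
rewrite integral_EFin//; apply/fine_cvgP; split.
  by near=> n; exact: (integrable_fin_num measurableT (if_ (mu n))).
apply/cvgrPdist_le => e e0.
have mFG F G : bounded_continuous F -> bounded_continuous G ->
    measurable_fun [set: R * R] (fun p => F p.1 * G p.2).
  move=> bF bG; apply: measurable_funM.
    apply: measurableT_comp; last exact: measurable_fst.
    exact: bounded_continuous_measurable.
  apply: measurableT_comp; last exact: measurable_snd.
  exact: bounded_continuous_measurable.
have iFG (P : probability (R * R)%type R) F G : bounded_continuous F -> bounded_continuous G ->
    P.-integrable [set: R * R] (EFin \o (fun p => F p.1 * G p.2)).
  move=> bF bG; apply: integrable_bounded; first exact: mFG.
  have [_ [C FC]] := bF; have [_ [D GD]] := bG.
  by exists (C * D) => p; rewrite normrM ler_pM.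
pose chi k p : R := cutoff k%:R p.1 * cutoff k%:R p.2.
have chi01 k p : 0 <= chi k p <= 1.
  rewrite mulr_ge0 ?ramp_ge0//= -[leRHS]mulr1.
  by rewrite ler_pM ?ramp_ge0 ?ramp_le1.
have chi_lim : \int[nu]_p chi k p @[k --> \oo] --> (1 : R).
  have bc k := @bounded_continuous_cutoff R k%:R.
  rewrite -(Rintegral_prob_cst nu 1).
  apply: fine_cvg; rewrite -integral_EFin; last first.
    by apply: integrable_bounded => //; exists 1 => p; rewrite normr1.
  have -> : (\int[nu]_p (1 : R)%:E = \int[nu]_p (limn (fun k => (chi k p)%:E)))%E.
    apply: eq_integral => p _; apply/esym/cvg_lim => //; apply: cvg_near_cst.
    near=> k; rewrite /chi !cutoff_eq1 ?mulr1//.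
      by near: k; exact: nbhs_infty_ger.
    by near: k; exact: nbhs_infty_ger.
  apply: cvg_monotone_convergence => //.
  - by move=> k; apply/measurable_EFinP; exact: mFG.
  - by move=> k p _; rewrite lee_fin; case/andP: (chi01 k p).
  - move=> p _ m n mn; rewrite lee_fin; apply: ler_pM; rewrite ?ramp_ge0//.
      by apply: le_ramp; rewrite lerD2r lerD2r ler_nat.
    by apply: le_ramp; rewrite lerD2r lerD2r ler_nat.
(* the errors below add up to [3 * eta + 6 * B * eta] *)
pose eta := e / (4 + 8 * B).
have eta0 : 0 < eta by rewrite divr_gt0// addr_gt0// mulr_gt0.
move/cvgrPdist_le : chi_lim => /(_ _ eta0)[k _ /(_ k (leqnn k))/= hk].
have bchi := @bounded_continuous_cutoff R k%:R.
have [N [F [G [bF bG gB fg]]]] := @tensor_approx f B (k%:R + 1) _ cf fB eta0.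
pose g := tensor_sum N F G.
have mg : measurable_fun [set: R * R] g.
  by apply: measurable_tensor_sum => i; exact: bounded_continuous_measurable.
have ig (P : probability (R * R)%type R) : P.-integrable [set: R * R] (EFin \o g).
  by apply: integrable_bounded => //; exists B.
have fgE p : `|f p - g p| <= eta + 2 * B * (1 - chi k p).
  have /andP[c0 c1] := chi01 k p.
  have [/andP[h1 h2]|h] := boolP ((`|p.1| <= k%:R + 1) && (`|p.2| <= k%:R + 1)).
    by rewrite (le_trans (fg p h1 h2))// lerDl mulr_ge0 ?subr_ge0// mulr_ge0// ltW.
  have -> : chi k p = 0.
    move: h; rewrite negb_and -!ltNge => /orP[] /ltW h.
      by rewrite /chi cutoff_eq0// mul0r.
    by rewrite /chi (cutoff_eq0 h) mulr0.
  rewrite (le_trans (ler_normB _ _))//.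
  by have := fB p; have := gB p; rewrite -/g; lra.
have bound (P : probability (R * R)%type R) :
    `|\int[P]_p f p - \int[P]_p g p| <= eta + 2 * B * (1 - \int[P]_p chi k p).
  have ichi : P.-integrable [set: R * R] (EFin \o chi k) by exact: iFG.
  have i1 c := integrable_const P c.
  have i1c : P.-integrable [set: R * R] (EFin \o (fun p => 1 - chi k p)).
    exact: integrable_sub.
  have i2c : P.-integrable [set: R * R] (EFin \o (fun p => 2 * B * (1 - chi k p))).
    exact: integrable_scale.
  have -> : eta + 2 * B * (1 - \int[P]_p chi k p) =
      \int[P]_p (eta + 2 * B * (1 - chi k p)).
    have e1 : \int[P]_p (1 - chi k p) = 1 - \int[P]_p chi k p.
      by rewrite (RintegralB measurableT (i1 1) ichi) Rintegral_prob_cst.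
    rewrite (RintegralD measurableT (i1 eta) i2c) Rintegral_prob_cst.
    by rewrite (RintegralZl (2 * B) measurableT i1c) e1.
  rewrite -(RintegralB measurableT (if_ P) (ig P)).
  apply: normr_Rintegral_le fgE; first exact: measurable_funB.
  exact: integrable_add.
have gcvg : \int[mu n]_p g p @[n --> \oo] --> \int[nu]_p g p.
  have gE (P : probability (R * R)%type R) : \int[P]_p g p =
      \sum_(i < N) \int[P]_p (F i p.1 * G i p.2).
    by apply: (@Rintegral_sum _ _ P N (fun i p => F i p.1 * G i p.2) _).2 => i; exact: iFG.
  rewrite gE; under eq_fun do rewrite gE.
  elim: (N) => [|m IH].
    rewrite big_ord0 (_ : (fun n => _) = fun=> 0); first exact: cvg_cst.
    by apply/funext => n; rewrite big_ord0.
  rewrite big_ord_recr/= (_ : (fun n => _) = fun n =>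
    \sum_(i < m) \int[mu n]_p (F i p.1 * G i p.2) + \int[mu n]_p (F m p.1 * G m p.2)).
    by apply: cvgD; [exact: IH|exact: FG].
  by apply/funext => n; rewrite big_ord_recr.
have chicvg : \int[mu n]_p chi k p @[n --> \oo] --> \int[nu]_p chi k p by exact: FG.
move/cvgrPdist_le : gcvg => /(_ _ eta0) gcvg.
move/cvgrPdist_le : chicvg => /(_ _ eta0) chicvg.
near=> n.
have h1 : `|\int[nu]_p g p - \int[mu n]_p g p| <= eta by near: n.
have h2 : `|\int[nu]_p chi k p - \int[mu n]_p chi k p| <= eta by near: n.
have h3 := bound nu; have h4 := bound (mu n).
rewrite -[fine _]/(\int[mu n]_p f p).
have etaE : eta * (4 + 8 * B) = e by rewrite /eta divfK// gt_eqF// addr_gt0// mulr_gt0.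
move: hk h1 h2 h3 h4; rewrite !ler_norml => /andP[k1 k2] /andP[a1 a2] /andP[b1 b2] /andP[c1 c2] /andP[d1 d2].
have l1 : 2 * B * (1 - \int[nu]_p chi k p) <= 2 * B * eta.
  by rewrite ler_wpM2l ?mulr_ge0 ?(ltW B_gt0)//.
have l2 : 2 * B * (1 - \int[mu n]_p chi k p) <= 2 * B * (2 * eta).
  by rewrite ler_wpM2l ?mulr_ge0 ?(ltW B_gt0)//; lra.
have Beta : 0 < B * eta by rewrite mulr_gt0.
apply/andP; split; lra.
Unshelve. all: by end_near. Qed.

End tensor.

(** * Existence of a limit law *)

Section partition.
Variable R : realType.
Implicit Types (P : probability R R) (f : R -> R) (B e M x z : R).

Definition cdfr P z : R := fine (P `]-oo, z]%classic).

Let H z x : R := \1_(`]-oo, z]%classic) x.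

Let HE z x : H z x = (x <= z)%R%:R.
Proof. by rewrite /H indicE mem_setE in_itv. Qed.

Let le_H z z' x : z <= z' -> H z x <= H z' x.
Proof.
move=> zz'; rewrite !HE ler_nat; have [xz|//] := leP x z.
by rewrite (le_trans xz zz').
Qed.

Let integrable_H P z : P.-integrable [set: R] (EFin \o H z).
Proof. exact: integrable_indic. Qed.

Let measurable_H z : measurable_fun [set: R] (H z).
Proof. exact: measurable_indic. Qed.

Let integrable_HB P z z' :
  P.-integrable [set: R] (EFin \o (fun x => H z x - H z' x)).
Proof. exact: integrable_sub (integrable_H _ _) (integrable_H _ _). Qed.

Let int_H P z : \int[P]_x H z x = cdfr P z.
Proof. by rewrite /Rintegral integral_indic// setIT. Qed.

Let int_HB P z z' : \int[P]_x (H z x - H z' x) = cdfr P z - cdfr P z'.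
Proof.
by rewrite (RintegralB measurableT (integrable_H _ _) (integrable_H _ _)) !int_H.
Qed.

Lemma cdfr_ge0 P z : 0 <= cdfr P z.
Proof. by rewrite fine_ge0. Qed.

Lemma cdfr_le1 P z : cdfr P z <= 1.
Proof.
rewrite -[leRHS]/(fine 1%:E) fine_le//; last exact: probability_le1.
by rewrite fin_num_measure.
Qed.

Lemma le_cdfr P z z' : z <= z' -> cdfr P z <= cdfr P z'.
Proof.
move=> zz'; rewrite -!int_H.
by apply: le_Rintegral => [//|||x _]; [exact: integrable_H|exact: integrable_H|exact: le_H].
Qed.

Lemma cutoff_le_cdfr P M M' : 0 <= M' -> M + 1 <= M' ->
  \int[P]_x cutoff M x <= cdfr P M' - cdfr P (- M').
Proof.
move=> M'0 MM'; rewrite -int_HB; apply: le_Rintegral => //.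
- exact/bounded_continuous_integrable/bounded_continuous_cutoff.
- exact: integrable_HB.
- move=> x _; rewrite !HE.
  have [xM|] := leP M' `|x|.
    rewrite cutoff_eq0 ?(le_trans MM')// subr_ge0 ler_nat.
    have [h|//] := leP x (- M').
    by rewrite (le_trans h)// (le_trans _ M'0)// oppr_le0.
  rewrite ltr_norml => /andP[x1 x2].
  by rewrite (ltW x2) [x <= - M']leNgt x1/= subr0 ramp_le1.
Qed.

(** A Riemann sum in which the distribution function enters only through its
    values at the grid points, so that pointwise information on distribution
    functions gives information on integrals. *)
Lemma partition_estimate P f B e N (z : nat -> R) (c : nat -> R) :
  bounded_continuous f -> (forall x, `|f x| <= B) -> {homo z : i j / (i <= j)%N >-> i <= j} ->
  0 <= e ->
  (forall i x, (i < N)%N -> z i < x -> x <= z i.+1 -> `|f x - c i| <= e) ->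
  `|\int[P]_x f x - \sum_(i < N) c i * (cdfr P (z i.+1) - cdfr P (z i))| <=
    e + B * (1 - (cdfr P (z N) - cdfr P (z 0%N))).
Proof.
move=> bf fB ndz e0 fc.
have D0 i x : 0 <= H (z i.+1) x - H (z i) x by rewrite subr_ge0 le_H// ndz.
have iD i : P.-integrable [set: R] (EFin \o (fun x => H (z i.+1) x - H (z i) x)).
  exact: integrable_HB.
have icD i : P.-integrable [set: R] (EFin \o (fun x => c i * (H (z i.+1) x - H (z i) x))).
  exact: integrable_scale.
have [ig gE] := Rintegral_sum N icD.
have sumE : \sum_(i < N) c i * (cdfr P (z i.+1) - cdfr P (z i)) =
    \sum_(i < N) \int[P]_x (c i * (H (z i.+1) x - H (z i) x)).
  by apply: eq_bigr => i _; rewrite RintegralZl// int_HB.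
have tele x : \sum_(i < N) (H (z i.+1) x - H (z i) x) = H (z N) x - H (z 0%N) x.
  by rewrite -(big_mkord xpredT (fun i => H (z i.+1) x - H (z i) x)) telescope_sumr.
have B0 : 0 <= B by exact: le_trans (fB 0).
have ib : P.-integrable [set: R] (EFin \o (fun x => e + B * (1 - (H (z N) x - H (z 0%N) x)))).
  apply: integrable_add; first exact: integrable_const.
  apply: integrable_scale; apply: integrable_sub; first exact: integrable_const.
  exact: integrable_HB.
have -> : e + B * (1 - (cdfr P (z N) - cdfr P (z 0%N))) =
    \int[P]_x (e + B * (1 - (H (z N) x - H (z 0%N) x))).
  have i1 : P.-integrable [set: R] (EFin \o (fun x => H (z N) x - H (z 0%N) x)).
    exact: integrable_HB.
  have i2 : P.-integrable [set: R] (EFin \o (fun x => 1 - (H (z N) x - H (z 0%N) x))).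
    by apply: integrable_sub => //; exact: integrable_const.
  rewrite RintegralD//; last 2 first.
    exact: integrable_const.
    exact: integrable_scale.
  rewrite Rintegral_prob_cst RintegralZl// RintegralB//; last exact: integrable_const.
  by rewrite Rintegral_prob_cst int_HB.
rewrite sumE -gE -RintegralB//; last exact: bounded_continuous_integrable.
apply: normr_Rintegral_le => //.
  apply: measurable_funB; first exact: bounded_continuous_measurable.
  by apply: measurable_sum => i; apply: measurable_funM => //; apply: measurable_funB; exact: measurable_H.
move=> x; set S := H (z N) x - H (z 0%N) x.
have S1 : S <= 1 by rewrite /S !HE; case: (x <= z N); case: (x <= z 0%N) => /=; lra.
have S0 : 0 <= S by rewrite subr_ge0 le_H// ndz.
have -> : f x - \sum_(i < N) c i * (H (z i.+1) x - H (z i) x) =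
    f x * (1 - S) + \sum_(i < N) (f x - c i) * (H (z i.+1) x - H (z i) x).
  have SE : S = \sum_(i < N) (H (z i.+1) x - H (z i) x) by rewrite tele.
  rewrite [in RHS]SE.
  rewrite mulrBr mulr1 mulr_sumr -addrA; congr (_ + _).
  rewrite -sumrN -sumrN -big_split/=; apply: eq_bigr => i _; ring.
rewrite (le_trans (ler_normD _ _))// addrC lerD//; last first.
  by rewrite normrM (ger0_norm (_ : 0 <= 1 - S)) ?subr_ge0// ler_wpM2r// subr_ge0.
rewrite (le_trans (ler_norm_sum _ _ _))//.
apply: (@le_trans _ _ (\sum_(i < N) e * (H (z i.+1) x - H (z i) x))).
  apply: ler_sum => i _; rewrite normrM (ger0_norm (D0 _ _)).
  have [->|Di] := eqVneq (H (z i.+1) x - H (z i) x) 0; first by rewrite !mulr0.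
  rewrite ler_wpM2r//; apply: fc => //.
    rewrite ltNge; apply: contra Di => h; rewrite !HE h (le_trans h) ?subrr//.
    exact: ndz.
  rewrite leNgt; apply: contra Di => h; rewrite !HE !leNgt h/= (le_lt_trans _ h) ?subrr//.
  exact: ndz.
by rewrite -mulr_sumr tele -/S ler_piMr.
Qed.

End partition.

Section helly.
Variable R : realType.
Implicit Types (f : R -> R) (B e M x y z : R).
Variable mu : nat -> probability R R.
Hypothesis mu_tight : forall e, 0 < e -> exists M, \forall n \near \oo,
  1 - e <= \int[mu n]_x cutoff M x.

(** By Tychonoff's theorem the distribution functions have a cluster point for
    pointwise convergence.  It is approached at finitely many arguments at a
    time, along indices in any set [A] that contains all large ones. *)
Let cluster_cdf : exists F : R -> R, forall (N : nat) (a : nat -> R) e (A : set nat),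
  0 < e -> (\forall n \near \oo, A n) ->
  exists2 n, A n & forall i, (i <= N)%N -> `|F (a i) - cdfr (mu n) (a i)| < e.
Proof.
pose PT : topologicalType := prod_topology (fun _ : R => R : topologicalType).
have cK : compact [set f : PT |
    forall z : R, `[0, 1]%classic (f z)].
  exact: (@tychonoff R (fun=> R) (fun=> `[0, 1]%classic) (fun=> @segment_compact R 0 1)).
pose FF : set_system PT :=
  (fun n => cdfr (mu n)) @ \oo.
have PF : ProperFilter FF by exact: fmap_proper_filter.
have FF01 : FF [set f | forall z : R, `[0, 1]%classic (f z)].
  exists 0%N => // n _ z /=; rewrite in_itv/=; apply/andP.
  by split; [exact: cdfr_ge0|exact: cdfr_le1].
have [F [_ clF]] := cK FF PF FF01.
exists F => N a e A e0 nA.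
have FFl : Filter (nbhs (F : PT)) by exact: nbhs_filter.
have nbF : nbhs (F : PT)
    [set G : PT | forall i : 'I_N.+1, `|F (a i) - G (a i)| < e].
  apply: (@filter_forall PT 'I_N.+1 (fun i => [set G : PT | `|F (a i) - G (a i)| < e]) _ FFl) => i.
  have := @proj_continuous R (fun=> R : topologicalType) (a i) F.
  by move=> /cvgrPdist_lt/(_ _ e0).
have FA : FF [set G | exists2 n, A n & G = cdfr (mu n)].
  by apply: filterS nA => n An /=; exists n.
have [G [[n An ->] hG]] := clF _ _ FA nbF.
exists n => // i iN.
exact: (hG (Ordinal (iN : (i < N.+1)%N))).
Qed.

(** Only the integrals already known to converge are identified, which spares
    the extraction of subsequences.  The right limits [G] of a cluster point
    [F] of the distribution functions form a distribution function by
    tightness.  Integrals against [nu] and [mu n] are compared by Riemann sums;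
    the grid for [mu n] is shifted to the right by a small [dl], because [F] is
    close to [G (a i)] at [a i + dl] but possibly not at [a i]. *)
Theorem helly : exists nu : probability R R, forall f l, bounded_continuous f ->
  \int[mu n]_x f x @[n --> \oo] --> l -> \int[nu]_x f x = l.
Proof.
have [F clF] := cluster_cdf.
have F_close2 z z' e : 0 < e -> exists n, `|F z - cdfr (mu n) z| < e /\ `|F z' - cdfr (mu n) z'| < e.
  move=> e0; have nT : \forall n \near \oo, [set: nat] n by exact: nearW.
  have [n _ hn] := clF 1%N (fun i => if i == 0%N then z else z') _ _ e0 nT.
  by exists n; split; [exact: (hn 0%N)|exact: (hn 1%N)].
have ndF : {homo F : x y / x <= y}.
  move=> x y xy; apply/ler_addgt0Pr => e e0.
  have e20 : 0 < e / 2 by rewrite divr_gt0.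
  have [n [h1 h2]] := F_close2 x y _ e20.
  have := le_cdfr (mu n) xy.
  by move: h1 h2; rewrite !ltr_norml => /andP[? ?] /andP[? ?]; lra.
have F01 z : 0 <= F z <= 1.
  apply/andP; split; apply/ler_addgt0Pr => e e0; have [n [h1 _]] := F_close2 z z _ e0;
    have := cdfr_ge0 (mu n) z; have := cdfr_le1 (mu n) z;
    by move: h1; rewrite !ltr_norml => /andP[? ?]; lra.
have F_tail e : 0 < e -> exists2 M, 0 < M & 1 - e <= F M /\ F (- M) <= e.
  move=> e0; have e20 : 0 < e / 2 by rewrite divr_gt0.
  have [M0 hM0] := mu_tight e20.
  pose M := `|M0| + 1.
  have M0M : M0 + 1 <= M by rewrite lerD2r ler_norm.
  exists M; first by rewrite ltr_wpDl.
  have [n nM hn] := clF 1%N (fun i => if i == 0%N then M else - M) _ _ e20 hM0.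
  have h1 := hn 0%N isT; have h2 := hn 1%N isT; rewrite /= in h1 h2.
  have M0' : 0 <= M by rewrite addr_ge0.
  have := cutoff_le_cdfr (mu n) M0' M0M; move: nM => /= nM.
  have := cdfr_ge0 (mu n) (- M); have := cdfr_le1 (mu n) M.
  by move: h1 h2; rewrite !ltr_norml => /andP[? ?] /andP[? ?]; split; lra.
pose G z := inf [set F y | y in [set y | z < y]].
have infz z : has_inf [set F y | y in [set y | z < y]].
  split; first by exists (F (z + 1)), (z + 1) => //=; rewrite ltrDl.
  by exists 0 => _ [y _ <-]; case/andP: (F01 y).
have GF z y : z < y -> G z <= F y.
  by move=> zy; apply: ge_inf; [exact: (infz z).2|exists y].
have FG z y : y <= z -> F y <= G z.
  move=> yz; apply: lb_le_inf; first exact: (infz z).1.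
  by move=> _ [w /= zw <-]; apply: ndF; rewrite (le_trans yz)// ltW.
have G_near z e : 0 < e -> exists2 y, z < y & F y < G z + e.
  move=> e0; have [_ [y /= zy <-] h] := inf_adherent e0 (infz z).
  by exists y.
have ndG : {homo G : x y / x <= y}.
  move=> x y xy; apply/ler_addgt0Pr => e e0.
  have [w yw Fw] := G_near y _ e0.
  by rewrite (le_trans (GF _ _ (le_lt_trans xy yw)))// ltW.
have rcG : right_continuous G.
  move=> z; apply/cvgrPdist_le => e e0.
  have [y zy Fy] := G_near z _ e0.
  near=> x; have zx : z < x by near: x; exact: nbhs_right_gt.
  have xy : x < y by near: x; exact: nbhs_right_lt.
  have := ndG _ _ (ltW zx); have := GF _ _ xy => h1 h2.
  by rewrite ler_norml; apply/andP; split; lra.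
have G01 z : 0 <= G z <= 1.
  apply/andP; split.
    by rewrite (le_trans _ (FG z z _))//; case/andP: (F01 z).
  by rewrite (le_trans (GF z (z + 1) _)) ?ltrDl//; case/andP: (F01 (z + 1)).
have GNy : G @ -oo --> (0 : R).
  apply/cvgrPdist_le => e e0; have [M M0 [_ h]] := F_tail _ e0.
  near=> x; rewrite sub0r normrN ger0_norm; last by case/andP: (G01 x).
  rewrite (le_trans (GF x (- M) _))//.
  by near: x; apply: nbhs_ninfty_lt; exact: num_real.
have Gy : G @ +oo --> (1 : R).
  apply/cvgrPdist_le => e e0; have [M M0 [h _]] := F_tail _ e0.
  near=> x; rewrite ger0_norm ?subr_ge0; last by case/andP: (G01 x).
  have : F M <= G x by apply: FG; near: x; apply: nbhs_pinfty_ge; exact: num_real.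
  lra.
pose Gc := isCumulative.Build R _ R G ndG rcG.
pose Gb := isCumulativeBounded.Build R 0 1 G GNy Gy.
pose Gm : cumulativeBounded (0 : R) (1 : R) := HB.pack G Gc Gb.
pose nu : probability R R := distribution (lebesgue_stieltjes_measure Gm) (@idTR R).
have nuE z : cdfr nu z = G z.
  by rewrite /cdfr; have := cdf_lebesgue_stieltjes_id Gm z; rewrite /cdf /nu /distribution /pushforward/= => ->.
exists nu => f l bf fl.
have [cf [B0 fB0]] := bf.
pose B := `|B0| + 1; have B_gt0 : 0 < B by rewrite ltr_wpDl.
have fB x : `|f x| <= B.
  by rewrite (le_trans (fB0 x))// (le_trans (ler_norm _))// lerDl.
apply/eqP; rewrite -subr_eq0 -normr_le0; apply/ler_addgt0Pr => E E0; rewrite add0r.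
(* the errors below add up to [3 * e + 4 * B * e] *)
pose e := E / (4 + 4 * B).
have e0 : 0 < e by rewrite divr_gt0// addr_gt0// mulr_gt0.
have e20 : 0 < e / 2 by rewrite divr_gt0.
have [K K0 [FK FNK]] := F_tail _ e20.
have [d0 d00 hd] := heine_cantor (@segment_compact R (- (K + 1)) (K + 2)) cf e0.
pose h := d0 / 4; have h0 : 0 < h by rewrite divr_gt0.
pose N := (Num.truncn ((2 * K + 1) / h)).+1.
pose a i : R := - (K + 1) + i%:R * h.
have nda : {homo a : i j / (i <= j)%N >-> i <= j}.
  by move=> i j ij; rewrite lerD2l ler_pM2r// ler_nat.
have aS i : a i.+1 = a i + h by rewrite /a -natr1 mulrDl mul1r addrA.
have aN : K <= a N.
  have : (2 * K + 1) / h < N%:R by exact: truncnS_gt.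
  by rewrite ltr_pdivrMr// /a; lra.
have a_in i : (i < N)%N -> - (K + 1) <= a i <= K + 2.
  move=> iN; rewrite /a lerDl mulr_ge0 ?(ltW h0)//=.
  have : i%:R <= (2 * K + 1) / h.
    rewrite (@le_trans _ _ (Num.truncn ((2 * K + 1) / h))%:R)// ?ler_nat//.
    by rewrite truncn_le// divr_ge0 ?(ltW h0)//; lra.
  by rewrite ler_pdivlMr//; lra.
pose eta := e / (4 * N%:R).
have N0 : 0 < N%:R :> R by rewrite ltr0n.
have eta0 : 0 < eta by rewrite divr_gt0// mulr_gt0.
have etaN : N%:R * (4 * eta) = e by rewrite /eta; field; exact: lt0r_neq0.
have eta_le : 4 * eta <= e.
  have N1 : 1 <= N%:R :> R by rewrite ler1n.
  by rewrite -etaN ler_peMl// mulr_ge0// ltW.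
have [dl [/= dl0 dlh hdl]] : exists dl, [/\ 0 < dl, dl < h &
    forall i : 'I_N.+1, `|F (a i + dl) - G (a i)| <= eta].
  suff : \forall dl \near 0^'+, forall i : 'I_N.+1, `|F (a i + dl) - G (a i)| <= eta.
    move=> H; have : \forall dl \near 0^'+, [/\ 0 < dl, dl < h &
        forall i : 'I_N.+1, `|F (a i + dl) - G (a i)| <= eta].
      near=> dl; split; last by near: dl.
        by near: dl; exact: nbhs_right_gt.
      by near: dl; exact: nbhs_right_lt.
    exact: filter_ex.
  apply: filter_forall => i.
  have [y iy Fy] := G_near (a i) _ eta0.
  near=> dl.
  have dl0 : 0 < dl by near: dl; exact: nbhs_right_gt.
  have dly : dl < y - a i by near: dl; apply: nbhs_right_lt; rewrite subr_gt0.
  have h1 : G (a i) <= F (a i + dl) by apply: GF; rewrite ltrDl.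
  have h2 : F (a i + dl) <= F y by apply: ndF; lra.
  by rewrite ler_norml; apply/andP; split; lra.
move/cvgrPdist_le : fl => /(_ _ e0) fl.
have [n hl hn] := clF N (fun i => a i + dl) eta _ eta0 fl.
have close i : (i <= N)%N -> `|G (a i) - cdfr (mu n) (a i + dl)| <= 2 * eta.
  move=> iN; have h1 := hn i iN; have h2 := hdl (Ordinal (iN : (i < N.+1)%N)).
  move: h1 h2 => /=; rewrite ltr_norml !ler_norml => /andP[? ?] /andP[? ?].
  by apply/andP; split; lra.
have osc i x : (i < N)%N -> a i < x -> x <= a i + 2 * h -> `|f x - f (a i)| <= e.
  move=> iN ix xi; rewrite distrC ltW//; apply: hd.
    by rewrite /= in_itv/=; exact: a_in.
  rewrite /ball/= ltr_norml; apply/andP; split; last lra.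
  by move: xi; rewrite /h; lra.
have est1 : `|\int[nu]_x f x - \sum_(i < N) f (a i) * (G (a i.+1) - G (a i))| <=
    e + B * (1 - (G (a N) - G (a 0%N))).
  under eq_bigr do rewrite -!nuE.
  rewrite -!nuE; apply: (@partition_estimate _ nu f B e N a (fun i => f (a i))) => //.
    exact: ltW.
  by move=> i x iN ix; rewrite aS => xi; apply: osc => //; lra.
have est2 : `|\int[mu n]_x f x - \sum_(i < N) f (a i) *
      (cdfr (mu n) (a i.+1 + dl) - cdfr (mu n) (a i + dl))| <=
    e + B * (1 - (cdfr (mu n) (a N + dl) - cdfr (mu n) (a 0%N + dl))).
  apply: (@partition_estimate _ (mu n) f B e N (fun i => a i + dl) (fun i => f (a i))) => //.
  - by move=> i j ij; rewrite lerD2r; exact: nda.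
  - exact: ltW.
  - by move=> i x iN ix; rewrite aS => xi; apply: osc => //; lra.
have est3 : `|\sum_(i < N) f (a i) * (G (a i.+1) - G (a i)) -
    \sum_(i < N) f (a i) * (cdfr (mu n) (a i.+1 + dl) - cdfr (mu n) (a i + dl))| <= B * e.
  rewrite -sumrB (le_trans (ler_norm_sum _ _ _))//.
  apply: (@le_trans _ _ (\sum_(i < N) B * (4 * eta))).
    apply: ler_sum => i _; rewrite -mulrBr normrM ler_pM//.
    have := close i (ltnW (ltn_ord i)); have := close i.+1 (ltn_ord i).
    rewrite !ler_norml => /andP[? ?] /andP[? ?].
    by apply/andP; split; lra.
  by rewrite sumr_const card_ord -[leLHS]mulr_natl mulrCA etaN.
have g0 : G (a 0%N) <= e / 2.
  by rewrite (le_trans (GF _ (- K) _))// /a mul0r addr0; lra.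
have gN : 1 - e / 2 <= G (a N) by rewrite (le_trans FK)// FG.
have c0 := close 0%N isT; have cN := close N (leqnn N).
have gap1 : B * (1 - (G (a N) - G (a 0%N))) <= B * e.
  by rewrite ler_wpM2l ?(ltW B_gt0)//; lra.
have gap2 : B * (1 - (cdfr (mu n) (a N + dl) - cdfr (mu n) (a 0%N + dl))) <= B * (2 * e).
  rewrite ler_wpM2l ?(ltW B_gt0)//.
  by move: c0 cN; rewrite !ler_norml => /andP[? ?] /andP[? ?]; lra.
have EE : e * (4 + 4 * B) = E by rewrite /e divfK// gt_eqF// addr_gt0// mulr_gt0.
move: est1 est2 est3 hl => /=; rewrite !ler_norml.
move=> /andP[? ?] /andP[? ?] /andP[? ?] /andP[? ?].
by apply/andP; split; lra.
Unshelve. all: by end_near. Qed.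

End helly.

(** * Completeness of exponentials for weighted integrals *)

Section exponential_moments.
Context d (S : measurableType d) (R : realType).
Implicit Types (P : nat -> probability S R) (xi W : nat -> S -> R).

Definition exp_moments P xi :=
  (forall n r, (P n).-integrable [set: S] (EFin \o (fun x => expR (r * `|xi n x|)))) /\
  (forall r, exists C, \forall n \near \oo, \int[P n]_x expR (r * `|xi n x|) <= C).

Lemma exp_growth_measurable (f : R -> R) : exp_growth f -> measurable_fun [set: R] f.
Proof. by move=> [cf _]; exact: continuous_measurable_fun. Qed.

Lemma exp_growth_integrable (Q : probability S R) (x w : S -> R) (f : R -> R) (D : R) :
  measurable_fun [set: S] x -> measurable_fun [set: S] w -> (forall s, `|w s| <= D) ->
  (forall r, Q.-integrable [set: S] (EFin \o (fun s => expR (r * `|x s|)))) ->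
  exp_growth f -> Q.-integrable [set: S] (EFin \o (fun s => w s * f (x s))).
Proof.
move=> mx mw wD ix ef; have [B [r [B0 r0 fB]]] := exp_growthP ef.
apply: (@integrable_dominated _ _ _ _ _ (fun s => (D * B) * expR (r * `|x s|))).
- apply: measurable_funM => //; apply: measurableT_comp => //.
  exact: exp_growth_measurable.
- exact: integrable_scale.
- by move=> s; rewrite normrM -mulrA ler_pM.
Qed.

Lemma exp_functional_Rintegral P xi W (D : R) :
  (forall n, measurable_fun [set: S] (xi n)) ->
  (forall n, measurable_fun [set: S] (W n)) ->
  (forall n s, `|W n s| <= D) -> exp_moments P xi ->
  exp_functional (fun n f => \int[P n]_s (W n s * f (xi n s))).
Proof.
move=> mxi mW WD [ixi bxi]; split.
  move=> n a f g ef eg.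
  have i1 f' := exp_growth_integrable (mxi n) (mW n) (WD n) (ixi n) (f := f').
  under eq_Rintegral do rewrite mulrDr mulrCA.
  rewrite RintegralD//; last 2 first.
  - by apply: integrable_scale; exact: i1.
  - exact: i1.
  by rewrite RintegralZl//; exact: i1.
move=> r; have [C bC] := bxi r; exists (D * C); near=> n => f B ef fB.
have D0 : 0 <= D by exact: le_trans (WD 0%N point).
have B0 : 0 <= B.
  by have := fB 0; rewrite normr0 mulr0 expR0 mulr1; exact: le_trans.
apply: (@le_trans _ _ (\int[P n]_s ((D * B) * expR (r * `|xi n s|)))).
  apply: normr_Rintegral_le.
  - apply: measurable_funM => //; apply: measurableT_comp => //.
    exact: exp_growth_measurable.
  - exact: integrable_scale.
  - by move=> s; rewrite normrM -mulrA ler_pM.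
rewrite (RintegralZl _ measurableT (ixi n r)) mulrAC ler_wpM2r// ler_wpM2l//.
by near: n.
Unshelve. all: by end_near. Qed.

End exponential_moments.

Lemma exp_functionalB (R : realType) (L L' : nat -> (R -> R) -> R) :
  exp_functional L -> exp_functional L' -> exp_functional (fun n f => L n f - L' n f).
Proof.
move=> [Ll Lb] [L'l L'b]; split=> [n a f g ef eg|r].
  by rewrite Ll// L'l//; ring.
have [C LC] := Lb r; have [C' LC'] := L'b r; exists (C + C').
near=> n => f B ef fB; rewrite (le_trans (ler_normB _ _))// mulrDl.
suff [H H'] : (forall f B, exp_growth f -> (forall x, `|f x| <= B * expR (r * `|x|)) ->
    `|L n f| <= C * B) /\
  (forall f B, exp_growth f -> (forall x, `|f x| <= B * expR (r * `|x|)) ->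
    `|L' n f| <= C' * B) by rewrite lerD ?H ?H'.
by split; near: n.
Unshelve. all: by end_near. Qed.

Section completeness_of_exponentials.
Context d d' (S : measurableType d) (S' : measurableType d') (R : realType).
Variables (P : nat -> probability S R) (xi W : nat -> S -> R).
Variables (N : probability S' R) (eta w : S' -> R) (D D' : R).
Hypothesis mxi : forall n, measurable_fun [set: S] (xi n).
Hypothesis mW : forall n, measurable_fun [set: S] (W n).
Hypothesis WD : forall n s, `|W n s| <= D.
Hypothesis exi : exp_moments P xi.
Hypothesis meta : measurable_fun [set: S'] eta.
Hypothesis mw : measurable_fun [set: S'] w.
Hypothesis wD : forall s, `|w s| <= D'.
Hypothesis eeta : forall r, N.-integrable [set: S'] (EFin \o (fun s => expR (r * `|eta s|))).

Let L n f := \int[P n]_s (W n s * f (xi n s)) - \int[N]_s (w s * f (eta s)).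

Let Lexp : exp_functional L.
Proof.
apply: exp_functionalB; first exact: exp_functional_Rintegral WD exi.
apply: (@exp_functional_Rintegral _ _ _ (fun=> N) (fun=> eta) (fun=> w) D') => //.
split=> [_ r//|r].
by exists (\int[N]_x expR (r * `|eta x|)); near=> n.
Unshelve. all: by end_near. Qed.

Let L_cvg f : L n f @[n --> \oo] --> (0 : R) <->
  \int[P n]_s (W n s * f (xi n s)) @[n --> \oo] --> \int[N]_s (w s * f (eta s)).
Proof.
by rewrite subr_cvg0.
Qed.

(** Bounded exponential moments of all orders make the functions of
    exponential growth uniformly integrable. *)
Lemma exp_growth_cvg : (forall h, bounded_continuous h ->
    \int[P n]_s (W n s * h (xi n s)) @[n --> \oo] --> \int[N]_s (w s * h (eta s))) ->
  forall h, exp_growth h ->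
    \int[P n]_s (W n s * h (xi n s)) @[n --> \oo] --> \int[N]_s (w s * h (eta s)).
Proof.
move=> Lh h eh; apply/L_cvg; apply: (exp_functional_truncate Lexp) => // g bg.
exact/L_cvg/Lh.
Qed.

(** The difference of the two sides is a sequence of functionals to which
    [exp_functional_vanish] applies.  The weights [W] and [w] make room for
    bounded functions of a second variable. *)
Theorem exponentials_determine (Theta : set R) : interior (closure Theta) !=set0 ->
  (forall theta, Theta theta ->
    \int[P n]_s (W n s * expR (theta * xi n s)) @[n --> \oo] -->
    \int[N]_s (w s * expR (theta * eta s))) ->
  forall h, exp_growth h ->
    \int[P n]_s (W n s * h (xi n s)) @[n --> \oo] --> \int[N]_s (w s * h (eta s)).
Proof.
move=> iT LT h eh; apply/L_cvg.
apply: (exp_functional_vanish Lexp (Theta := Theta)) => // theta Ttheta.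
exact/(L_cvg (fun x => expR (theta * x)))/LT.
Qed.

End completeness_of_exponentials.

Section normal_characteristic_function.
Variables (R : realType) (sigma : R).
Hypothesis sigma0 : sigma != 0.
Implicit Types (u theta : R).
Local Notation N := (normal_law 0 sigma).

(** Real and imaginary part of the characteristic function. *)
Definition chf_re (P : probability R R) u := \int[P]_x cos (u * x).
Definition chf_im (P : probability R R) u := \int[P]_x sin (u * x).

Let integrable_cos (P : probability R R) u : P.-integrable [set: R] (EFin \o (fun x => cos (u * x))).
Proof. exact/bounded_continuous_integrable/bounded_continuous_cos. Qed.

Let integrable_sin (P : probability R R) u : P.-integrable [set: R] (EFin \o (fun x => sin (u * x))).
Proof. exact/bounded_continuous_integrable/bounded_continuous_sin. Qed.

Lemma chf_re_shift (P : probability R R) u c :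
  \int[P]_x cos (u * (x + c)) = cos (u * c) * chf_re P u - sin (u * c) * chf_im P u.
Proof.
have i1 := integrable_cos P u; have i2 := integrable_sin P u.
rewrite /chf_re /chf_im.
rewrite -(RintegralZl (cos (u * c)) measurableT i1) -(RintegralZl (sin (u * c)) measurableT i2).
rewrite -(RintegralB measurableT (integrable_scale _ i1) (integrable_scale _ i2)).
by apply: eq_Rintegral => x _; rewrite mulrDr cosD; ring.
Qed.

Lemma chf_im_shift (P : probability R R) u c :
  \int[P]_x sin (u * (x + c)) = sin (u * c) * chf_re P u + cos (u * c) * chf_im P u.
Proof.
have i1 := integrable_cos P u; have i2 := integrable_sin P u.
rewrite /chf_re /chf_im.
rewrite -(RintegralZl (sin (u * c)) measurableT i1) -(RintegralZl (cos (u * c)) measurableT i2).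
rewrite -(RintegralD measurableT (integrable_scale _ i1) (integrable_scale _ i2)).
by apply: eq_Rintegral => x _; rewrite mulrDr sinD; ring.
Qed.

(** An exponential weight shifts the centred normal law by [theta * sigma ^+ 2]
    and multiplies it by its moment generating function. *)
Lemma Rintegral_normal_law_shift theta f : bounded_continuous f ->
  \int[N]_x (f x * expR (theta * x)) =
  expR (theta ^+ 2 * sigma ^+ 2 / 2) * \int[N]_x f (x + theta * sigma ^+ 2).
Proof.
move=> bf; have := Rintegral_normal_law_affine 0 (theta * sigma ^+ 2) ltr01 sigma0 bf.
rewrite mulr0 add0r mul1r Rintegral_normal_law_tilt// => H.
have E : \int[N]_x f (x + theta * sigma ^+ 2) =
    expR (- (theta ^+ 2 * sigma ^+ 2 / 2)) * \int[N]_x (f x * expR (theta * x)).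
  rewrite -RintegralZl//; last first.
    have [cf [B fB]] := bf.
    apply: (@exp_growth_integrable _ _ _ N id f (fun x => expR (theta * x)) B) => //.
    - exact: bounded_continuous_measurable.
    - by move=> r; exact: integrable_normal_law_expR.
    - exact: exp_growth_expR.
  transitivity (\int[N]_x f (1 * x + theta * sigma ^+ 2)).
    by apply: eq_Rintegral => x _; rewrite mul1r.
  by rewrite -H; apply: eq_Rintegral => x _; rewrite expRD; ring.
by rewrite E mulrA -expRD subrr expR0 mul1r.
Qed.

(** If the characteristic function vanished at [u], then by the shift formula
    [cos (u * x)] and [sin (u * x)] would be orthogonal to all exponentials, and
    by completeness to themselves; but the sum of their squares is 1. *)
Lemma normal_chf_neq0 u : chf_re N u ^+ 2 + chf_im N u ^+ 2 != 0.
Proof.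
apply/negP => /eqP; move/eqP; rewrite paddr_eq0 ?sqr_ge0// !sqrf_eq0 => /andP[/eqP c0 /eqP s0].
have mid : measurable_fun [set: R] (id : R -> R) by exact: measurable_id.
have eN : exp_moments (fun=> N) (fun=> id : R -> R).
  split=> [_ r|r]; first exact: integrable_normal_law_expR.
  by exists (\int[N]_x expR (r * `|x|)); near=> n.
have iT : interior (closure [set: R]) !=set0.
  by exists 0; rewrite closureT interiorT.
have null (q : R -> R) : bounded_continuous q -> (forall x, `|q x| <= 1) ->
    (forall c, \int[N]_x q (x + c) = 0) ->
    forall h, exp_growth h -> \int[N]_x (q x * h x) = 0.
  move=> bq q1 q0 h eh.
  have mq := bounded_continuous_measurable bq.
  have := @exponentials_determine _ _ R R R (fun=> N) (fun=> id) (fun=> q)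
    N id (fun=> 0) 1 1 (fun=> mid) (fun=> mq) (fun=> q1) eN mid (measurable_cst (0 : R)).
  have b0 : forall s : R, `|(0 : R)| <= 1 by move=> s; rewrite normr0.
  have ie r := @integrable_normal_law_expR R r sigma sigma0.
  move=> /(_ b0 ie setT iT) H.
  have z0 (g : R -> R) : \int[N]_x (0 * g x) = 0.
    by under eq_Rintegral do rewrite mul0r; rewrite Rintegral_prob_cst.
  have := H _ h eh; rewrite z0 => H2.
  have H3 : (fun _ : nat => \int[N]_x (q x * h x)) @ \oo --> (0 : R).
    apply: H2 => theta _; rewrite z0 Rintegral_normal_law_shift// q0 mulr0.
    exact: cvg_cst.
  exact: (cvg_unique (@Rhausdorff R) (cvg_cst _) H3).
have bcos := bounded_continuous_cos u.
have bsin := bounded_continuous_sin u.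
have h1 : \int[N]_x (cos (u * x) * cos (u * x)) = 0.
  apply: (null (fun x => cos (u * x))) => //; last exact: bounded_exp_growth.
    by move=> x; exact: cos_max.
  by move=> c; rewrite chf_re_shift c0 s0 !mulr0 subrr.
have h2 : \int[N]_x (sin (u * x) * sin (u * x)) = 0.
  apply: (null (fun x => sin (u * x))) => //; last exact: bounded_exp_growth.
    by move=> x; exact: sin_max.
  by move=> c; rewrite chf_im_shift c0 s0 !mulr0 addr0.
have : \int[N]_x (cos (u * x) * cos (u * x) + sin (u * x) * sin (u * x)) = 1.
  rewrite -[RHS](Rintegral_prob_cst N); apply: eq_Rintegral => x _.
  by rewrite -!expr2 cos2Dsin2.
rewrite RintegralD//; last 2 first.
- by apply: bounded_continuous_integrable; exact: bounded_continuousM.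
- by apply: bounded_continuous_integrable; exact: bounded_continuousM.
by rewrite h1 h2 addr0 => /esym/eqP; rewrite oner_eq0.
Unshelve. all: by end_near. Qed.

End normal_characteristic_function.

(** * Asymptotic independence of the remainder *)

Section cutoff_tightness.
Variable R : realType.
Implicit Types (M x y e a : R).

Lemma cutoff_ge0 M x : 0 <= cutoff M x.
Proof. exact: ramp_ge0. Qed.

Lemma cutoff_le1 M x : cutoff M x <= 1.
Proof. exact: ramp_le1. Qed.

Lemma le_cutoff M M' x : M <= M' -> cutoff M x <= cutoff M' x.
Proof. by move=> MM'; apply: le_ramp; rewrite lerD2r lerD2r. Qed.

Lemma cutoff_tight (P : probability R R) e : 0 < e ->
  exists M, 1 - e <= \int[P]_x cutoff M x.
Proof.
move=> e0.
have ic k := bounded_continuous_integrable P (bounded_continuous_cutoff k).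
have lim : \int[P]_x cutoff k%:R x @[k --> \oo] --> (1 : R).
  suff : \int[P]_x cutoff k%:R x @[k --> \oo] --> \int[P]_x (1 : R).
    by rewrite Rintegral_prob_cst.
  apply: fine_cvg; rewrite -integral_EFin; last exact: integrable_const.
  have -> : (\int[P]_x (1 : R)%:E = \int[P]_x (limn (fun k => (cutoff k%:R x)%:E)))%E.
    apply: eq_integral => x _; apply/esym/cvg_lim => //; apply: cvg_near_cst.
    by near=> k; rewrite cutoff_eq1//; near: k; exact: nbhs_infty_ger.
  apply: cvg_monotone_convergence => //.
  - move=> k; apply/measurable_EFinP; apply: bounded_continuous_measurable.
    exact: bounded_continuous_cutoff.
  - by move=> k x _; rewrite lee_fin cutoff_ge0.
  - by move=> x _ m n mn; rewrite lee_fin le_cutoff// ler_nat.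
move/cvgrPdist_le : lim => /(_ _ e0)[k _ /(_ k (leqnn k))/=].
by rewrite ler_norml => /andP[_ h]; exists k%:R; lra.
Unshelve. all: by end_near. Qed.

(** If [y - a * x] is large, then so is [x] or [y]. *)
Lemma cutoff_sub M M' x y a : 0 <= a -> 0 <= M + 1 -> 0 <= M' + 1 ->
  1 - cutoff (M' + 1 + a * (M + 1)) (y - a * x) <= (1 - cutoff M x) + (1 - cutoff M' y).
Proof.
move=> a0 M0 M'0; have c1 := cutoff_le1 M x; have c2 := cutoff_le1 M' y.
have c3 := cutoff_ge0 (M' + 1 + a * (M + 1)) (y - a * x).
have [xM|xM] := leP (M + 1) `|x|; first by rewrite (cutoff_eq0 xM); lra.
have [yM|yM] := leP (M' + 1) `|y|; first by rewrite (cutoff_eq0 yM); lra.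
rewrite cutoff_eq1; first lra.
rewrite (le_trans (ler_normB _ _))// lerD//; first exact: ltW.
by rewrite normrM ger0_norm// ler_wpM2l// ltW.
Qed.

End cutoff_tightness.

Section limit_of_rest.
Variables (R : realType) (sigma : R) (Theta : set R).
Variables (mu : nat -> probability (R * R)%type R) (Q : probability R R).
Hypothesis sigma_gt0 : 0 < sigma.
Hypothesis Theta0 : Theta 0.
Hypothesis Theta_int : interior (closure Theta) !=set0.
Local Notation N := (normal_law 0 sigma).
Hypothesis mu_exp : exp_moments mu (fun _ p => p.1).
Hypothesis mu_fst : forall h, bounded_continuous h ->
  \int[mu n]_p h p.1 @[n --> \oo] --> \int[N]_x h x.
Hypothesis mu_regular : forall theta k, Theta theta -> bounded_continuous k ->
  \int[mu n]_p (k p.2 * expR (theta * p.1 - theta ^+ 2 * sigma ^+ 2 / 2)) @[n --> \oo]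
    --> \int[Q]_y k (y + theta).

Let sigma0 : sigma != 0. Proof. by rewrite gt_eqF. Qed.

Let v := (sigma ^+ 2)^-1.

Let v0 : 0 <= v. Proof. by rewrite invr_ge0 sqr_ge0. Qed.

Let zz (p : R * R) : R := p.2 - v * p.1.

Let mfst : measurable_fun [set: R * R] (fun p => p.1 : R).
Proof. exact: measurable_fst. Qed.

Let msnd : measurable_fun [set: R * R] (fun p => p.2 : R).
Proof. exact: measurable_snd. Qed.

Let mzz : measurable_fun [set: R * R] zz.
Proof. by apply: measurable_funB => //; exact: measurable_funM. Qed.

Let Nexp r := @integrable_normal_law_expR R r sigma sigma0.

Let mcomp (g : R * R -> R) (k : R -> R) : measurable_fun [set: R * R] g ->
  bounded_continuous k -> measurable_fun [set: R * R] (fun p => k (g p)).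
Proof.
by move=> mg bk; apply: measurableT_comp => //; exact: bounded_continuous_measurable.
Qed.

Let icomp n (g : R * R -> R) (k : R -> R) : measurable_fun [set: R * R] g ->
  bounded_continuous k -> (mu n).-integrable [set: R * R] (EFin \o (fun p => k (g p))).
Proof.
move=> mg bk; apply: integrable_bounded; first exact: mcomp.
by have [_ [B kB]] := bk; exists B.
Qed.

Let mu_snd k : bounded_continuous k -> \int[mu n]_p k p.2 @[n --> \oo] --> \int[Q]_y k y.
Proof.
move=> bk; have := mu_regular Theta0 bk.
rewrite (_ : (fun n => _) = fun n => \int[mu n]_p k p.2); last first.
  apply/funext => n; apply: eq_Rintegral => p _.
  by rewrite mul0r expr0n/= !mul0r subrr expR0 mulr1.
rewrite (_ : \int[Q]_y k (y + 0) = \int[Q]_y k y)//.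
by apply: eq_Rintegral => y _; rewrite addr0.
Qed.

(** Tightness of both coordinates is inherited from their limit laws. *)
Let zz_tight e : 0 < e -> exists M, \forall n \near \oo,
  1 - e <= \int[mu n]_p cutoff M (zz p).
Proof.
move=> e0; have e40 : 0 < e / 4 by rewrite divr_gt0.
have [M0 hM0] := cutoff_tight N e40; have [M0' hM0'] := cutoff_tight Q e40.
pose M := `|M0|; pose M' := `|M0'|.
have hM : 1 - e / 4 <= \int[N]_x cutoff M x.
  rewrite (le_trans hM0)//; apply: le_Rintegral => //.
  - exact/bounded_continuous_integrable/bounded_continuous_cutoff.
  - exact/bounded_continuous_integrable/bounded_continuous_cutoff.
  - by move=> x _; rewrite le_cutoff// ler_norm.
have hM' : 1 - e / 4 <= \int[Q]_x cutoff M' x.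
  rewrite (le_trans hM0')//; apply: le_Rintegral => //.
  - exact/bounded_continuous_integrable/bounded_continuous_cutoff.
  - exact/bounded_continuous_integrable/bounded_continuous_cutoff.
  - by move=> x _; rewrite le_cutoff// ler_norm.
have bc K := @bounded_continuous_cutoff R K.
exists (M' + 1 + v * (M + 1)).
move/cvgrPdist_le : (mu_fst (bc M)) => /(_ _ e40) h1.
move/cvgrPdist_le : (mu_snd (bc M')) => /(_ _ e40) h2.
near=> n.
have /andP[_ k1] : - (e / 4) <= \int[N]_x cutoff M x - \int[mu n]_p cutoff M p.1 <= e / 4.
  by rewrite -ler_norml; near: n.
have /andP[_ k2] : - (e / 4) <= \int[Q]_x cutoff M' x - \int[mu n]_p cutoff M' p.2 <= e / 4.
  by rewrite -ler_norml; near: n.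
have i1 := icomp n mfst (bc M); have i2 := icomp n msnd (bc M').
have i3 := icomp n mzz (bc (M' + 1 + v * (M + 1))).
have ic := integrable_const (mu n) 1.
have : \int[mu n]_p (1 - cutoff (M' + 1 + v * (M + 1)) (zz p)) <=
    \int[mu n]_p ((1 - cutoff M p.1) + (1 - cutoff M' p.2)).
  apply: le_Rintegral => //.
  - exact: integrable_sub.
  - by apply: integrable_add; exact: integrable_sub.
  - move=> p _.
    exact: (cutoff_sub p.1 p.2 v0 (addr_ge0 (normr_ge0 M0) ler01) (addr_ge0 (normr_ge0 M0') ler01)).
rewrite (RintegralB measurableT ic i3).
rewrite (RintegralD measurableT (integrable_sub ic i1) (integrable_sub ic i2)).
rewrite (RintegralB measurableT ic i1) (RintegralB measurableT ic i2).
rewrite !Rintegral_prob_cst; lra.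
Unshelve. all: by end_near. Qed.

Let untilt (k : R -> R) theta l : bounded_continuous k ->
  \int[mu n]_p (k p.2 * expR (theta * p.1 - theta ^+ 2 * sigma ^+ 2 / 2)) @[n --> \oo] --> l ->
  \int[mu n]_p (k p.2 * expR (theta * p.1)) @[n --> \oo] -->
    expR (theta ^+ 2 * sigma ^+ 2 / 2) * l.
Proof.
move=> bk H; have [_ [B kB]] := bk.
rewrite (_ : (fun n => _) = fun n => expR (theta ^+ 2 * sigma ^+ 2 / 2) *
    \int[mu n]_p (k p.2 * expR (theta * p.1 - theta ^+ 2 * sigma ^+ 2 / 2))).
  by apply: cvgM => //; exact: cvg_cst.
apply/funext => n; rewrite -RintegralZl//.
  by apply: eq_Rintegral => p _; rewrite mulrCA -expRD addrCA subrr addr0.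
have -> : (fun p : R * R => k p.2 * expR (theta * p.1 - theta ^+ 2 * sigma ^+ 2 / 2)) =
   fun p => expR (- (theta ^+ 2 * sigma ^+ 2 / 2)) * (k p.2 * expR (theta * p.1)).
  by apply/funext => p; rewrite expRD; ring.
apply: integrable_scale.
apply: (@exp_growth_integrable _ _ _ (mu n) (fun p => p.1) (fun p => k p.2)
  (fun x => expR (theta * x)) B) => //.
- exact: mcomp.
- exact: mu_exp.1.
- exact: exp_growth_expR.
Qed.

Let den u := chf_re N (v * u) ^+ 2 + chf_im N (v * u) ^+ 2.

Let den0 u : den u != 0. Proof. exact: normal_chf_neq0. Qed.

(** Real and imaginary part of the quotient of the characteristic functions of
    [Q] and of the normal law with variance [sigma ^- 2]. *)
Let rc u := (chf_re Q u * chf_re N (v * u) + chf_im Q u * chf_im N (v * u)) / den u.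
Let rs u := (chf_im Q u * chf_re N (v * u) - chf_re Q u * chf_im N (v * u)) / den u.

Let vE theta : v * (theta * sigma ^+ 2) = theta.
Proof. by rewrite /v mulrCA mulVf ?mulr1// sqrf_eq0. Qed.

(** The Laplace transform, under the normal law, of a trigonometric polynomial
    of frequency [v * u].  Its dependence on [theta] is, up to the generating
    function of the normal law, that of a rotation by the angle [u * theta]:
    the same as that of the characteristic function at [u] of a law shifted by
    [theta]. *)
Let trig_exp (a b u theta : R) :
  \int[N]_x ((a * cos (v * u * x) + b * sin (v * u * x)) * expR (theta * x)) =
  expR (theta ^+ 2 * sigma ^+ 2 / 2) *
    (a * (cos (u * theta) * chf_re N (v * u) - sin (u * theta) * chf_im N (v * u)) +
     b * (sin (u * theta) * chf_re N (v * u) + cos (u * theta) * chf_im N (v * u))).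
Proof.
have bs : bounded_continuous (fun x => b * sin (v * u * x) + 0).
  by apply: bounded_continuousZD; [exact: bounded_continuous_sin|exact: bounded_continuous_cst].
have bb := bounded_continuousZD a (bounded_continuous_cos (v * u)) bs.
have := Rintegral_normal_law_shift sigma0 theta bb.
under eq_Rintegral do rewrite addr0.
move=> ->; congr (_ * _).
have c1 : \int[N]_x cos (v * u * (x + theta * sigma ^+ 2)) = 
    cos (u * theta) * chf_re N (v * u) - sin (u * theta) * chf_im N (v * u).
  by rewrite chf_re_shift mulrAC vE (mulrC theta).
have c2 : \int[N]_x sin (v * u * (x + theta * sigma ^+ 2)) = 
    sin (u * theta) * chf_re N (v * u) + cos (u * theta) * chf_im N (v * u).
  by rewrite chf_im_shift mulrAC vE (mulrC theta).
rewrite -c1 -c2.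
have bsh (q : R -> R) : bounded_continuous q ->
    bounded_continuous (fun x => q (x + theta * sigma ^+ 2)).
  move=> [cq [B qB]]; split; last by exists B.
  move=> x; apply: (@continuous_comp _ _ _ (fun x => x + theta * sigma ^+ 2) q); last exact: cq.
  by apply: cvgD; [exact: cvg_id|exact: cvg_cst].
have i1 := bounded_continuous_integrable N (bsh _ (bounded_continuous_cos (v * u))).
have i2 := bounded_continuous_integrable N (bsh _ (bounded_continuous_sin (v * u))).
rewrite -(RintegralZl a measurableT i1) -(RintegralZl b measurableT i2).
rewrite -(RintegralD measurableT (integrable_scale a i1) (integrable_scale b i2)).
by apply: eq_Rintegral => x _; rewrite addr0.
Qed.

(** Completeness turns the convergence for exponential weights into one for
    arbitrary weights in the first coordinate: [w] acts as an asymptotic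
    conditional expectation of [k p.2] given [p.1]. *)
Let conditional (k w : R -> R) (D D' : R) h : bounded_continuous k ->
  (forall y, `|k y| <= D) -> measurable_fun [set: R] w -> (forall y, `|w y| <= D') ->
  (forall theta, Theta theta ->
    \int[mu n]_p (k p.2 * expR (theta * p.1)) @[n --> \oo] -->
    \int[N]_x (w x * expR (theta * x))) ->
  exp_growth h ->
  \int[mu n]_p (k p.2 * h p.1) @[n --> \oo] --> \int[N]_x (w x * h x).
Proof.
move=> bk kD mw wD H eh.
by apply: (@exponentials_determine _ _ _ _ R mu (fun _ p => p.1) (fun _ p => k p.2) N id w D D'
  _ _ _ mu_exp _ _ _ _ Theta) => // n; exact: mcomp.
Qed.

Let trig_bounded (a b t : R) :
  let w x := a * cos (t * x) + b * sin (t * x) in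
  measurable_fun [set: R] w /\ forall x, `|w x| <= `|a| + `|b|.
Proof.
move=> w.
have mc := bounded_continuous_measurable (bounded_continuous_cos t).
have ms := bounded_continuous_measurable (bounded_continuous_sin t).
split; first by apply: measurable_funD; exact: measurable_funM.
move=> x; rewrite (le_trans (ler_normD _ _))// lerD// normrM ler_piMr//.
  exact: cos_max.
exact: sin_max.
Qed.

(** The coefficients [rc u] and [rs u] solve the linear system obtained by
    comparing [mu_regular] with [trig_exp]; they are the same for all
    [theta]. *)
Let cos_cvg u h : exp_growth h ->
  \int[mu n]_p (cos (u * p.2) * h p.1) @[n --> \oo] -->
  \int[N]_x ((rc u * cos (v * u * x) + - rs u * sin (v * u * x)) * h x).
Proof.
move=> eh; have [mw wB] := trig_bounded (rc u) (- rs u) (v * u).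
apply: (conditional (bounded_continuous_cos u) (fun y => cos_max (u * y)) mw wB) => //.
move=> theta Tt; rewrite trig_exp.
have := untilt (bounded_continuous_cos u) (mu_regular Tt (bounded_continuous_cos u)).
rewrite chf_re_shift; set l1 := (X in _ --> X -> _); set l2 := (X in _ -> _ --> X).
suff -> : l1 = l2 by [].
rewrite /l1 /l2; congr (_ * _).
by rewrite /rc /rs /den; field; exact: den0.
Qed.

Let sin_cvg u h : exp_growth h ->
  \int[mu n]_p (sin (u * p.2) * h p.1) @[n --> \oo] -->
  \int[N]_x ((rs u * cos (v * u * x) + rc u * sin (v * u * x)) * h x).
Proof.
move=> eh; have [mw wB] := trig_bounded (rs u) (rc u) (v * u).
apply: (conditional (bounded_continuous_sin u) (fun y => sin_max (u * y)) mw wB) => //.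
move=> theta Tt; rewrite trig_exp.
have := untilt (bounded_continuous_sin u) (mu_regular Tt (bounded_continuous_sin u)).
rewrite chf_im_shift; set l1 := (X in _ --> X -> _); set l2 := (X in _ -> _ --> X).
suff -> : l1 = l2 by [].
rewrite /l1 /l2; congr (_ * _).
by rewrite /rc /rs /den; field; exact: den0.
Qed.

Let imu n (k h : R -> R) : bounded_continuous k -> exp_growth h ->
  (mu n).-integrable [set: R * R] (EFin \o (fun p => k p.2 * h p.1)).
Proof.
move=> bk eh; have [_ [B kB]] := bk.
apply: (exp_growth_integrable mfst (mcomp msnd bk) (fun p => kB p.2) (mu_exp.1 n) eh).
Qed.

Let iN (a b t : R) h : exp_growth h ->
  N.-integrable [set: R] (EFin \o (fun x => (a * cos (t * x) + b * sin (t * x)) * h x)).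
Proof.
move=> eh; have [mw wB] := trig_bounded a b t.
exact: (exp_growth_integrable (@measurable_id _ _ setT) mw wB Nexp eh).
Qed.

Let eNh h : exp_growth h -> N.-integrable [set: R] (EFin \o h).
Proof.
move=> eh; rewrite (_ : h = fun x => 1 * h x); last by apply/funext => x; rewrite mul1r.
apply: (@exp_growth_integrable _ _ _ N id (fun=> 1) h 1) => //.
by move=> x; rewrite normr1.
Qed.

(** The test function [h] multiplied by [cos (v * u * x)] or [sin (v * u * x)] is
    again admissible.  By the addition theorem this passes from [p.2] to
    [p.2 - v * p.1], and the limit loses its dependence on [x]. *)
Let zz_cos u h : exp_growth h ->
  \int[mu n]_p (cos (u * zz p) * h p.1) @[n --> \oo] --> rc u * \int[N]_x h x.
Proof.
move=> eh.
have ec : exp_growth (fun x => cos (v * u * x) * h x).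
  by apply: exp_growthM => //; exact/bounded_exp_growth/bounded_continuous_cos.
have es : exp_growth (fun x => sin (v * u * x) * h x).
  by apply: exp_growthM => //; exact/bounded_exp_growth/bounded_continuous_sin.
rewrite (_ : rc u * \int[N]_x h x =
    \int[N]_x ((rc u * cos (v * u * x) + - rs u * sin (v * u * x)) * (cos (v * u * x) * h x)) +
    \int[N]_x ((rs u * cos (v * u * x) + rc u * sin (v * u * x)) * (sin (v * u * x) * h x))); last first.
  rewrite -(RintegralD measurableT (iN _ _ _ ec) (iN _ _ _ es)).
  rewrite -(RintegralZl _ measurableT (eNh eh)); apply: eq_Rintegral => x _.
  have : cos (v * u * x) ^+ 2 + sin (v * u * x) ^+ 2 = 1 by exact: cos2Dsin2.
  rewrite /=; set c := cos _; set s := sin _ => cs.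
  rewrite -[LHS]mulr1 -cs; ring.
rewrite (_ : (fun n => _) = fun n =>
    \int[mu n]_p (cos (u * p.2) * (cos (v * u * p.1) * h p.1)) +
    \int[mu n]_p (sin (u * p.2) * (sin (v * u * p.1) * h p.1))); last first.
  apply/funext => n.
  rewrite -(RintegralD measurableT (imu n (bounded_continuous_cos u) ec)
    (imu n (bounded_continuous_sin u) es)).
  apply: eq_Rintegral => p _ /=.
  by rewrite /zz mulrBr cosB (_ : u * (v * p.1) = v * u * p.1); ring.
by apply: cvgD; [exact: cos_cvg|exact: sin_cvg].
Qed.

Let zz_sin u h : exp_growth h ->
  \int[mu n]_p (sin (u * zz p) * h p.1) @[n --> \oo] --> rs u * \int[N]_x h x.
Proof.
move=> eh.
have ec : exp_growth (fun x => cos (v * u * x) * h x).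
  by apply: exp_growthM => //; exact/bounded_exp_growth/bounded_continuous_cos.
have es : exp_growth (fun x => sin (v * u * x) * h x).
  by apply: exp_growthM => //; exact/bounded_exp_growth/bounded_continuous_sin.
rewrite (_ : rs u * \int[N]_x h x =
    \int[N]_x ((rs u * cos (v * u * x) + rc u * sin (v * u * x)) * (cos (v * u * x) * h x)) -
    \int[N]_x ((rc u * cos (v * u * x) + - rs u * sin (v * u * x)) * (sin (v * u * x) * h x))); last first.
  rewrite -(RintegralB measurableT (iN _ _ _ ec) (iN _ _ _ es)).
  rewrite -(RintegralZl _ measurableT (eNh eh)); apply: eq_Rintegral => x _.
  have : cos (v * u * x) ^+ 2 + sin (v * u * x) ^+ 2 = 1 by exact: cos2Dsin2.
  rewrite /=; set c := cos _; set s := sin _ => cs.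
  rewrite -[LHS]mulr1 -cs; ring.
rewrite (_ : (fun n => _) = fun n =>
    \int[mu n]_p (sin (u * p.2) * (cos (v * u * p.1) * h p.1)) -
    \int[mu n]_p (cos (u * p.2) * (sin (v * u * p.1) * h p.1))); last first.
  apply/funext => n.
  rewrite -(RintegralB measurableT (imu n (bounded_continuous_sin u) ec)
    (imu n (bounded_continuous_cos u) es)).
  apply: eq_Rintegral => p _ /=.
  by rewrite /zz mulrBr sinB (_ : u * (v * p.1) = v * u * p.1); ring.
by apply: cvgB; [exact: sin_cvg|exact: cos_cvg].
Qed.

(** By [zz_cos] and [zz_sin] the joint transform of [p.1] and
    [p.2 - p.1 / sigma ^+ 2] factorizes in the limit, with a second factor [rc],
    [rs] that is the characteristic function of the limit [nu] found by
    [helly].  Trigonometric functions of the second coordinate are then replaced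
    by arbitrary bounded continuous ones, with [h p.1] as a fixed weight. *)
Theorem rest_limit : exists nu : probability R R,
  forall h k, exp_growth h -> bounded_continuous k ->
  \int[mu n]_p (h p.1 * k (p.2 - p.1 / sigma ^+ 2)) @[n --> \oo] -->
    \int[N]_x h x * \int[nu]_z k z.
Proof.
pose zm : {mfun (R * R)%type >-> R} := mfun_Sub (mem_set mzz).
pose rho n : probability R R := distribution (mu n) zm.
have rhoE n k : bounded_continuous k -> \int[rho n]_z k z = \int[mu n]_p k (zz p).
  move=> bk; rewrite /Rintegral /rho integral_distribution//.
    by apply/measurable_EFinP; exact: bounded_continuous_measurable.
  exact: (icomp n mzz bk).
have rho_tight e : 0 < e -> exists M, \forall n \near \oo,
    1 - e <= \int[rho n]_x cutoff M x.
  move=> e0; have [M hM] := zz_tight e0; exists M.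
  by apply: filterS hM => n; rewrite rhoE//; exact: bounded_continuous_cutoff.
have [nu hnu] := helly rho_tight; exists nu.
have e1 : exp_growth (fun=> 1 : R) by exact/bounded_exp_growth/bounded_continuous_cst.
have nu_cos u : \int[nu]_z cos (u * z) = rc u.
  apply: hnu; first exact: bounded_continuous_cos.
  have := zz_cos (u:=u) e1; rewrite Rintegral_prob_cst mulr1.
  rewrite (_ : (fun n => _) = fun n => \int[rho n]_z cos (u * z))//.
  apply/funext => n; rewrite rhoE; last exact: bounded_continuous_cos.
  by apply: eq_Rintegral => p _; rewrite mulr1.
have nu_sin u : \int[nu]_z sin (u * z) = rs u.
  apply: hnu; first exact: bounded_continuous_sin.
  have := zz_sin (u:=u) e1; rewrite Rintegral_prob_cst mulr1.
  rewrite (_ : (fun n => _) = fun n => \int[rho n]_z sin (u * z))//.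
  apply/funext => n; rewrite rhoE; last exact: bounded_continuous_sin.
  by apply: eq_Rintegral => p _; rewrite mulr1.
move=> h k eh bk.
pose L n k := \int[mu n]_p (k (zz p) * h p.1) - \int[nu]_z k z * \int[N]_x h x.
have ihk n q : bounded_continuous q ->
    (mu n).-integrable [set: R * R] (EFin \o (fun p => q (zz p) * h p.1)).
  move=> bq; have [_ [B qB]] := bq.
  exact: (exp_growth_integrable mfst (mcomp mzz bq) (fun p => qB _) (mu_exp.1 n) eh).
have inu q : bounded_continuous q -> nu.-integrable [set: R] (EFin \o q).
  exact: bounded_continuous_integrable.
have mh : measurable_fun [set: R * R] (fun p => h p.1).
  by apply: measurableT_comp => //; exact: exp_growth_measurable.
have ihn n : (mu n).-integrable [set: R * R] (EFin \o (fun p => h p.1)).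
  have := ihk n _ (bounded_continuous_cst 1); congr (_.-integrable _ _).
  by apply/funext => p /=; rewrite mul1r.
have ihn2 n : (mu n).-integrable [set: R * R] (EFin \o (fun p => h p.1 ^+ 2)).
  have := exp_growth_integrable mfst (@measurable_cst _ _ _ _ setT (1 : R)) (D := 1) _
    (mu_exp.1 n) (exp_growthM eh eh).
  rewrite (_ : (fun s => 1 * _) = fun p : R * R => h p.1 ^+ 2); last first.
    by apply/funext => p; rewrite mul1r expr2.
  by apply => p; rewrite normr1.
have [Ch hCh] : exists C, \forall n \near \oo, \int[mu n]_p `|h p.1| <= C /\
    \int[mu n]_p (h p.1 ^+ 2) <= C.
  have [B [r [B0 r0 hB]]] := exp_growthP eh.
  have [C1 hC1] := mu_exp.2 r; have [C2 hC2] := mu_exp.2 (2 * r).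
  exists (`|B * C1| + `|B ^+ 2 * C2|).
  have h2B p : h p ^+ 2 <= B ^+ 2 * expR (2 * r * `|p|).
    rewrite -[leLHS]real_normK ?num_real// -mulrA expRM_natl -exprMn.
    by rewrite lerXn2r ?nnegrE ?mulr_ge0 ?expR_ge0.
  near=> n.
  have i1 := integrable_scale B (mu_exp.1 n r).
  have i2 := integrable_scale (B ^+ 2) (mu_exp.1 n (2 * r)).
  have l1 := le_Rintegral measurableT (integrable_norm (ihn n)) i1 (fun p _ => hB p.1).
  have l2 := le_Rintegral measurableT (ihn2 n) i2 (fun p _ => h2B p.1).
  split.
    rewrite (le_trans l1)// (RintegralZl _ measurableT (mu_exp.1 n r)).
    apply: (@le_trans _ _ (B * C1)); first by rewrite ler_wpM2l//; near: n.
    by rewrite (le_trans (ler_norm _))// lerDl.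
  rewrite (le_trans l2)// (RintegralZl _ measurableT (mu_exp.1 n (2 * r))).
  apply: (@le_trans _ _ (B ^+ 2 * C2)); first by rewrite ler_wpM2l ?sqr_ge0//; near: n.
  by rewrite (le_trans (ler_norm _))// lerDr.
suff : L n k @[n --> \oo] --> (0 : R).
  rewrite /L; move/subr_cvg0; rewrite mulrC.
  rewrite (_ : (fun n => _) = fun n => \int[mu n]_p (h p.1 * k (p.2 - p.1 / sigma ^+ 2)))//.
  by apply/funext => n; apply: eq_Rintegral => p _; rewrite /zz mulrC (mulrC v).
apply: trigonometric_vanish => //.
- move=> n a f g bf bg; rewrite /L.
  rewrite (RintegralD measurableT (integrable_scale a (inu _ bf)) (inu _ bg)).
  rewrite (RintegralZl a measurableT (inu _ bf)).
  have -> : \int[mu n]_p ((a * f (zz p) + g (zz p)) * h p.1) =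
      a * \int[mu n]_p (f (zz p) * h p.1) + \int[mu n]_p (g (zz p) * h p.1).
    rewrite -(RintegralZl a measurableT (ihk n _ bf)).
    rewrite -(RintegralD measurableT (integrable_scale a (ihk n _ bf)) (ihk n _ bg)).
    by apply: eq_Rintegral => p _; ring.
  by ring.
- exists (Ch + `|\int[N]_x h x|); near=> n => f B bf fB.
  have [hC _] : \int[mu n]_p `|h p.1| <= Ch /\ \int[mu n]_p (h p.1 ^+ 2) <= Ch by near: n.
  have B0 : 0 <= B by exact: le_trans (fB 0).
  rewrite /L (le_trans (ler_normB _ _))// mulrDl lerD//.
    apply: (@le_trans _ _ (\int[mu n]_p (B * `|h p.1|))).
      apply: normr_Rintegral_le.
      - by apply: measurable_funM => //; exact: mcomp.
      - by apply: integrable_scale; exact: integrable_norm (ihn n).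
      - by move=> p; rewrite normrM ler_wpM2r.
    rewrite (RintegralZl B measurableT (integrable_norm (ihn n))) mulrC.
    by rewrite ler_wpM2r.
  rewrite normrM mulrC ler_wpM2l//.
  by apply: normr_Rintegral_bounded => //; exact: bounded_continuous_measurable.
- move=> e e0; have e20 : 0 < e / 2 by rewrite divr_gt0.
  have e40 : 0 < e / 4 by rewrite divr_gt0.
  pose C := `|Ch| + `|\int[N]_x h x| + 1.
  have C0 : 0 < C by rewrite ltr_wpDl// addr_ge0.
  (* [a * `|h| <= K * a + K^-1 * h ^+ 2] for [0 <= a <= 1]; this [K] makes the
     integral of the second term at most [e / 4] *)
  pose K := 4 * C / e.
  have K0 : 0 < K by rewrite divr_gt0// mulr_gt0.
  have [M1 hM1] := zz_tight (divr_gt0 e40 K0).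
  have [M2 hM2] := cutoff_tight nu (divr_gt0 e20 C0).
  pose M := Num.max M1 M2.
  have bcM := @bounded_continuous_cutoff R M.
  exists (M + 1); near=> n => f bf f1 fM.
  have [_ hC] : \int[mu n]_p `|h p.1| <= Ch /\ \int[mu n]_p (h p.1 ^+ 2) <= Ch by near: n.
  have fc z : `|f z| <= 1 - cutoff M z.
    have [zM|zM] := leP `|z| (M + 1).
      by rewrite fM// normr0 subr_ge0 cutoff_le1.
    by rewrite cutoff_eq0 ?subr0// ltW.
  have t1 : \int[mu n]_p (1 - cutoff M (zz p)) <= e / 4 / K.
    rewrite (RintegralB measurableT (integrable_const _ _) (icomp n mzz bcM)).
    rewrite Rintegral_prob_cst.
    have h1 : 1 - e / 4 / K <= \int[mu n]_p cutoff M1 (zz p) by near: n.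
    have : \int[mu n]_p cutoff M1 (zz p) <= \int[mu n]_p cutoff M (zz p).
      have i1 := icomp n mzz (bounded_continuous_cutoff M1).
      apply: (le_Rintegral measurableT i1 (icomp n mzz bcM)) => p _.
      by rewrite le_cutoff// le_max lexx.
    by lra.
  have t2 : \int[nu]_z (1 - cutoff M z) <= e / 2 / C.
    rewrite (RintegralB measurableT (integrable_const _ _) (inu _ bcM)) Rintegral_prob_cst.
    have : \int[nu]_z cutoff M2 z <= \int[nu]_z cutoff M z.
      have i2 := inu _ (bounded_continuous_cutoff M2).
      apply: (le_Rintegral measurableT i2 (inu _ bcM)) => z _.
      by rewrite le_cutoff// le_max lexx orbT.
    by lra.
  have ic := integrable_sub (integrable_const (mu n) 1) (icomp n mzz bcM).
  rewrite /L (le_trans (ler_normB _ _))// [e]splitr lerD//.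
    apply: (@le_trans _ _ (\int[mu n]_p (K * (1 - cutoff M (zz p)) + K^-1 * h p.1 ^+ 2))).
      apply: normr_Rintegral_le.
      - by apply: measurable_funM => //; exact: mcomp.
      - by apply: integrable_add; apply: integrable_scale => //; exact: ihn2.
      - move=> p; rewrite normrM.
        have c0 : 0 <= 1 - cutoff M (zz p) by rewrite subr_ge0 cutoff_le1.
        have c1 : 1 - cutoff M (zz p) <= 1 by rewrite gerBl cutoff_ge0.
        apply: (@le_trans _ _ ((1 - cutoff M (zz p)) * `|h p.1|)).
          by rewrite ler_wpM2r.
        have h2 : 0 <= K^-1 * h p.1 ^+ 2 by rewrite mulr_ge0 ?sqr_ge0// invr_ge0 ltW.
        have [hK|hK] := leP `|h p.1| K.
          apply: (@le_trans _ _ (K * (1 - cutoff M (zz p)))); last by rewrite lerDl.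
          by rewrite mulrC ler_wpM2r.
        apply: (@le_trans _ _ (K^-1 * h p.1 ^+ 2)); last by rewrite lerDr mulr_ge0// ltW.
        apply: (@le_trans _ _ (1 * `|h p.1|)); first by rewrite ler_wpM2r.
        rewrite mul1r -[X in _ * X]real_normK ?num_real// ler_pdivlMl// expr2.
        by rewrite ler_wpM2r// ltW.
    rewrite (RintegralD measurableT (integrable_scale K ic) (integrable_scale K^-1 (ihn2 n))).
    rewrite (RintegralZl K measurableT ic) (RintegralZl K^-1 measurableT (ihn2 n)).
    have q1 : K * \int[mu n]_p (1 - cutoff M (zz p)) <= e / 4.
      by rewrite -ler_pdivlMl// mulrC.
    have q2 : K^-1 * \int[mu n]_p (h p.1 ^+ 2) <= e / 4.
      rewrite ler_pdivrMl// (le_trans hC)// /K.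
      rewrite (_ : 4 * C / e * (e / 4) = C); last by field; rewrite gt_eqF.
      by rewrite /C -addrA (le_trans (ler_norm _))// lerDl addr_ge0.
    by lra.
  rewrite normrM.
  have s1 : `|\int[nu]_z f z| <= e / 2 / C.
    apply: le_trans t2; apply: normr_Rintegral_le fc.
      exact: bounded_continuous_measurable.
    exact: integrable_sub (integrable_const _ _) (inu _ bcM).
  have s2 : `|\int[N]_x h x| <= C.
    by rewrite /C -addrA addrCA lerDl addr_ge0.
  apply: (@le_trans _ _ (e / 2 / C * C)); first by rewrite ler_pM.
  by rewrite divfK// gt_eqF.
- move=> u; apply/subr_cvg0; rewrite nu_cos; exact: zz_cos.
- move=> u; apply/subr_cvg0; rewrite nu_sin; exact: zz_sin.
Unshelve. all: by end_near. Qed.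

End limit_of_rest.

(** * Change of measure *)

Section diagonal.

(** A property that holds for large [n] at each fixed level still holds along
    a level that grows slowly enough. *)
Lemma diagonal_choice (P : nat -> nat -> Prop) :
  (forall m, \forall n \near \oo, P m n) ->
  exists c : nat -> nat, (forall m, \forall n \near \oo, (m <= c n)%N) /\
    \forall n \near \oo, P (c n) n.
Proof.
move=> HP.
have : forall m, exists K, forall n, (K <= n)%N -> P m n.
  by move=> m; have [K _ hK] := HP m; exists K => n; exact: hK.
move=> /choice[K hK].
pose c n := \max_(m < n.+1 | (K m <= n)%N) m; exists c; split.
  move=> m; exists (maxn m (K m)) => // n /=; rewrite geq_max => /andP[mn Kn].
  exact: (@leq_bigmax_cond _ (fun m : 'I_n.+1 => K m <= n)%N (fun m => m) (Ordinal (mn : (m < n.+1)%N))).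
exists (K 0%N) => // n /= Kn; apply: hK.
pose A := [pred m : 'I_n.+1 | (K m <= n)%N].
have A0 : (0 < #|A|)%N by apply/card_gt0P; exists ord0.
have [i iA iE] := @eq_bigmax_cond _ A (fun m => m) A0.
by have -> : c n = i by rewrite /c -iE.
Qed.

End diagonal.

Section likelihood_ratio.
Variable R : realType.

(** A finite distance excludes the values [0] and [+oo] of [l]. *)
Lemma lne_dist_le (l : \bar R) (a delta : R) : (0 <= l)%E ->
  ((`|lne l - a%:E| <= delta%:E) =
   ((expR (a - delta))%:E <= l) && (l <= (expR (a + delta))%:E))%E.
Proof.
case: l => [r| |]//; last first.
  by move=> _ /=; rewrite leye_eq/= [RHS]andbF.
move=> r0 /=; case: ifPn => [r_le0|].
  rewrite /= leye_eq/=; apply/esym/negP => /andP[+ _]; rewrite lee_fin => h.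
  by have := lt_le_trans (expR_gt0 (a - delta)) (le_trans h r_le0); rewrite ltxx.
rewrite -ltNge => r_gt0; rewrite !lee_fin/= ler_distl.
by rewrite -[r in RHS]lnK// !ler_expR.
Qed.

End likelihood_ratio.

Section le_cam.
Context d (T : nat -> measurableType d) (R : realType).
Variables (P0 Pt : forall n, probability (T n) R) (L : forall n, T n -> \bar R).
Variables (X : forall n, {mfun T n >-> R}) (Xc : forall n, T n -> R).
Variables (theta a C : R).
Hypothesis lr : forall n, is_likelihood_ratio (Pt n) (P0 n) (@L n).
Hypothesis logL : forall e : R, 0 < e ->
  P0 n [set x | e%:E < `|lne (L x) - (theta * X n x - a)%:E|]%E @[n --> \oo] --> 0%E.
Hypothesis mXc : forall n, measurable_fun [set: T n] (@Xc n).
Hypothesis Xc_eq : P0 n [set x | Xc x != X n x] @[n --> \oo] --> 0%E.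

Let W n x : R := expR (theta * @Xc n x - a).

Hypothesis iW2 : forall n, (P0 n).-integrable [set: T n] (EFin \o (fun x => W x ^+ 2)).
Hypothesis W2 : \forall n \near \oo, \int[P0 n]_x W x ^+ 2 <= C.
Hypothesis W1 : \int[P0 n]_x W x @[n --> \oo] --> (1 : R).

Let W_ge0 n x : 0 <= @W n x. Proof. exact: expR_ge0. Qed.

Let mW n : measurable_fun [set: T n] (@W n).
Proof.
apply: measurableT_comp => //; apply: measurable_funB => //.
exact: measurable_funM.
Qed.

Let W_le n x : @W n x <= 1 + W x ^+ 2.
Proof.
have [W1'|W1'] := leP (@W n x) 1; first by rewrite (le_trans W1')// lerDl sqr_ge0.
by rewrite -[leLHS]add0r lerD// expr2 ler_peMl// ltW.
Qed.

Let iW n : (P0 n).-integrable [set: T n] (EFin \o @W n).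
Proof.
apply: (@integrable_dominated _ _ _ _ _ (fun x => 1 + W x ^+ 2)) => //.
  by apply: integrable_add => //; exact: integrable_const.
by move=> x; rewrite ger0_norm.
Qed.

Let B1 e n := [set x : T n | (e%:E < `|lne (L x) - (theta * X n x - a)%:E|)%E].
Let B2 n := [set x : T n | @Xc n x != X n x].

Let mB1 e n : measurable (@B1 e n).
Proof.
have [mL L0 _] := lr n.
have mlin : measurable_fun [set: T n] (fun x => theta * X n x - a).
  by apply: measurable_funB => //; exact: measurable_funM.
have -> : @B1 e n = ~` ([set x | (expR (theta * X n x - a - e))%:E <= L x]%E `&`
    [set x | L x <= (expR (theta * X n x - a + e))%:E]%E).
  rewrite /B1; apply/seteqP; split => x /=.
    rewrite ltNge lne_dist_le// => /negP h [h1 h2]; apply: h; exact/andP.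
  move=> h; rewrite ltNge lne_dist_le//; apply/negP => /andP[h1 h2].
  exact: h.
apply: measurableC; apply: measurableI; rewrite -[X in measurable X]setTI.
  apply: measurable_lee => //; apply/measurable_EFinP/measurableT_comp => //.
  exact: measurable_funB.
apply: measurable_lee => //; apply/measurable_EFinP/measurableT_comp => //.
exact: measurable_funD.
Qed.

Let mB2 n : measurable (@B2 n).
Proof. exact: measurable_neq_fun. Qed.

Section bound.
Variables (n : nat) (G G' : T n -> R).
Hypothesis mG : measurable_fun [set: T n] G.
Hypothesis mG' : measurable_fun [set: T n] G'.
Hypothesis G01 : forall x, 0 <= G x <= 1.
Hypothesis G'01 : forall x, 0 <= G' x <= 1.
Hypothesis GG' : forall x, Xc x = X n x -> G x = G' x.

(** Outside [B1 e] and [B2] the likelihood ratio is at least [expR (- e) * W], and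
    on these exceptional sets [W <= K + K^-1 * W ^+ 2].  Only a lower bound can be
    obtained in this way, because [L] does not see the singular part of
    [Pt n]. *)
Lemma le_cam_bound e K : 0 < e -> 0 < K ->
  \int[P0 n]_x (G' x * W x) - e * \int[P0 n]_x W x -
    (K * (fine (P0 n (@B1 e n)) + fine (P0 n (@B2 n))) + K^-1 * \int[P0 n]_x W x ^+ 2) <=
  \int[Pt n]_x G x.
Proof.
move=> e0 K0; have [mL L0 [N [mN PN QE]]] := lr n.
pose A := ~` (@B1 e n `|` @B2 n).
have mA : measurable A.
  by apply: measurableC; apply: measurableU; [exact: mB1|exact: mB2].
have iG : (Pt n).-integrable [set: T n] (EFin \o G).
  apply: integrable_bounded => //; exists 1 => x.
  by case/andP: (G01 x) => ? ?; rewrite ger0_norm.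
have mGW : measurable_fun [set: T n] (fun x => G' x * W x).
  by apply: measurable_funM => //; exact: mW.
have mf : measurable_fun [set: T n] (fun x => expR (- e) * (G' x * W x) * \1_A x).
  apply: measurable_funM; last exact: measurable_indic.
  by apply: measurable_funM.
have iGW : (P0 n).-integrable [set: T n] (EFin \o (fun x => G' x * W x)).
  apply: (integrable_dominated mGW (iW n)) => x; case/andP: (G'01 x) => g0 g1.
  by rewrite normrM (ger0_norm g0) (ger0_norm (W_ge0 x)) ler_piMl.
have f_le x : 0 <= expR (- e) * (G' x * W x) * \1_A x <= G' x * W x.
  case/andP: (G'01 x) => g0 g1.
  have GW0 : 0 <= G' x * W x by rewrite mulr_ge0.
  have e1 : expR (- e) <= 1 by rewrite -expR0 ler_expR oppr_le0 ltW.
  have ee0 := expR_ge0 (- e).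
  rewrite indicE; case: (x \in A) => /=; rewrite ?mulr1 ?mulr0 ?lexx//.
  by rewrite mulr_ge0//= ler_piMl.
have if_ : (P0 n).-integrable [set: T n] (EFin \o (fun x => expR (- e) * (G' x * W x) * \1_A x)).
  apply: (integrable_dominated mf iGW) => x.
  by case/andP: (f_le x) => f0 f1; rewrite ger0_norm.
have step1 : \int[P0 n]_x (expR (- e) * (G' x * W x) * \1_A x) <= \int[Pt n]_x G x.
  rewrite -lee_fin -!integral_EFin//.
  apply: (@le_trans _ _ (\int[P0 n]_x ((G x)%:E * L x))%E); last first.
    have nuL B : measurable B -> (\int[P0 n]_(x in B) L x <= Pt n B)%E.
      by move=> mB; rewrite QE// leeDl.
    have mGE : measurable_fun [set: T n] (EFin \o G) by exact/measurable_EFinP.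
    have GE0 x : (0 <= (G x)%:E)%E by rewrite lee_fin; case/andP: (G01 x).
    exact: (ge0_integral_density_le mL L0 nuL mGE GE0).
  apply: ge0_le_integral.
  - by [].
  - by move=> x _; rewrite lee_fin; case/andP: (f_le x).
  - exact/measurable_EFinP.
  - by apply: emeasurable_funM => //; exact/measurable_EFinP.
  - move=> x _; rewrite indicE; case: (boolP (x \in A)) => /= [|_]; last first.
      by rewrite mulr0 mule_ge0// lee_fin; case/andP: (G01 x).
    rewrite inE => /not_orP[nB1 nB2].
    have XX : Xc x = X n x by apply/eqP/negPn/negP.
    have lL : (`|lne (L x) - (theta * X n x - a)%:E| <= e%:E)%E.
      by rewrite leNgt; apply/negP.
    move: lL; rewrite lne_dist_le// => /andP[lL _].
    rewrite mulr1 GG'// mulrC -mulrA EFinM lee_wpmul2l//.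
      by rewrite lee_fin; case/andP: (G'01 x).
    by rewrite /W XX -expRD.
apply: le_trans step1.
have i1 B : measurable B -> (P0 n).-integrable [set: T n] (EFin \o (\1_B : T n -> R)).
  by move=> mB; exact: integrable_indic.
have int1 B : measurable B -> \int[P0 n]_x (\1_B x : R) = fine (P0 n B).
  by move=> mB; rewrite /Rintegral integral_indic// setIT.
rewrite -(int1 _ (mB1 e n)) -(int1 _ (mB2 n)).
have iB := integrable_add (i1 _ (mB1 e n)) (i1 _ (mB2 n)).
rewrite -(RintegralD measurableT (i1 _ (mB1 e n)) (i1 _ (mB2 n))).
rewrite -(RintegralZl K measurableT iB) -(RintegralZl K^-1 measurableT (iW2 n)).
have iR := integrable_add (integrable_scale K iB) (integrable_scale K^-1 (iW2 n)).
rewrite -(RintegralD measurableT (integrable_scale K iB) (integrable_scale K^-1 (iW2 n))).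
rewrite -(RintegralZl e measurableT (iW n)).
rewrite -(RintegralB measurableT iGW (integrable_scale e (iW n))).
rewrite -(RintegralB measurableT (integrable_sub iGW (integrable_scale e (iW n))) iR).
apply: (le_Rintegral measurableT (integrable_sub (integrable_sub iGW (integrable_scale e (iW n))) iR) if_).
move=> x _; case/andP: (G'01 x) => g0 g1.
have GW0 : 0 <= G' x * W x by rewrite mulr_ge0.
have GW1 : G' x * W x <= W x by rewrite ler_piMl.
have eW : 0 <= e * W x by rewrite mulr_ge0// ltW.
have KW : 0 <= K^-1 * W x ^+ 2 by rewrite mulr_ge0 ?sqr_ge0// invr_ge0 ltW.
have W_K : W x <= K + K^-1 * W x ^+ 2.
  have [WK|WK] := leP (W x) K; first by rewrite (le_trans WK)// lerDl.
  rewrite -[leLHS]add0r lerD ?(ltW K0)// ler_pdivlMl// expr2 ler_wpM2r//.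
  exact: ltW.
have [xA|xA] := boolP (x \in A).
  rewrite [X in _ <= _ * X]indicE xA mulr1.
  have e1 : 1 - e <= expR (- e) by exact: expR_ge1Dx.
  have : (1 - e) * (G' x * W x) <= expR (- e) * (G' x * W x) by rewrite ler_wpM2r.
  have : 0 <= K * (\1_(@B1 e n) x + \1_(@B2 n) x).
    by rewrite mulr_ge0 ?(ltW K0)// addr_ge0.
  have : e * (G' x * W x) <= e * W x by rewrite ler_wpM2l// ltW.
  lra.
rewrite [X in _ <= _ * X]indicE (negbTE xA) mulr0.
have : K <= K * (\1_(@B1 e n) x + \1_(@B2 n) x).
  rewrite ler_peMr ?(ltW K0)//; move: xA; rewrite notin_setE => /contrapT[xB|xB].
    by rewrite [X in X + _]indicE mem_set// lerDl.
  by rewrite [X in _ + X]indicE mem_set// lerDr.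
lra.
Qed.

End bound.

Let le_cam_lower (G G' : forall n, T n -> R) :
  (forall n, measurable_fun [set: T n] (@G n)) ->
  (forall n, measurable_fun [set: T n] (@G' n)) ->
  (forall n x, 0 <= @G n x <= 1) -> (forall n x, 0 <= @G' n x <= 1) ->
  (forall n x, @Xc n x = X n x -> @G n x = @G' n x) ->
  forall e, 0 < e ->
  \forall n \near \oo, \int[P0 n]_x (@G' n x * W x) - e <= \int[Pt n]_x @G n x.
Proof.
move=> mG mG' G01 G'01 GG' e e0.
pose D := `|C| + 1; have D0 : 0 < D by rewrite ltr_wpDl.
(* the three error terms of [le_cam_bound] become [e / 4] each *)
pose K := 4 * D / e; have K0 : 0 < K by rewrite divr_gt0// mulr_gt0.
pose dl := e / 8; have dl0 : 0 < dl by rewrite divr_gt0.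
pose eta := e / (8 * K); have eta0 : 0 < eta by rewrite divr_gt0// mulr_gt0.
have p1 : \forall n \near \oo, fine (P0 n (@B1 dl n)) <= eta.
  have /fine_cvg/cvgrPdist_le/(_ _ eta0) := logL dl0.
  apply: filterS => n; rewrite sub0r normrN.
  by apply: le_trans; exact: ler_norm.
have p2 : \forall n \near \oo, fine (P0 n (@B2 n)) <= eta.
  have /fine_cvg/cvgrPdist_le/(_ _ eta0) := Xc_eq.
  apply: filterS => n; rewrite sub0r normrN.
  by apply: le_trans; exact: ler_norm.
move/cvgrPdist_le : W1 => /(_ _ ltr01) w1.
near=> n.
have h1 : fine (P0 n (@B1 dl n)) <= eta by near: n.
have h2 : fine (P0 n (@B2 n)) <= eta by near: n.
have h3 : \int[P0 n]_x W x ^+ 2 <= C by near: n; exact: W2.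
have : `|1 - \int[P0 n]_x W x| <= 1 by near: n.
rewrite ler_norml => /andP[h4 _].
have := le_cam_bound (mG n) (mG' n) (G01 n) (G'01 n) (@GG' n) dl0 K0.
apply: le_trans; rewrite -addrA lerD2l -opprD lerN2.
have q1 : dl * \int[P0 n]_x W x <= dl * 2 by rewrite ler_wpM2l ?(ltW dl0)//; lra.
have q2 : K * (fine (P0 n (@B1 dl n)) + fine (P0 n (@B2 n))) <= K * (2 * eta).
  by rewrite ler_wpM2l ?(ltW K0)//; lra.
have q3 : K^-1 * \int[P0 n]_x W x ^+ 2 <= K^-1 * D.
  rewrite ler_wpM2l ?invr_ge0 ?(ltW K0)// (le_trans h3)//.
  by rewrite (le_trans (ler_norm _))// lerDl.
have E1 : K * (2 * eta) = e / 4 by rewrite /eta; field; rewrite gt_eqF.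
have E2 : K^-1 * D = e / 4 by rewrite /K; field; rewrite !gt_eqF.
have E3 : dl * 2 = e / 4 by rewrite /dl; field.
lra.
Unshelve. all: by end_near. Qed.

(** The lower bound for [G] and the one for [- G], both moved into the unit
    interval, meet because the total mass of [W] tends to 1; so the singular
    part of [Pt n] disappears in the limit.  The random variable [X] is replaced
    by [Xc], which may be chosen with exponential moments. *)
Theorem le_cam (G G' : forall n, T n -> R) (B : R) :
  (forall n, measurable_fun [set: T n] (@G n)) ->
  (forall n, measurable_fun [set: T n] (@G' n)) ->
  (forall n x, `|@G n x| <= B) -> (forall n x, `|@G' n x| <= B) ->
  (forall n x, @Xc n x = X n x -> @G n x = @G' n x) ->
  \int[Pt n]_x @G n x - \int[P0 n]_x (@G' n x * W x) @[n --> \oo] --> (0 : R).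
Proof.
move=> mG mG' GB G'B GG'.
have GB' n x : `|@G n x| <= `|B| + 1.
  by rewrite (le_trans (GB n x))// (le_trans (ler_norm _))// lerDl.
have G'B' n x : `|@G' n x| <= `|B| + 1.
  by rewrite (le_trans (G'B n x))// (le_trans (ler_norm _))// lerDl.
pose D := `|B| + 1; have D0 : 0 < D by rewrite ltr_wpDl.
have D20 : 0 < 2 * D by rewrite mulr_gt0.
have low (s : R) (F F' : forall n, T n -> R) : (s = 1 \/ s = -1) ->
    (forall n, measurable_fun [set: T n] (@F n)) ->
    (forall n, measurable_fun [set: T n] (@F' n)) ->
    (forall n x, @F n x = (s * @G n x + D) / (2 * D)) ->
    (forall n x, @F' n x = (s * @G' n x + D) / (2 * D)) ->
    forall e, 0 < e -> \forall n \near \oo,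
    \int[P0 n]_x (@F' n x * W x) - e <= \int[Pt n]_x @F n x.
  move=> s1 mF mF' FE F'E; apply: le_cam_lower => //.
  - move=> n x; rewrite FE ler_pdivlMr// ler_pdivrMr//.
    by have := GB' n x; rewrite ler_norml -/D => /andP[? ?]; apply/andP; split; case: s1 => ->; lra.
  - move=> n x; rewrite F'E ler_pdivlMr// ler_pdivrMr//.
    by have := G'B' n x; rewrite ler_norml -/D => /andP[? ?]; apply/andP; split; case: s1 => ->; lra.
  - by move=> n x XX; rewrite FE F'E GG'.
have iG n : (Pt n).-integrable [set: T n] (EFin \o @G n).
  by apply: integrable_bounded => //; exists B; exact: GB.
have iGW n : (P0 n).-integrable [set: T n] (EFin \o (fun x => @G' n x * W x)).
  apply: (integrable_dominated _ (integrable_scale B (iW n))).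
    by apply: measurable_funM => //; exact: mW.
  by move=> x; rewrite normrM (ger0_norm (W_ge0 x)) ler_wpM2r.
have mS s n (H : T n -> R) : measurable_fun [set: T n] H ->
    measurable_fun [set: T n] (fun x => (s * H x + D) / (2 * D)).
  move=> mH; apply: measurable_funM => //; apply: measurable_funD => //.
  exact: measurable_funM.
have main s e : s = 1 \/ s = -1 -> 0 < e -> \forall n \near \oo,
    s * (\int[P0 n]_x (@G' n x * W x) - \int[Pt n]_x @G n x) <= e.
  move=> s1 e0.
  have e1 : 0 < e / (4 * D) by rewrite divr_gt0// mulr_gt0.
  have e2 : 0 < e / (2 * D) by rewrite divr_gt0.
  have := @low s (fun n x => (s * @G n x + D) / (2 * D))
    (fun n x => (s * @G' n x + D) / (2 * D)) s1 (fun n => mS s _ _ (mG n))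
    (fun n => mS s _ _ (mG' n)) (fun _ _ => erefl) (fun _ _ => erefl) _ e1.
  move/cvgrPdist_le : W1 => /(_ _ e2) w1 lw.
  near=> n.
  have : `|1 - \int[P0 n]_x W x| <= e / (2 * D) by near: n.
  rewrite ler_norml => /andP[h1 h2].
  have : \int[P0 n]_x ((s * @G' n x + D) / (2 * D) * W x) - e / (4 * D) <=
    \int[Pt n]_x ((s * @G n x + D) / (2 * D)) by near: n.
  have -> : \int[P0 n]_x ((s * @G' n x + D) / (2 * D) * W x) =
      s / (2 * D) * \int[P0 n]_x (@G' n x * W x) + 2^-1 * \int[P0 n]_x W x.
    rewrite -(RintegralZl _ measurableT (iGW n)) -(RintegralZl _ measurableT (iW n)).
    rewrite -(RintegralD measurableT (integrable_scale _ (iGW n)) (integrable_scale _ (iW n))).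
    by apply: eq_Rintegral => x _; field; rewrite gt_eqF.
  have -> : \int[Pt n]_x ((s * @G n x + D) / (2 * D)) =
      s / (2 * D) * \int[Pt n]_x @G n x + 2^-1.
    rewrite -(RintegralZl _ measurableT (iG n)) -[in RHS](Rintegral_prob_cst (Pt n) 2^-1).
    rewrite -(RintegralD measurableT (integrable_scale _ (iG n)) (integrable_const _ _)).
    by apply: eq_Rintegral => x _; field; rewrite gt_eqF.
  set I1 := \int[P0 n]_x (@G' n x * W x); set I2 := \int[Pt n]_x _; set I3 := Rintegral _ _ _ in h1 h2 *.
  move=> h3.
  have h4 : s / (2 * D) * (I1 - I2) <= e / (4 * D) + 2^-1 * (e / (2 * D)) by lra.
  have h5 : (2 * D) * (s / (2 * D) * (I1 - I2)) <= (2 * D) * (e / (4 * D) + 2^-1 * (e / (2 * D))).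
    by rewrite ler_wpM2l// ltW.
  have E1 : (2 * D) * (s / (2 * D) * (I1 - I2)) = s * (I1 - I2) by field; rewrite gt_eqF.
  have E2 : (2 * D) * (e / (4 * D) + 2^-1 * (e / (2 * D))) = e by field; rewrite gt_eqF.
  by rewrite E1 E2 in h5.
apply/cvgrPdist_le => e e0.
have m1 := main 1 e (or_introl erefl) e0.
have m2 := main (-1) e (or_intror erefl) e0.
near=> n; rewrite sub0r opprB ler_norml.
have h1 : 1 * (\int[P0 n]_x (@G' n x * W x) - \int[Pt n]_x @G n x) <= e by near: n.
have h2 : -1 * (\int[P0 n]_x (@G' n x * W x) - \int[Pt n]_x @G n x) <= e by near: n.
by apply/andP; split; lra.
Unshelve. all: by end_near. Qed.

End le_cam.

(** * Truncation, products and convolutions *)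

Section truncation.
Variable R : realType.
Implicit Types (M x r : R).

Lemma bounded_continuous_expR_clamp r M : 0 <= M ->
  bounded_continuous (fun x => expR (r * `|clamp M x|)).
Proof.
move=> M0; split.
  move=> x; apply: (@continuous_comp _ _ _ (fun x => r * `|clamp M x|) expR).
    apply: cvgM; first exact: cvg_cst.
    by apply: cvg_norm; exact: continuous_clamp.
  exact: continuous_expR.
exists (expR (`|r| * M)) => x; rewrite ger0_norm ?expR_ge0// ler_expR.
by rewrite (le_trans (ler_norm _))// normrM normr_id ler_wpM2l// normr_clamp.
Qed.

(** Convergence in law does not give exponential moments.  At a fixed level
    the moments of the clamped variables converge to limits bounded by the
    moments of [N]; if the level grows slowly, the first [c n] of these
    bounds hold simultaneously for large [n]. *)
Lemma exists_truncation d (T : nat -> measurableType d) (P : forall n, probability (T n) R)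
    (X : forall n, {mfun T n >-> R}) (N : probability R R) :
  (forall r, N.-integrable [set: R] (EFin \o (fun x => expR (r * `|x|)))) ->
  (forall h, bounded_continuous h ->
    \int[P n]_x h (X n x) @[n --> \oo] --> \int[N]_x h x) ->
  exists c : nat -> nat, (forall m, \forall n \near \oo, (m <= c n)%N) /\
    forall r, exists C, \forall n \near \oo,
      \int[P n]_x expR (r * `|clamp (c n)%:R (X n x)|) <= C.
Proof.
move=> iN XN.
pose C (j : nat) := \int[N]_x expR (j%:R * `|x|) + 1.
have [m|c [cy hc]] := @diagonal_choice (fun m n => forall j : 'I_m.+1,
    \int[P n]_x expR (j%:R * `|clamp m%:R (X n x)|) <= C j).
  apply: filter_forall => j.
  have bj := @bounded_continuous_expR_clamp j%:R m%:R (ler0n _ m).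
  move/cvgrPdist_le : (XN _ bj) => /(_ _ ltr01).
  apply: filterS => n; rewrite ler_norml => /andP[+ _].
  have : \int[N]_x expR (j%:R * `|clamp m%:R x|) <= \int[N]_x expR (j%:R * `|x|).
    apply: (le_Rintegral measurableT (bounded_continuous_integrable N bj) (iN _)) => x _.
    by rewrite ler_expR ler_wpM2l// normr_clamp_le.
  rewrite /C; lra.
exists c; split=> // r.
pose j := (Num.truncn `|r|).+1; exists (C j).
near=> n.
have jc : (j < (c n).+1)%N by rewrite ltnS; near: n; exact: cy.
have H : forall j : 'I_(c n).+1, \int[P n]_x expR (j%:R * `|clamp (c n)%:R (X n x)|) <= C j.
  by near: n.
apply: le_trans (H (Ordinal jc)).
have ibc s : (P n).-integrable [set: T n] (EFin \o (fun x : T n => expR (s * `|clamp (c n)%:R (X n x)|))).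
  have bs := @bounded_continuous_expR_clamp s (c n)%:R (ler0n _ _).
  apply: integrable_bounded; last by have [_ [B hB]] := bs; exists B.
  apply: (measurableT_comp (bounded_continuous_measurable bs)) => //.
apply: (le_Rintegral measurableT (ibc _) (ibc _)) => x _ /=.
rewrite ler_expR ler_wpM2r// (le_trans (ler_norm _))// ltW// /j truncnS_gt//.
Unshelve. all: by end_near. Qed.

End truncation.

Section product_integrals.
Variable R : realType.
Implicit Types (F G f : R -> R) (mu nu : probability R R).

Lemma bounded_continuous_tensor_integrable (P : probability (R * R)%type R) F G :
  bounded_continuous F -> bounded_continuous G ->
  P.-integrable [set: R * R] (EFin \o (fun p => F p.1 * G p.2)).
Proof.
move=> bF bG; apply: integrable_bounded.
  apply: measurable_funM.
    by apply: measurableT_comp; [exact: bounded_continuous_measurable|exact: measurable_fst].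
  by apply: measurableT_comp; [exact: bounded_continuous_measurable|exact: measurable_snd].
have [_ [C FC]] := bF; have [_ [D GD]] := bG.
by exists (C * D) => p; rewrite normrM ler_pM.
Qed.

Lemma Rintegral_tensor mu nu F G : bounded_continuous F -> bounded_continuous G ->
  \int[(mu \x nu)%E]_p (F p.1 * G p.2) = \int[mu]_x F x * \int[nu]_y G y.
Proof.
move=> bF bG.
have iFG := bounded_continuous_tensor_integrable (mu \x nu)%E bF bG.
rewrite /Rintegral -(integral12_prod_meas1 iFG) /fubini_F /=.
have -> : (\int[mu]_x \int[nu]_y (F x * G y)%:E =
    \int[mu]_x ((F x)%:E * (\int[nu]_y G y)%:E))%E.
  apply: eq_integral => x _; rewrite -integral_EFin; last exact: bounded_continuous_integrable.
  under eq_integral do rewrite EFinM.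
  by rewrite integralZl//; exact: bounded_continuous_integrable.
rewrite integralZr//; last exact: bounded_continuous_integrable.
by rewrite integral_EFin//; exact: bounded_continuous_integrable.
Qed.

Lemma measurable_bounded_continuous_lin (f : R -> R) (a b : R) : bounded_continuous f ->
  measurable_fun [set: R * R] (fun p => f (a * p.1 + b * p.2)).
Proof.
move=> bf; apply: (measurableT_comp (bounded_continuous_measurable bf)).
by apply: measurable_funD; apply: measurable_funM.
Qed.

Lemma measurable_bounded_continuous_add f : bounded_continuous f ->
  measurable_fun [set: R * R] (fun p => f (p.1 + p.2)).
Proof.
move=> bf; rewrite (_ : (fun p => _) = fun p : R * R => f (1 * p.1 + 1 * p.2)).
  exact: measurable_bounded_continuous_lin.
by apply/funext => p; rewrite !mul1r.
Qed.

Lemma Rintegral_convolution mu nu f : bounded_continuous f ->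
  \int[convolution mu nu]_x f x = \int[(mu \x nu)%E]_p f (p.1 + p.2).
Proof.
move=> bf; rewrite /Rintegral /convolution integral_distribution//.
  by apply/measurable_EFinP; exact: bounded_continuous_measurable.
apply: integrable_bounded; first exact: measurable_bounded_continuous_add.
by have [_ [B fB]] := bf; exists B.
Qed.

Lemma Rintegral_convolution_dirac mu f (t : R) : bounded_continuous f ->
  \int[convolution mu (dirac t)]_x f x = \int[mu]_x f (x + t).
Proof.
move=> bf; rewrite Rintegral_convolution// /Rintegral; congr fine.
have [_ [B fB]] := bf.
have mf : measurable_fun [set: R * R] (fun p : R * R => (f (p.1 + p.2))%:E).
  by apply/measurable_EFinP; exact: measurable_bounded_continuous_add.
have iff : (mu \x dirac t)%E.-integrable [set: R * R] (fun p : R * R => (f (p.1 + p.2))%:E).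
  by apply: integrable_bounded => //; [exact/measurable_EFinP|exists B].
rewrite -(integral12_prod_meas1 iff) /fubini_F; apply: eq_integral => x _ /=.
rewrite integral_dirac ?diracT ?mul1e//.
apply/measurable_EFinP; apply: (measurableT_comp (bounded_continuous_measurable bf)).
exact: measurable_funD.
Qed.

(** The law of [z + x / s ^+ 2] when [x] is normal and [z] is independent of it
    with law [nu]. *)
Lemma convolution_normal_law nu (theta s : R) f : 0 < s ->
  bounded_continuous f -> (forall x, 0 <= f x) ->
  \int[convolution nu (normal_law theta (1 / s))]_x f x =
  \int[(normal_law (theta * s ^+ 2) s \x nu)%E]_p f (p.2 + p.1 / s ^+ 2).
Proof.
move=> s0 bf f0; rewrite Rintegral_convolution// /Rintegral; congr fine.
have meas1 : measurable_fun [set: R * R] (fun p : R * R => (f (p.1 + p.2))%:E).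
  by apply/measurable_EFinP; exact: measurable_bounded_continuous_add.
have meas2 : measurable_fun [set: R * R] (fun p : R * R => (f (p.2 + p.1 / s ^+ 2))%:E).
  apply/measurable_EFinP.
  rewrite (_ : (fun p => _) = fun p : R * R => f (s ^- 2 * p.1 + 1 * p.2)).
    exact: measurable_bounded_continuous_lin.
  by apply/funext => p; rewrite mul1r addrC mulrC.
rewrite (fubini_tonelli1 _ meas1); last by move=> p; rewrite lee_fin.
rewrite (fubini_tonelli2 _ meas2); last by move=> p; rewrite lee_fin.
apply: eq_integral => y _; rewrite /fubini_F /fubini_G /=.
have s2 : 0 < s ^- 2 by rewrite invr_gt0 exprn_gt0.
have := @ge0_integral_normal_law_affine R (theta * s ^+ 2) s (s ^- 2) 0
  (fun x => f (y + x)) s2 (lt0r_neq0 s0).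
have -> : s ^- 2 * (theta * s ^+ 2) + 0 = theta by field; rewrite gt_eqF.
have -> : s ^- 2 * s = 1 / s by field; rewrite gt_eqF.
move=> ->//.
  by apply: eq_integral => x _; rewrite addr0 mulrC.
move=> x; apply: (@continuous_comp _ _ _ (fun x => y + x) f); last by case: bf => cf _; exact: cf.
by apply: cvgD; [exact: cvg_cst|exact: cvg_id].
Qed.

End product_integrals.

(** * The limit of the local experiments *)

Lemma cvg_asymptotically_equal (R : realType) (u v : nat -> R) (l : R) :
  u n - v n @[n --> \oo] --> (0 : R) -> v n @[n --> \oo] --> l -> u n @[n --> \oo] --> l.
Proof.
move=> uv vl; rewrite -[l]add0r (_ : u = fun n => (u n - v n) + v n); first exact: cvgD.
by apply/funext => n; rewrite subrK.
Qed.

Section regular_limit.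
Context d (T : nat -> measurableType d) (R : realType).
Variables (sigma : R) (Theta : set R) (P : R -> forall n, probability (T n) R).
Variables (X Y : forall n, {mfun T n >-> R}) (Q : probability R R).
Hypothesis sigma_gt0 : 0 < sigma.
Hypothesis Theta0 : Theta 0.
Hypothesis Theta_int : interior (closure Theta) !=set0.
Local Notation N := (normal_law 0 sigma).
Hypothesis likelihood : forall theta, Theta theta ->
  exists L : forall n, T n -> \bar R,
    (forall n, is_likelihood_ratio (P theta n) (P 0 n) (L n)) /\
    forall e : R, 0 < e ->
    P 0 n [set x | e%:E < `|lne (L n x) - (theta * X n x - theta ^+ 2 * sigma ^+ 2 / 2)%:E|]%E
      @[n --> \oo] --> 0%E.
Hypothesis central : forall h, bounded_continuous h ->
  \int[P 0 n]_x h (X n x) @[n --> \oo] --> \int[N]_x h x.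
Hypothesis regular : forall theta k, Theta theta -> bounded_continuous k ->
  \int[P theta n]_x k (Y n x) @[n --> \oo] --> \int[Q]_y k (y + theta).

Let sigma0 : sigma != 0. Proof. by rewrite gt_eqF. Qed.

Let Nexp r : N.-integrable [set: R] (EFin \o (fun x => expR (r * `|x|))).
Proof. exact: integrable_normal_law_expR. Qed.

Let exp_growth_tilt theta :
  exp_growth (fun x => expR (theta * x - theta ^+ 2 * sigma ^+ 2 / 2)).
Proof.
rewrite (_ : (fun x => _) = fun x =>
  expR (theta * x) * expR (- (theta ^+ 2 * sigma ^+ 2 / 2))).
  apply: exp_growthM; first exact: exp_growth_expR.
  exact/bounded_exp_growth/bounded_continuous_cst.
by apply/funext => x; rewrite -expRD.
Qed.

Section truncated.
Variable c : nat -> nat.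
Hypothesis c_cvg : forall m, \forall n \near \oo, (m <= c n)%N.
Hypothesis c_exp : forall r, exists C, \forall n \near \oo,
  \int[P 0 n]_x expR (r * `|clamp (c n)%:R (X n x)|) <= C.

Let Xc n (x : T n) : R := clamp (c n)%:R (X n x).

Let mXc n : measurable_fun [set: T n] (@Xc n).
Proof.
apply: measurableT_comp => //; apply: continuous_measurable_fun.
exact: continuous_clamp.
Qed.

Let XcB n x : `|@Xc n x| <= (c n)%:R.
Proof. exact: normr_clamp. Qed.

Let Xc_eq : P 0 n [set x | @Xc n x != X n x] @[n --> \oo] --> 0%E.
Proof.
have mB n : measurable [set x | @Xc n x != X n x] by exact: measurable_neq_fun.
apply/fine_cvgP; split.
  by apply: nearW => n; exact: fin_num_measure (mB n).
apply/cvgrPdist_le => e e0; rewrite /comp /=.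
have e2 : 0 < e / 2 by rewrite divr_gt0.
have [M hM] := cutoff_tight N e2.
have bM := @bounded_continuous_cutoff R M.
move/cvgrPdist_le : (central bM) => /(_ _ e2) cM.
near=> n; rewrite sub0r normrN ger0_norm ?fine_ge0//.
have Mc : M + 1 <= (c n)%:R.
  apply: (@le_trans _ _ (Num.truncn `|M + 1|).+1%:R).
    by rewrite (le_trans (ler_norm _))// ltW// truncnS_gt.
  by rewrite ler_nat; near: n; exact: c_cvg.
have : `|\int[N]_x cutoff M x - \int[P 0 n]_x cutoff M (X n x)| <= e / 2 by near: n.
rewrite ler_norml => /andP[_ h].
have iM : (P 0 n).-integrable [set: T n] (EFin \o (fun x => cutoff M (X n x))).
  apply: integrable_bounded.
    by apply: measurableT_comp => //; exact: bounded_continuous_measurable.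
  by exists 1 => x; exact: normr_ramp_le1.
have : \int[P 0 n]_x (\1_[set x | @Xc n x != X n x] x : R) <=
       \int[P 0 n]_x (1 - cutoff M (X n x)).
  have iB : (P 0 n).-integrable [set: T n]
      (EFin \o (\1_[set x | @Xc n x != X n x] : T n -> R)) by exact: integrable_indic.
  apply: (le_Rintegral measurableT iB (integrable_sub (integrable_const _ 1) iM)).
  move=> x _; rewrite indicE; have [|_] := boolP (x \in _); last by rewrite subr_ge0 cutoff_le1.
  rewrite inE /= => xc; rewrite cutoff_eq0 ?subr0//.
  rewrite (le_trans Mc)// ltW// ltNge; apply: contra xc => xc.
  by rewrite /Xc clamp_id.
rewrite {1}/Rintegral integral_indic// setIT.
rewrite (RintegralB measurableT (integrable_const _ _) iM) Rintegral_prob_cst.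
lra.
Unshelve. all: by end_near. Qed.

Let m2 n : measurable_fun [set: T n] (fun x => (@Xc n x, Y n x)).
Proof. by apply: measurable_fun_pair. Qed.

Let pm n : {mfun T n >-> (R * R)%type} := mfun_Sub (mem_set (@m2 n)).

Let mu n : probability (R * R)%type R := distribution (P 0 n) (pm n).

Let muE n (f : R * R -> R) : measurable_fun [set: R * R] f ->
  (P 0 n).-integrable [set: T n] (EFin \o (fun x => f (@Xc n x, Y n x))) ->
  \int[mu n]_p f p = \int[P 0 n]_x f (@Xc n x, Y n x).
Proof.
move=> mf i; rewrite /Rintegral /mu integral_distribution//.
exact/measurable_EFinP.
Qed.

Let iexp n r : (P 0 n).-integrable [set: T n] (EFin \o (fun x => expR (r * `|@Xc n x|))).
Proof.
apply: integrable_bounded.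
  by apply: measurableT_comp => //; apply: measurable_funM => //; exact: measurableT_comp.
exists (expR (`|r| * (c n)%:R)) => x; rewrite ger0_norm ?expR_ge0// ler_expR.
by rewrite (le_trans (ler_norm _))// normrM normr_id ler_wpM2l.
Qed.

Let integrable_Xc n (f : T n -> R) B (h : R -> R) :
  measurable_fun [set: T n] f -> (forall x, `|f x| <= B) -> exp_growth h ->
  (P 0 n).-integrable [set: T n] (EFin \o (fun x => f x * h (@Xc n x))).
Proof.
move=> mf fB eh.
by apply: (@exp_growth_integrable _ _ _ (P 0 n) (@Xc n) f h B) => // r; exact: iexp.
Qed.

Let integrable_mu n (f : R * R -> R) : measurable_fun [set: R * R] f ->
  (P 0 n).-integrable [set: T n] (EFin \o (fun x => f (@Xc n x, Y n x))) ->
  (mu n).-integrable [set: R * R] (EFin \o f).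
Proof.
move=> mf i; have mF : measurable_fun [set: R * R] (EFin \o f) by exact/measurable_EFinP.
by have := @integrable_pushforward _ _ _ _ R (pm n) (measurable_funPT _) (P 0 n) _ _ mF i measurableT.
Qed.

Let mu_exp : exp_moments mu (fun _ p => p.1).
Proof.
have me r : measurable_fun [set: R * R] (fun p => expR (r * `|p.1|)).
  apply: measurableT_comp => //; apply: measurable_funM => //.
  by apply: measurableT_comp => //; exact: measurable_fst.
split=> [n r|r]; first by apply: integrable_mu => //; exact: iexp.
have [C hC] := c_exp r; exists C.
by apply: filterS hC => n; rewrite muE//; exact: iexp.
Qed.

Let mu_fst h : bounded_continuous h ->
  \int[mu n]_p h p.1 @[n --> \oo] --> \int[N]_x h x.
Proof.
move=> bh; have mh := bounded_continuous_measurable bh.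
have [_ [B hB]] := bh; have B0 : 0 <= B by exact: le_trans (hB 0).
have iX n : (P 0 n).-integrable [set: T n] (EFin \o (fun x => h (X n x))).
  by apply: integrable_bounded; [exact: measurableT_comp|exists B].
have iXc n : (P 0 n).-integrable [set: T n] (EFin \o (fun x => h (@Xc n x))).
  by apply: integrable_bounded; [exact: measurableT_comp|exists B].
have -> : (fun n => \int[mu n]_p h p.1) = fun n => \int[P 0 n]_x h (@Xc n x).
  apply/funext => n; rewrite (@muE n (fun p => h p.1))//.
  by apply: measurableT_comp => //; exact: measurable_fst.
suff D0 : \int[P 0 n]_x h (@Xc n x) - \int[P 0 n]_x h (X n x) @[n --> \oo] --> (0 : R).
  exact: cvg_asymptotically_equal (central bh).
have mB n : measurable [set x | @Xc n x != X n x] by exact: measurable_neq_fun.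
apply/cvgrPdist_le => e e0; have /fine_cvg/cvgrPdist_le := Xc_eq.
have B1 : 0 < 2 * B + 1 by rewrite ltr_wpDl// mulr_ge0.
move=> /(_ _ (divr_gt0 e0 B1)); apply: filterS => n /=.
rewrite !sub0r !normrN ger0_norm ?fine_ge0// => hn.
rewrite -(RintegralB measurableT (iXc n) (iX n)).
have iB : (P 0 n).-integrable [set: T n]
    (EFin \o (\1_[set x | @Xc n x != X n x] : T n -> R)) by exact: integrable_indic.
apply: (@le_trans _ _ (\int[P 0 n]_x ((2 * B) * (\1_[set x | @Xc n x != X n x] x : R)))).
  apply: normr_Rintegral_le.
  - by apply: measurable_funB; exact: measurableT_comp.
  - exact: integrable_scale.
  - move=> x; rewrite indicE; have [_|] := boolP (x \in _).
      by rewrite mulr1 (le_trans (ler_normB _ _))//; have := hB (X n x); have := hB (Xc x); lra.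
    rewrite notin_setE /= => /negP/negPn/eqP ->.
    by rewrite subrr normr0 mulr0.
rewrite (RintegralZl _ measurableT iB) {1}/Rintegral integral_indic// setIT.
apply: (@le_trans _ _ ((2 * B + 1) * fine (P 0 n [set x | @Xc n x != X n x]))).
  by rewrite ler_wpM2r ?fine_ge0// lerDl.
by rewrite mulrC -ler_pdivlMr.
Qed.

(** The second moment required by [le_cam] is an exponential moment of [Xc], and
    the total mass of the weights tends to the integral of the normal density
    ratio. *)
Let contiguity theta (G G' : forall n, T n -> R) B : Theta theta ->
  (forall n, measurable_fun [set: T n] (@G n)) ->
  (forall n, measurable_fun [set: T n] (@G' n)) ->
  (forall n x, `|@G n x| <= B) -> (forall n x, `|@G' n x| <= B) ->
  (forall n x, @Xc n x = X n x -> @G n x = @G' n x) ->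
  \int[P theta n]_x @G n x - \int[P 0 n]_x (@G' n x *
    expR (theta * @Xc n x - theta ^+ 2 * sigma ^+ 2 / 2)) @[n --> \oo] --> (0 : R).
Proof.
move=> Tt; have [L [lr logL]] := likelihood Tt.
set a := theta ^+ 2 * sigma ^+ 2 / 2.
have a0 : 0 <= a by rewrite /a divr_ge0// mulr_ge0 ?sqr_ge0.
have ew : exp_growth (fun x => expR (theta * x - a)) by exact: exp_growth_tilt.
have i1 n h : exp_growth h -> (P 0 n).-integrable [set: T n] (EFin \o (fun x => h (@Xc n x))).
  move=> eh; have := @integrable_Xc n (fun=> 1) 1 h (measurable_cst _) _ eh.
  rewrite (_ : (fun x => 1 * _) = fun x => h (@Xc n x)).
    by apply => x; rewrite normr1.
  by apply/funext => x; rewrite mul1r.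
have [C hC] := c_exp (2 * `|theta|).
apply: (le_cam (C := C) lr logL) => //.
- move=> n; have := i1 n _ (exp_growthM ew ew).
  by rewrite (_ : (fun x => expR _ * expR _) = fun x => expR (theta * @Xc n x - a) ^+ 2).
- apply: filterS hC => n; apply: le_trans.
  have mn := i1 n _ (exp_growthM ew ew).
  apply: (le_Rintegral measurableT mn (iexp n _)) => x _.
  rewrite -expRD ler_expR.
  have : theta * Xc x <= `|theta| * `|Xc x| by rewrite -normrM ler_norm.
  by lra.
- have WN : \int[N]_x (1 * expR (theta * x - a)) = 1.
    have -> : \int[N]_x (1 * expR (theta * x - a)) = \int[N]_x expR (theta * x - a).
      by apply: eq_Rintegral => x _; rewrite mul1r.
    have H := @integral_normal_law_expR R theta sigma sigma0.
    by rewrite /Rintegral H.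
  suff : \int[P 0 n]_x expR (theta * @Xc n x - a) @[n --> \oo] -->
    \int[N]_x (1 * expR (theta * x - a)) by rewrite WN.
  rewrite (_ : (fun n => _) = fun n => \int[mu n]_p (1 * expR (theta * p.1 - a))).
    have b1 : forall s : R, `|(1 : R)| <= 1 by move=> s; rewrite normr1.
    have b2 (n : nat) : forall s : R * R, `|(1 : R)| <= 1 by move=> s; rewrite normr1.
    have m1 (n : nat) : measurable_fun [set: R * R] (fun p => p.1 : R) by exact: measurable_fst.
    have m2' (n : nat) : measurable_fun [set: R * R] (fun _ : R * R => 1 : R) by exact: measurable_cst.
    apply: (@exp_growth_cvg _ _ _ _ R mu (fun _ p => p.1) (fun _ _ => 1) N id (fun=> 1) 1 1
      m1 m2' b2 mu_exp (@measurable_id _ _ _) (measurable_cst _) b1 Nexp _ _ ew) => h bh.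
    rewrite (_ : (fun n => _) = fun n => \int[mu n]_p h p.1).
      by under eq_Rintegral do rewrite mul1r; exact: mu_fst.
    by apply/funext => n; apply: eq_Rintegral => p _; rewrite mul1r.
  apply/funext => n.
  have H := @muE n (fun p => 1 * expR (theta * p.1 - a)).
  rewrite H /=.
  - by apply: eq_Rintegral => x _; rewrite mul1r.
  - apply: measurable_funM => //; apply: measurableT_comp => //.
    by apply: measurable_funB => //; apply: measurable_funM => //; exact: measurable_fst.
  - apply: (@integrable_Xc n (fun=> 1) 1 (fun x => expR (theta * x - a))) => //.
    by move=> x; rewrite normr1.
Qed.

Let mu_regular theta k : Theta theta -> bounded_continuous k ->
  \int[mu n]_p (k p.2 * expR (theta * p.1 - theta ^+ 2 * sigma ^+ 2 / 2)) @[n --> \oo]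
    --> \int[Q]_y k (y + theta).
Proof.
move=> Tt bk; have mk := bounded_continuous_measurable bk; have [_ [B kB]] := bk.
have mkY n : measurable_fun [set: T n] (fun x => k (Y n x)) by exact: measurableT_comp.
have := contiguity Tt mkY mkY (fun n x => kB (Y n x)) (fun n x => kB (Y n x)) (fun _ _ _ => erefl).
rewrite (_ : (fun n => _) = fun n => \int[P theta n]_x k (Y n x) - \int[mu n]_p (k p.2 *
  expR (theta * p.1 - theta ^+ 2 * sigma ^+ 2 / 2))).
  move=> /cvgN; rewrite oppr0 => H.
  apply: cvg_asymptotically_equal (regular Tt bk).
  by under eq_fun do rewrite -opprB.
apply/funext => n; congr (_ - _).
rewrite (@muE n (fun p => k p.2 * expR (theta * p.1 - theta ^+ 2 * sigma ^+ 2 / 2)))//.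
  apply: measurable_funM; first by apply: measurableT_comp => //; exact: measurable_snd.
  apply: measurableT_comp => //; apply: measurable_funB => //.
  by apply: measurable_funM => //; exact: measurable_fst.
by apply: (@integrable_Xc n _ B (fun x => expR (theta * x - theta ^+ 2 * sigma ^+ 2 / 2))).
Qed.

Lemma truncated_limit : exists nu : probability R R, forall theta F G,
  Theta theta -> bounded_continuous F -> bounded_continuous G ->
  \int[P theta n]_x (F (X n x) * G (Y n x - X n x / sigma ^+ 2)) @[n --> \oo] -->
  \int[normal_law (theta * sigma ^+ 2) sigma]_x F x * \int[nu]_z G z.
Proof.
have [nu hnu] := rest_limit sigma_gt0 Theta0 Theta_int mu_exp mu_fst mu_regular.
exists nu => theta F G Tt bF bG; have [_ [B FB]] := bF; have [_ [C GC]] := bG.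
have mF := bounded_continuous_measurable bF; have mG := bounded_continuous_measurable bG.
have ew := exp_growth_tilt theta.
have mGn n (x : T n -> R) : measurable_fun [set: T n] x ->
    measurable_fun [set: T n] (fun t => F (x t) * G (Y n t - x t / sigma ^+ 2)).
  move=> mx; apply: measurable_funM; first exact: measurableT_comp.
  apply: measurableT_comp => //; apply: measurable_funB => //.
  exact: measurable_funM.
have bFG (x y : R) : `|F x * G y| <= B * C by rewrite normrM ler_pM.
have := contiguity Tt (fun n => mGn n _ (measurable_funPT (X n))) (fun n => mGn n _ (@mXc n))
  (fun n x => bFG _ _) (fun n x => bFG _ _) (fun n x e => congr1 (fun z => F z * G (Y n x - z / sigma ^+ 2)) (esym e)).
move/cvg_asymptotically_equal; apply.
have eh := exp_growthM (bounded_exp_growth bF) ew.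
have := hnu _ _ eh bG; rewrite -Rintegral_normal_law_tilt//.
rewrite (_ : (fun n => _) = fun n => \int[P 0 n]_x (F (@Xc n x) * G (Y n x - @Xc n x / sigma ^+ 2) *
  expR (theta * @Xc n x - theta ^+ 2 * sigma ^+ 2 / 2)))//.
apply/funext => n.
pose g (p : R * R) := F p.1 * expR (theta * p.1 - theta ^+ 2 * sigma ^+ 2 / 2) *
  G (p.2 - p.1 / sigma ^+ 2).
have gE x : g (@Xc n x, Y n x) = F (Xc x) * G (Y n x - Xc x / sigma ^+ 2) *
  expR (theta * Xc x - theta ^+ 2 * sigma ^+ 2 / 2) by rewrite /g/= mulrAC.
rewrite -[LHS]/(\int[mu n]_p g p) (@muE n g).
- by apply: eq_Rintegral => x _; exact: gE.
- have mw : measurable_fun [set: R] (fun x => F x * expR (theta * x - theta ^+ 2 * sigma ^+ 2 / 2)).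
    exact: exp_growth_measurable eh.
  apply: measurable_funM; first exact: (measurableT_comp mw measurable_fst).
  apply: measurableT_comp => //; apply: measurable_funB; first exact: measurable_snd.
  by apply: measurable_funM => //; exact: measurable_fst.
- rewrite (_ : EFin \o _ = EFin \o (fun x => F (Xc x) * G (Y n x - Xc x / sigma ^+ 2) *
    expR (theta * @Xc n x - theta ^+ 2 * sigma ^+ 2 / 2))).
    exact: (integrable_Xc (mGn n _ (@mXc n)) (fun x => bFG _ _) ew).
  by apply/funext => x; rewrite /comp gE.
Qed.

End truncated.

(** Under [P 0] the pair of the clamped central sequence and [Y] satisfies the
    hypotheses of [rest_limit], by [le_cam] for functions of [Y].  The general
    [theta] follows by [le_cam] for functions of both variables: the weight
    [expR (theta * x - theta ^+ 2 * sigma ^+ 2 / 2)] affects the first factor of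
    the limit only, and turns it into a shifted normal law. *)
Theorem regular_limit : exists nu : probability R R, forall theta F G,
  Theta theta -> bounded_continuous F -> bounded_continuous G ->
  \int[P theta n]_x (F (X n x) * G (Y n x - X n x / sigma ^+ 2)) @[n --> \oo] -->
  \int[normal_law (theta * sigma ^+ 2) sigma]_x F x * \int[nu]_z G z.
Proof.
have [c [c_cvg c_exp]] := exists_truncation Nexp central.
exact: truncated_limit c_cvg c_exp.
Qed.

End regular_limit.

(** * Point masses *)

Section point_mass.
Variable R : realType.
Implicit Types (mu nu : probability R R) (k : R -> R).

Lemma Rintegral_point_mass mu k (a : R) : measurable_fun [set: R] k ->
  measure_eq mu (dirac a) -> \int[mu]_x k x = k a.
Proof.
move=> mk mua; have mE : measurable_fun [set: R] (EFin \o k) by exact/measurable_EFinP.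
rewrite /Rintegral (@eq_measure_integral _ _ _ setT (dirac a) mu); last first.
  by move=> A mA _; exact: mua.
by rewrite integral_dirac// diracT mul1e.
Qed.

Lemma bounded_continuous_point_mass mu (a : R) :
  (forall k, bounded_continuous k -> \int[mu]_x k x = k a) -> measure_eq mu (dirac a).
Proof.
move=> mua; apply: probability_bounded_continuous_eq => k bk _.
rewrite mua// (@Rintegral_point_mass (dirac a) k a)//.
exact: bounded_continuous_measurable.
Qed.

Lemma convolution_point_mass0 mu nu : measure_eq mu (dirac (0 : R)) ->
  measure_eq (convolution mu nu) nu.
Proof.
move=> mu0; apply: probability_bounded_continuous_eq => f bf f0.
rewrite Rintegral_convolution// /Rintegral; congr fine.
have mf : measurable_fun [set: R * R] (fun p : R * R => (f (p.1 + p.2))%:E).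
  by apply/measurable_EFinP; exact: measurable_bounded_continuous_add.
have f0E (p : R * R) : (0 <= (f (p.1 + p.2))%:E)%E by rewrite lee_fin.
rewrite (fubini_tonelli1 _ mf)//.
rewrite (@eq_measure_integral _ _ _ setT (dirac (0 : R)) mu); last first.
  by move=> A mA _; exact: mu0.
rewrite integral_dirac// ?diracT ?mul1e//.
  by apply: eq_integral => x _; rewrite /= add0r.
exact: measurable_fun_fubini_tonelli_F.
Qed.

Lemma Rintegral_measure_eq mu nu k : measure_eq mu nu -> \int[mu]_x k x = \int[nu]_x k x.
Proof.
move=> mn; rewrite /Rintegral; congr fine; apply: eq_measure_integral => A mA _.
exact: mn.
Qed.

(** Characteristic functions are multiplicative, so that the one of [mu] is
    identically 1 wherever it can be divided by that of [nu]; and [mu] is then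
    determined by [trigonometric_vanish] with a constant sequence. *)
Lemma convolution_cancel mu nu :
  (forall u, chf_re nu u ^+ 2 + chf_im nu u ^+ 2 != 0) ->
  measure_eq (convolution mu nu) nu -> measure_eq mu (dirac (0 : R)).
Proof.
move=> nu0 munu; apply: bounded_continuous_point_mass => k bk.
have chf u : chf_re mu u = 1 /\ chf_im mu u = 0.
  have bc := bounded_continuous_cos u; have bs := bounded_continuous_sin u.
  have tc := bounded_continuous_tensor_integrable (mu \x nu)%E bc bc.
  have ts := bounded_continuous_tensor_integrable (mu \x nu)%E bs bs.
  have tcs := bounded_continuous_tensor_integrable (mu \x nu)%E bc bs.
  have tsc := bounded_continuous_tensor_integrable (mu \x nu)%E bs bc.
  have Ec : chf_re mu u * chf_re nu u - chf_im mu u * chf_im nu u = chf_re nu u.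
    rewrite /chf_re /chf_im -!Rintegral_tensor// -(RintegralB measurableT tc ts).
    rewrite -(Rintegral_measure_eq _ munu) Rintegral_convolution//.
    by apply: eq_Rintegral => p _; rewrite mulrDr cosD.
  have Es : chf_im mu u * chf_re nu u + chf_re mu u * chf_im nu u = chf_im nu u.
    rewrite /chf_re /chf_im -!Rintegral_tensor// -(RintegralD measurableT tsc tcs).
    rewrite -(Rintegral_measure_eq _ munu) Rintegral_convolution//.
    by apply: eq_Rintegral => p _; rewrite mulrDr sinD.
  move: (nu0 u) Ec Es; set a := chf_re mu u; set b := chf_im mu u.
  set c := chf_re nu u; set s := chf_im nu u => n0 Ec Es.
  split; apply: (mulIf n0).
    transitivity (c * (a * c - b * s) + s * (b * c + a * s)); first ring.
    by rewrite Ec Es; ring.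
  transitivity (c * (b * c + a * s) - s * (a * c - b * s)); first ring.
  by rewrite Ec Es; ring.
have imu f : bounded_continuous f -> mu.-integrable [set: R] (EFin \o f).
  exact: bounded_continuous_integrable.
suff H : (fun _ : nat => \int[mu]_x k x - k 0) @ \oo --> (0 : R).
  by apply/eqP; rewrite -subr_eq0; apply/eqP; exact: (cvg_unique (@Rhausdorff R) (cvg_cst _) H).
apply: (@trigonometric_vanish R (fun _ k => \int[mu]_x k x - k 0)) => //.
- move=> _ a f g bf bg.
  rewrite (RintegralD measurableT (integrable_scale a (imu _ bf)) (imu _ bg)).
  by rewrite (RintegralZl a measurableT (imu _ bf)); ring.
- exists 2; apply: nearW => _ f B bf fB; rewrite (le_trans (ler_normB _ _))//.
  rewrite mulr_natl mulr2n lerD//; apply: normr_Rintegral_bounded => //.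
  exact: bounded_continuous_measurable.
- move=> e e0; have [M hM] := cutoff_tight mu e0.
  exists (`|M| + 1); apply: nearW => _ f bf f1 fM.
  rewrite fM ?normr0 ?addr_ge0// subr0.
  have iM := imu _ (bounded_continuous_cutoff M).
  have : `|\int[mu]_x f x| <= \int[mu]_x (1 - cutoff M x).
    apply: normr_Rintegral_le.
    - exact: bounded_continuous_measurable.
    - exact: integrable_sub (integrable_const _ _) iM.
    - move=> x; have [xM|xM] := leP `|x| (`|M| + 1).
        by rewrite fM// normr0 subr_ge0 cutoff_le1.
      by rewrite cutoff_eq0 ?subr0// (le_trans _ (ltW xM))// lerD2r ler_norm.
  rewrite (RintegralB measurableT (integrable_const _ _) iM) Rintegral_prob_cst; lra.
- move=> u; rewrite mulr0 cos0 -/(chf_re mu u) (chf u).1 subrr; exact: cvg_cst.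
- move=> u; rewrite mulr0 sin0 -/(chf_im mu u) (chf u).2 subrr; exact: cvg_cst.
Qed.

Lemma normal_law_chf_neq0 (m s : R) u : s != 0 ->
  chf_re (normal_law m s) u ^+ 2 + chf_im (normal_law m s) u ^+ 2 != 0.
Proof.
move=> s0.
have shift f : bounded_continuous f ->
    \int[normal_law m s]_x f x = \int[normal_law 0 s]_x f (x + m).
  move=> bf; have := Rintegral_normal_law_affine 0 m ltr01 s0 bf.
  rewrite mulr0 add0r mul1r => ->.
  by apply: eq_Rintegral => x _; rewrite mul1r.
have Ec : chf_re (normal_law m s) u = cos (u * m) * chf_re (normal_law 0 s) u -
    sin (u * m) * chf_im (normal_law 0 s) u.
  by rewrite -chf_re_shift; exact: shift (bounded_continuous_cos u).
have Es : chf_im (normal_law m s) u = sin (u * m) * chf_re (normal_law 0 s) u +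
    cos (u * m) * chf_im (normal_law 0 s) u.
  by rewrite -chf_im_shift; exact: shift (bounded_continuous_sin u).
have := normal_chf_neq0 s0 u; have := cos2Dsin2 (u * m).
rewrite Ec Es; set c := cos _; set t := sin _; set a := chf_re _ _; set b := chf_im _ _ => ct.
rewrite (_ : (c * a - t * b) ^+ 2 + (t * a + c * b) ^+ 2 = (c ^+ 2 + t ^+ 2) * (a ^+ 2 + b ^+ 2)).
  by rewrite ct mul1r.
ring.
Qed.

Lemma cvg_probability_point_mass d (T : nat -> measurableType d)
    (P : forall n, probability (T n) R) (Z : forall n, {mfun T n >-> R}) nu :
  (forall k, bounded_continuous k -> \int[P n]_x k (Z n x) @[n --> \oo] --> \int[nu]_z k z) ->
  (forall e : R, 0 < e -> P n [set x | e%:E < `|(Z n x)%:E|]%E @[n --> \oo] --> 0%E) <->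
  measure_eq nu (dirac (0 : R)).
Proof.
move=> Znu.
have mB n e : measurable [set x | e%:E < `|(Z n x)%:E|]%E.
  rewrite (_ : [set x | _] = [set: T n] `&` [set x | e%:E < (`|Z n x|)%:E]%E).
    by apply: measurable_lte => //; apply/measurable_EFinP; apply: measurableT_comp.
  by rewrite setTI.
have iB n e : (P n).-integrable [set: T n]
    (EFin \o (\1_[set x | e%:E < `|(Z n x)%:E|]%E : T n -> R)).
  by apply: integrable_indic => //; exact: mB.
have IB n e : \int[P n]_x (\1_[set x | e%:E < `|(Z n x)%:E|]%E x : R) =
    fine (P n [set x | e%:E < `|(Z n x)%:E|]%E).
  by rewrite /Rintegral integral_indic ?setIT//; exact: mB.
have ik n k : bounded_continuous k -> (P n).-integrable [set: T n] (EFin \o (fun x => k (Z n x))).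
  move=> bk; apply: integrable_bounded; last by have [_ [B kB]] := bk; exists B.
  by apply: measurableT_comp => //; exact: bounded_continuous_measurable.
split=> [Z0|nu0].
  apply: bounded_continuous_point_mass => k bk.
  have [ck [B0 kB0]] := bk; pose B := `|B0| + 1.
  have kB x : `|k x| <= B by rewrite (le_trans (kB0 x))// (le_trans (ler_norm _))// lerDl.
  have B_gt0 : 0 < B by rewrite ltr_wpDl.
  suff H : \int[P n]_x k (Z n x) @[n --> \oo] --> k 0.
    exact: (cvg_unique (@Rhausdorff R) (Znu _ bk) H).
  apply/cvgrPdist_le => e e0; have e2 : 0 < e / 2 by rewrite divr_gt0.
  have /cvgrPdist_le/(_ _ e2) := ck 0; move=> /nbhs_ballP[dl /= dl0 hdl].
  have dl2 : 0 < dl / 2 by rewrite divr_gt0.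
  have /fine_cvg/cvgrPdist_le := Z0 _ dl2.
  have eB : 0 < e / 2 / (2 * B) by rewrite divr_gt0// mulr_gt0.
  move=> /(_ _ eB); apply: filterS => n.
  rewrite /= sub0r normrN ger0_norm ?fine_ge0// -IB => hn.
  rewrite distrC -[k 0](Rintegral_prob_cst (P n)).
  rewrite -(RintegralB measurableT (ik n _ bk) (integrable_const _ _)).
  have i2 := integrable_add (integrable_const (P n) (e / 2)) (integrable_scale (2 * B) (iB n (dl / 2))).
  apply: (@le_trans _ _ (\int[P n]_x (e / 2 + 2 * B * \1_[set x | (dl / 2)%:E < `|(Z n x)%:E|]%E x))).
    apply: normr_Rintegral_le => //.
      by apply: measurable_funB => //; apply: measurableT_comp => //; exact: bounded_continuous_measurable.
    move=> x; rewrite indicE; have [_|] := boolP (x \in _).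
      by rewrite mulr1 (le_trans (ler_normB _ _))//; have := kB (Z n x); have := kB 0; lra.
    rewrite notin_setE /= => /negP; rewrite -leNgt lee_fin => Zd.
    rewrite mulr0 addr0 distrC; apply: hdl.
    by rewrite /ball/= sub0r normrN (le_lt_trans Zd)// ltr_pdivrMr// mulr_natr mulr2n ltrDl.
  rewrite (RintegralD measurableT (integrable_const _ _) (integrable_scale _ (iB n _))).
  rewrite Rintegral_prob_cst (RintegralZl _ measurableT (iB n _)).
  have : 2 * B * \int[P n]_x (\1_[set x | (dl / 2)%:E < `|(Z n x)%:E|]%E x : R) <= e / 2.
    by rewrite mulrC -ler_pdivlMr// mulr_gt0.
  lra.
move=> e e0; pose k (z : R) := ramp (`|z| / e).
have bk : bounded_continuous k.
  apply: bounded_continuous_ramp => z; apply: cvgM; last exact: cvg_cst.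
  exact: norm_continuous.
have := Znu _ bk; rewrite (Rintegral_point_mass _ nu0); last exact: bounded_continuous_measurable.
rewrite {2}/k normr0 mul0r ramp_eq0// => k0.
apply/fine_cvgP; split; first by apply: nearW => n; exact: fin_num_measure (mB n e).
apply: (squeeze_cvgr _ (cvg_cst 0) k0); apply: nearW => n /=.
rewrite fine_ge0//= -IB; apply: (le_Rintegral measurableT (iB n e) (ik n _ bk)) => x _.
rewrite indicE; have [|_] := boolP (x \in _); last by rewrite ramp_ge0.
by rewrite inE /= lte_fin => ez; rewrite /k ramp_eq1// ler_pdivlMr// mul1r ltW.
Qed.

End point_mass.

(** * The convolution theorem *)

Lemma Rintegral_distribution_bounded d (T : measurableType d) d' (T' : measurableType d')
    (R : realType) (P : probability T R) (X : {mfun T >-> T'}) (f : T' -> R) B :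
  measurable_fun [set: T'] f -> (forall x, `|f x| <= B) ->
  \int[distribution P X]_x f x = \int[P]_x f (X x).
Proof.
move=> mf fB; rewrite /Rintegral integral_distribution//; first exact/measurable_EFinP.
by apply: integrable_bounded; [exact: measurableT_comp|exists B => x; exact: fB].
Qed.

Lemma weak_cvg_distribution d (T : nat -> measurableType d) (R : realType)
    (P : forall n, probability (T n) R) (X : forall n, {mfun T n >-> R}) (nu : probability R R) :
  weak_cvg (fun n => distribution (P n) (X n)) nu <->
  forall f, bounded_continuous f -> \int[P n]_x f (X n x) @[n --> \oo] --> \int[nu]_x f x.
Proof.
rewrite weak_cvgP; split=> H f bf; have [_ [B fB]] := bf; have mf := bounded_continuous_measurable bf.
  have := H f bf; rewrite (_ : (fun n => _) = fun n => \int[P n]_x f (X n x))//.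
  by apply/funext => n; rewrite (Rintegral_distribution_bounded _ _ mf fB).
rewrite (_ : (fun n => _) = fun n => \int[P n]_x f (X n x)); first exact: H.
by apply/funext => n; rewrite (Rintegral_distribution_bounded _ _ mf fB).
Qed.

Section coordinates.
Context (R : realType).
Variables (mu nu : probability R R).

Definition fst_rv : {RV (mu \x nu)%E >-> R} := mfun_Sub (mem_set (@measurable_fst _ _ R R)).
Definition snd_rv : {RV (mu \x nu)%E >-> R} := mfun_Sub (mem_set (@measurable_snd _ _ R R)).

Lemma independent_coordinates : independent_rv fst_rv snd_rv.
Proof.
move=> A B mA mB.
have -> : fst_rv @^-1` A `&` snd_rv @^-1` B = A `*` B by [].
have -> : fst_rv @^-1` A = A `*` setT by apply/seteqP; split => p //= [].
have -> : snd_rv @^-1` B = setT `*` B by apply/seteqP; split => p //= [].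
have E (C D : set R) : measurable C -> measurable D ->
    (mu \x nu)%E (C `*` D) = (mu C * nu D)%E by exact: product_measure1E.
transitivity (mu A * nu B)%E; first exact: E.
congr (_ * _)%E; apply/esym.
  by transitivity (mu A * nu setT)%E; [exact: E|rewrite probability_setT mule1].
by transitivity (mu setT * nu B)%E; [exact: E|rewrite probability_setT mul1e].
Qed.

Lemma distribution_coordinates :
  measure_eq (distribution (mu \x nu)%E (pair_fun fst_rv snd_rv)) (mu \x nu)%E.
Proof.
move=> A mA; rewrite /distribution /pushforward /=.
have -> : pair_fun fst_rv snd_rv @^-1` A = A by apply/seteqP; split => -[].
by [].
Qed.

End coordinates.

Theorem theorem2 (R : realType) (d : measure_display) (Omega : measurableType d)
    (P : R -> probability Omega R) (theta0 : R) (Theta : set R) (sigma : R)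
    (X T : forall n, {mfun n.-tuple Omega >-> R}) (Q : probability R R) :
  Theta 0 ->
  LAN P theta0 Theta sigma X ->
  interior (closure Theta) !=set0 ->
  regular_estimators P theta0 Theta T Q ->
  [/\ (forall theta, Theta theta ->
        exists (d' : measure_display) (Omega' : measurableType d')
               (P' : probability Omega' R) (X' Z' : {RV P' >-> R}),
          independent_rv X' Z' /\
          weak_cvg2
            (fun n => distribution (local_prob P theta0 theta n)
               (pair_fun (X n) (norm_rest theta0 sigma (X n) (T n))))
            (distribution P' (pair_fun X' Z'))),
      (exists nu : probability R R,
        [/\ weak_cvg
              (fun n => distribution (local_prob P theta0 0 n)
                 (norm_rest theta0 sigma (X n) (T n))) nu,
            (forall theta, Theta theta ->
              weak_cvg
                (fun n => distribution (local_prob P theta0 theta n)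
                   (norm_rest theta0 sigma (X n) (T n))) nu),
            (forall theta, Theta theta ->
              weak_cvg2
                (fun n => distribution (local_prob P theta0 theta n)
                   (pair_fun (X n) (norm_rest theta0 sigma (X n) (T n))))
                (normal_law (theta * sigma ^+ 2) sigma \x nu)%E) &
            (forall theta, Theta theta ->
              measure_eq (convolution Q (dirac theta))
                         (convolution nu (normal_law theta (1 / sigma))))]) &
      (asymptotically_efficient P theta0 sigma X T <->
       exists theta, Theta theta /\
         measure_eq (convolution Q (dirac theta)) (normal_law theta (1 / sigma)))].
Proof.
move=> Theta0 [sigma_gt0 lan central] Theta_int regular.
have sigma0 : sigma != 0 by rewrite gt_eqF.
pose Pl theta n := local_prob P theta0 theta n.
pose Z n : {mfun n.-tuple Omega >-> R} := norm_rest theta0 sigma (X n) (T n).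
have [nu hnu] : exists nu : probability R R, forall theta F G,
    Theta theta -> bounded_continuous F -> bounded_continuous G ->
    \int[Pl theta n]_x (F (X n x) * G (Z n x)) @[n --> \oo] -->
    \int[normal_law (theta * sigma ^+ 2) sigma]_x F x * \int[nu]_z G z.
  apply: (@regular_limit _ (fun n => n.-tuple Omega) R sigma Theta Pl X
    (fun n => norm_error theta0 (T n)) Q sigma_gt0 Theta0 Theta_int lan).
    exact/weak_cvg_distribution.
  move=> theta k Tt bk; rewrite -Rintegral_convolution_dirac//.
  by have /weak_cvg_distribution := regular theta Tt; apply.
have rest theta : Theta theta ->
    weak_cvg (fun n => distribution (Pl theta n) (Z n)) nu.
  move=> Tt; apply/(@weak_cvg_distribution _ (fun n => n.-tuple Omega)) => G bG.
  have := hnu theta _ G Tt (bounded_continuous_cst 1) bG.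
  rewrite Rintegral_prob_cst mul1r.
  rewrite (_ : (fun n => _) = fun n => \int[Pl theta n]_x G (Z n x))//.
  by apply/funext => n; apply: eq_Rintegral => x _; rewrite mul1r.
have joint theta : Theta theta ->
    weak_cvg2 (fun n => distribution (Pl theta n) (pair_fun (X n) (Z n)))
      (normal_law (theta * sigma ^+ 2) sigma \x nu)%E.
  move=> Tt; apply: weak_cvg2_tensor => F G bF bG; rewrite Rintegral_tensor//.
  have := hnu theta F G Tt bF bG.
  rewrite (_ : (fun n => _) = fun n =>
    \int[distribution (Pl theta n) (pair_fun (X n) (Z n))]_p (F p.1 * G p.2))//.
  apply/funext => n; have [_ [B FB]] := bF; have [_ [C GC]] := bG.
  rewrite (@Rintegral_distribution_bounded _ _ _ _ _ _ _ (fun p => F p.1 * G p.2) (B * C))//.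
    apply: measurable_funM.
      by apply: measurableT_comp; [exact: bounded_continuous_measurable|exact: measurable_fst].
    by apply: measurableT_comp; [exact: bounded_continuous_measurable|exact: measurable_snd].
  by move=> p; rewrite normrM ler_pM.
have conv theta : Theta theta ->
    measure_eq (convolution Q (dirac theta)) (convolution nu (normal_law theta (1 / sigma))).
  move=> Tt; apply: probability_bounded_continuous_eq => f bf f0.
  rewrite (convolution_normal_law _ _ sigma_gt0 bf f0).
  have [cf [B fB]] := bf; pose g (p : R * R) := f (p.2 + p.1 / sigma ^+ 2).
  have cg : continuous g.
    move=> p; apply: (@continuous_comp _ _ _ (fun p : R * R => p.2 + p.1 / sigma ^+ 2) f); last exact: cf.
    apply: cvgD; first exact: cvg_snd.
    by apply: cvgM; [exact: cvg_fst|exact: cvg_cst].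
  have gB p : `|g p| <= B by exact: fB.
  have mg : measurable_fun [set: R * R] g by apply: continuous_measurable_fun2 => //; exists B.
  have ig (m : probability (R * R)%type R) : m.-integrable [set: R * R] (EFin \o g).
    by apply: integrable_bounded => //; exists B.
  have := joint theta Tt g cg (ex_intro _ B gB); rewrite integral_EFin// => /fine_cvg H.
  have /weak_cvg_distribution/(_ f bf) H' := regular theta Tt.
  apply: (cvg_unique (@Rhausdorff R) H' _).
  rewrite (_ : (fun n => _) = fun n => \int[distribution (Pl theta n) (pair_fun (X n) (Z n))]_p g p)//.
  apply/funext => n; rewrite (Rintegral_distribution_bounded _ _ mg gB).
  by apply: eq_Rintegral => x _; rewrite /g /= /Z /norm_rest subrK.
split.
- move=> theta Tt.
  exists _, _, (normal_law (theta * sigma ^+ 2) sigma \x nu)%E, (fst_rv _ _), (snd_rv _ _).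
  split; first exact: independent_coordinates.
  move=> f cf fB; have := joint theta Tt f cf fB.
  set m := (normal_law _ _ \x nu)%E; set m' := distribution _ _ in f cf fB *.
  suff -> : (\int[m']_x (f x)%:E = \int[m]_x (f x)%:E)%E by [].
  by apply: eq_measure_integral => A mA _; exact: distribution_coordinates.
- by exists nu; split=> //; exact: rest.
- rewrite /asymptotically_efficient /cvg_in_prob0.
  have /weak_cvg_distribution/cvg_probability_point_mass -> := rest 0 Theta0.
  split=> [nu0|[theta [Tt QN]]].
    exists 0; split=> // A mA; rewrite conv//.
    exact: convolution_point_mass0.
  apply: (convolution_cancel (nu := normal_law theta (1 / sigma))).
    by move=> u; apply: normal_law_chf_neq0; rewrite mulf_neq0// ?oner_neq0 ?invr_eq0.
  by move=> A mA; rewrite -conv// QN.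
Qed.
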